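(* Let $V$ be a finite even-dimensional real vector space with a fixed volume form, let $\mathcal{Q}=S^2V^*$, and let $M$ be a manifold of dimension $d$. (i) Every fitting immersion $u:M\to\mathrm{Gr}_d^{\mathrm{mix}}(\mathcal{Q})$ admits a fitting flow. (ii) Let $\rho:\Gamma\to \mathrm{SL}(V)$ be a representation of a group $\Gamma$ acting properly on $M$. Every $\rho$-equivariant fitting immersion $u:M\to\mathrm{Gr}_d^{\mathrm{mix}}(\mathcal{Q})$ admits a $\rho$-equivariant fitting flow.
   Context: $S^2V$ is the space of symmetric tensors and $\mathcal{Q}=S^2V^*$ its dual, the space of symmetric bilinear forms on $V$, with the natural actions of $\mathrm{SL}(V)$ and the pairing $q(s)=\mathrm{Tr}(q\circ s)$. $S^2V^{>0}$ is the set of positive definite tensors; a form $q\in\mathcal{Q}$ is positive if positive definite. $\mathrm{Gr}_d(\mathcal{Q})$ is the Grassmannian of $d$-dimensional subspaces (pencils) of $\mathcal{Q}$; for a pencil $P$, $P^\circ=\{s\in S^2V: q(s)=0\ \forall q\in P\}$; $P$ is mixed if $P^\circ\cap S^2V^{>0}\neq\emptyset$, and $\mathrm{Gr}_d^{\mathrm{mix}}(\mathcal{Q})$ is the set of mixed pencils. Identify $T_P\mathrm{Gr}_d(\mathcal{Q})=\mathrm{Hom}(P,\mathcal{Q}/P)$. A tangent vector is fitting if its image in $\mathcal{Q}/P$ contains the class of some positive $q\in\mathcal{Q}$. A smooth immersion $u:M\to\mathrm{Gr}_d^{\mathrm{mix}}(\mathcal{Q})$ of a $d$-manifold is a fitting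 immersion if $\mathrm{d}u(w)$ is fitting for every non-zero $w\in TM$. For a continuous map $u:M\to\mathrm{Gr}_d(\mathcal{Q})$ let $u^*\mathcal{E}=\{(x,q):x\in M,\ q\in u(x)\}$ and let $\mathbb{S}u^*\mathcal{E}$ be the sphere bundle over $M$ obtained by removing the zero section and quotienting by positive scalars. A fitting flow for $u$ is a continuous flow $(\Phi_t)_{t\in\mathbb{R}}$ on $\mathbb{S}u^*\mathcal{E}$ such that for all $(x,[q])$ and all $t>0$, writing $\Phi_t(x,[q])=(x',[q'])$, one can choose representatives with $q'-q$ positive. It is $\rho$-equivariant if it commutes with $\gamma\cdot(x,[q])=(\gamma x,[\rho(\gamma)\cdot q])$. *)

(* Defs.v *)
From HB Require Import structures.
From mathcomp Require Import all_boot all_order all_algebra.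
From mathcomp Require Import all_classical all_reals all_analysis.
Import Order.TTheory GRing.Theory Num.Theory.
Import numFieldNormedType.Exports.

Set Implicit Arguments.
Unset Strict Implicit.
Unset Printing Implicit Defensive.

Local Open Scope classical_set_scope.
Local Open Scope ring_scope.
Local Open Scope quotient_scope.

Definition replace (I : eqType) (T : Type) (f : I -> T) (i : I) (x : T) : I -> T :=
  fun j => if j == i then x else f j.

Definition volume_form (R : realType) (V : vectType R)
    (vol : ('I_(\dim {:V}) -> V) -> R) : Prop :=
  [/\ forall (f : 'I_(\dim {:V}) -> V) i (c : R) (x y : V),
        vol (replace f i (c *: x + y)) =
        c * vol (replace f i x) + vol (replace f i y),
      forall (f : 'I_(\dim {:V}) -> V) i j, i != j -> f i = f j -> vol f = 0
    & exists f, vol f <> 0].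

Definition SL (R : realType) (V : vectType R)
    (vol : ('I_(\dim {:V}) -> V) -> R) : set 'End(V) :=
  [set g : 'End(V) | forall f, vol (fun i => g (f i)) = vol f].

Lemma linfun_linear (R : realType) (V W : vectType R) (f : V -> W) :
  linear f -> linfun f =1 f.
Proof.
move=> fl; pose g : {linear V -> W} :=
  HB.pack f (GRing.isLinear.Build _ _ _ _ f fl).
exact: (lfunE g).
Qed.

Lemma linfun_bilinear (R : realType) (V W : vectType R) (B : V -> V -> W) :
  (forall v, linear (B v)) -> (forall w, linear (B^~ w)) ->
  forall v w, linfun (fun v => linfun (B v)) v w = B v w.
Proof.
move=> Br Bl v w; rewrite linfun_linear ?linfun_linear//.
move=> c x y; apply/lfunP => z.
by rewrite add_lfunE scale_lfunE !linfun_linear// Bl.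
Qed.

Definition transpose_form (R : realType) (V : vectType R)
    (q : 'Hom(V, 'Hom(V, R^o))) : 'Hom(V, 'Hom(V, R^o)) :=
  linfun (fun v => linfun (fun w => q w v)).

Lemma transpose_formE (R : realType) (V : vectType R)
  (q : 'Hom(V, 'Hom(V, R^o))) v w : transpose_form q v w = q w v.
Proof.
apply: (linfun_bilinear (B := fun v w => q w v)) => [{}v|{}w] c x y.
  by rewrite linearP add_lfunE scale_lfunE.
exact: linearP.
Qed.

Definition symmetric_forms (R : realType) (V : vectType R) :
    {vspace 'Hom(V, 'Hom(V, R^o))} :=
  lker (\1 - linfun (@transpose_form R V))%VF.

Lemma symmetric_formsP (R : realType) (V : vectType R)
    (q : 'Hom(V, 'Hom(V, R^o))) :
  q \in symmetric_forms V <-> forall v w, q v w = q w v.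
Proof.
have tl : linear (@transpose_form R V).
  move=> c x y; apply/lfunP => v; apply/lfunP => w.
  by rewrite !(add_lfunE, scale_lfunE, transpose_formE).
rewrite memv_ker add_lfunE opp_lfunE id_lfunE linfun_linear// subr_eq0.
split=> [/eqP qE v w|qC]; first by rewrite [in LHS]qE transpose_formE.
by apply/eqP/lfunP => v; apply/lfunP => w; rewrite transpose_formE.
Qed.

(* A form q is encoded as the map V -> V^* it induces, and an element of S^2V as
   a symmetric map V^* -> V, so that the pairing is the trace of q \o s. *)
Definition qform (R : realType) (V : vectType R) : Type :=
  subvs_of (symmetric_forms V).
HB.instance Definition _ (R : realType) (V : vectType R) :=
  Vector.copy (qform V) (subvs_of (symmetric_forms V)).

Definition qeval (R : realType) (V : vectType R) (q : qform V) (v w : V) : R :=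
  vsval q v w.

Lemma qeval_linear (R : realType) (V : vectType R) (c : R) (p q : qform V)
    (v w : V) : qeval (c *: p + q) v w = c * qeval p v w + qeval q v w.
Proof.
have -> : qeval (c *: p + q) v w = (c *: vsval p + vsval q) v w by [].
by rewrite !(add_lfunE, scale_lfunE).
Qed.

Definition positive (R : realType) (V : vectType R) (q : qform V) : Prop :=
  forall v, v <> 0 -> 0 < qeval q v v.

Definition symmetric_tensor (R : realType) (V : vectType R)
    (s : 'Hom('Hom(V, R^o), V)) : Prop :=
  forall a b : 'Hom(V, R^o), a (s b) = b (s a).

Definition positive_tensor (R : realType) (V : vectType R)
    (s : 'Hom('Hom(V, R^o), V)) : Prop :=
  symmetric_tensor s /\
  forall a : 'Hom(V, R^o), a <> 0 -> (0 : R) < a (s a).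

Definition lfun_trace (R : realType) (W : vectType R) (f : 'End(W)) : R :=
  \sum_i coord (vbasis {:W}) i (f (vbasis {:W})`_i).

Definition pairing (R : realType) (V : vectType R) (q : qform V)
    (s : 'Hom('Hom(V, R^o), V)) : R :=
  lfun_trace (vsval q \o s)%VF.

(* [(g^-1)%VF] is the inverse of g when g is bijective (a junk value otherwise);
   the definition unfolds as in [act_formE]. *)
Definition act_form (R : realType) (V : vectType R) (g : 'End(V)) :
    'End(qform V) :=
  linfun (fun q : qform V => vsproj (symmetric_forms V)
    (linfun (fun v => vsval q ((g^-1)%VF v) \o g^-1)%VF) : qform V).

Lemma act_formE (R : realType) (V : vectType R) (g : 'End(V)) (q : qform V)
    (v w : V) :
  qeval (act_form g q) v w = qeval q ((g^-1)%VF v) ((g^-1)%VF w).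
Proof.
have lE (p : qform V) x :
    linfun (fun v => vsval p ((g^-1)%VF v) \o g^-1)%VF x =
    (vsval p ((g^-1)%VF x) \o g^-1)%VF.
  rewrite linfun_linear// => c y z; apply/lfunP => t.
  by rewrite !(add_lfunE, scale_lfunE, comp_lfunE, linearP).
have sE (p : qform V) : vsval (vsproj (symmetric_forms V)
    (linfun (fun v => vsval p ((g^-1)%VF v) \o g^-1)%VF)) =
    linfun (fun v => vsval p ((g^-1)%VF v) \o g^-1)%VF.
  rewrite vsprojK//; apply/symmetric_formsP => x y.
  rewrite !lE !comp_lfunE.
  by have /symmetric_formsP := subvsP p; exact.
rewrite /act_form linfun_linear; first by rewrite /qeval sE lE comp_lfunE.
move=> c y z; apply: val_inj; apply/lfunP => x; apply/lfunP => t.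
rewrite -!/(qeval _ x t) qeval_linear /qeval !sE !lE !comp_lfunE.
exact: qeval_linear.
Qed.

Definition mixed (R : realType) (V : vectType R) (P : {vspace qform V}) : Prop :=
  exists2 s, positive_tensor s & forall q, q \in P -> pairing q s = 0.

Definition Gr (R : realType) (V : vectType R) (d : nat) :
    set {vspace qform V} := [set P : {vspace qform V} | \dim P = d].
Arguments Gr {R} V d.

Definition Gr_mix (R : realType) (V : vectType R) (d : nat) :
    set {vspace qform V} := [set P | Gr V d P /\ mixed P].
Arguments Gr_mix {R} V d.

(* The standard chart of the Grassmannian centred at P: a pencil P' with
   P' :&: P^C = 0 is the graph of a unique linear map A : P -> P^C, which is
   encoded as the endomorphism equal to A on P and to 0 on P^C. *)
Definition gr_chart (R : realType) (W : vectType R) (P P' : {vspace W}) :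
    'End(W) := (daddv_pi P' P^C - daddv_pi P P^C)%VF.

Lemma gr_chartP (R : realType) (W : vectType R) (P P' : {vspace W}) :
  \dim P = \dim P' -> (P' :&: P^C = 0)%VS ->
  [/\ forall q, gr_chart P P' q \in (P^C)%VS,
      forall q, q \in (P^C)%VS -> gr_chart P P' q = 0 &
      forall q, q \in P' <-> exists2 p, p \in P & q = p + gr_chart P P' p].
Proof.
move=> dP tr.
have full : (P' + P^C = fullv)%VS.
  apply/eqP; rewrite eqEdim subvf dimv_disjoint_sum// -dP.
  by rewrite -dimv_disjoint_sum ?capv_compl// addv_complf /= leqnn.
have d1 q : daddv_pi P' P^C q = q - daddv_pi P^C P' q.
  by apply/eqP; rewrite eq_sym subr_eq daddv_pi_add// full memvf.
have d2 q : daddv_pi P P^C q = q - daddv_pi P^C P q.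
  apply/eqP; rewrite eq_sym subr_eq daddv_pi_add ?capv_compl//.
  by rewrite addv_complf memvf.
have k1 q : q \in (P^C)%VS -> daddv_pi P' P^C q = 0.
  by move=> qC; rewrite d1 daddv_pi_id ?subrr// capvC.
have k2 q : q \in (P^C)%VS -> daddv_pi P P^C q = 0.
  by move=> qC; rewrite d2 daddv_pi_id ?subrr// capvC capv_compl.
have cE q : gr_chart P P' q = daddv_pi P' P^C q - daddv_pi P P^C q.
  by rewrite /gr_chart add_lfunE opp_lfunE.
have cP p : p \in P -> p + gr_chart P P' p = daddv_pi P' P^C p.
  by move=> pP; rewrite cE (daddv_pi_id _ pP) ?capv_compl// addrC subrK.
split=> [q|q qC|q].
- have -> : gr_chart P P' q = daddv_pi P^C P q - daddv_pi P^C P' q.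
    by rewrite cE d1 d2 opprB addrC addrA subrK.
  by rewrite rpredB// memv_pi.
- by rewrite cE k1// k2// subrr.
split=> [qP'|[p pP ->]]; last by rewrite cP// memv_pi.
exists (daddv_pi P P^C q); first exact: memv_pi.
rewrite cP ?memv_pi// d2 linearB [X in _ - X]k1 ?memv_pi// subr0.
by rewrite -[RHS]/(daddv_pi P' P^C q) daddv_pi_id.
Qed.

Definition coords (R : realType) (W : vectType R) (w : W) :
    'rV[R]_(\dim {:W}) := passmx.rVof (vbasis {:W}) w.

(* All partial derivatives of order at most k exist and are continuous on U;
   only meaningful for U open, since ['D_v f] is a junk value where f is not
   derivable. *)
Fixpoint Ck (R : realType) (d k : nat) (U : set 'rV[R]_d) (f : 'rV[R]_d -> R) :
    Prop :=
  (forall z, U z -> {for z, continuous f}) /\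
  if k is k'.+1 then
    forall i : 'I_d, (forall z, U z -> derivable f z (delta_mx 0 i)) /\
                     Ck k' U ('D_(delta_mx 0 i) f)
  else True.

Definition smooth_at (R : realType) (d : nat) (W : vectType R)
    (f : 'rV[R]_d -> W) (z : 'rV[R]_d) : Prop :=
  exists U : set 'rV[R]_d, [/\ open U, U z &
    forall k i, Ck k U (fun y => coords (f y) 0 i)].

Definition dir_derive (R : realType) (d : nat) (W : vectType R)
    (f : 'rV[R]_d -> W) (z w : 'rV[R]_d) : W :=
  passmx.vecof (vbasis {:W}) ('D_w (fun y => coords (f y)) z).

(* The usual topology, transported from R^N by a basis. *)
HB.instance Definition _ (R : realType) (V : vectType R) :=
  Topological.copy (qform V) (initial_topology (@coords R (qform V))).

Record chart (R : realType) (d : nat) (M : topologicalType) := Chart {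
  chart_dom : set M;
  chart_fun :> M -> 'rV[R]_d;
  chart_inv : 'rV[R]_d -> M;
  chart_dom_open : open chart_dom;
  chart_cod_open : open (chart_fun @` chart_dom);
  chart_funK : forall x, chart_dom x -> chart_inv (chart_fun x) = x;
  chart_fun_continuous :
    forall x, chart_dom x -> {for x, continuous chart_fun};
  chart_inv_continuous :
    forall x, chart_dom x -> {for chart_fun x, continuous chart_inv} }.

(* A manifold is Hausdorff, second countable, and carries a smooth atlas (not
   necessarily maximal). *)
Record manifold (R : realType) (d : nat) := Manifold {
  manifold_sort :> topologicalType;
  atlas : set (chart R d manifold_sort);
  manifold_hausdorff : hausdorff_space manifold_sort;
  manifold_second_countable : @second_countable manifold_sort;
  atlas_cover : forall x, exists2 a, atlas a & chart_dom a x;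
  atlas_smooth : forall a b x, atlas a -> atlas b ->
    chart_dom a x -> chart_dom b x ->
    smooth_at (fun z => b (chart_inv a z)) (a x) }.

Definition smooth_map (R : realType) (d : nat) (M N : manifold R d)
    (f : M -> N) : Prop :=
  continuous f /\
  forall x a b, atlas a -> atlas b -> chart_dom a x -> chart_dom b (f x) ->
    smooth_at (fun z => b (f (chart_inv a z))) (a x).

(* A chart [a] of M at x identifies T_x M with R^d;
   the chart of the Grassmannian centred at P identifies T_P Gr with
   Hom(P, P^C) = Hom(P, Q / P). The differential of u at x is computed in
   these two charts, so a tangent vector to the Grassmannian at P is an
   endomorphism A of Q vanishing on P^C and valued in P^C, standing for
   q in P |-> A q modulo P. *)
Definition smooth_to_Gr (R : realType) (V : vectType R) (d : nat)
    (M : manifold R d) (u : M -> {vspace qform V}) : Prop :=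
  forall x a, atlas a -> chart_dom a x ->
    (\forall y \near x, (u y :&: (u x)^C = 0)%VS) /\
    smooth_at (fun z => gr_chart (u x) (u (chart_inv a z))) (a x).

Definition differential (R : realType) (V : vectType R) (d : nat)
    (M : manifold R d) (u : M -> {vspace qform V}) (x : M) (a : chart R d M)
    (w : 'rV[R]_d) : 'End(qform V) :=
  dir_derive (fun z => gr_chart (u x) (u (chart_inv a z))) (a x) w.

Definition immersion (R : realType) (V : vectType R) (d : nat)
    (M : manifold R d) (u : M -> {vspace qform V}) : Prop :=
  smooth_to_Gr u /\
  forall x a w, atlas a -> chart_dom a x -> w <> 0 ->
    exists2 q, q \in u x & differential u x a w q \notin u x.

Definition fitting (R : realType) (V : vectType R) (P : {vspace qform V})
    (A : 'End(qform V)) : Prop :=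
  exists q p, [/\ q \in P, positive p & p - A q \in P].

Definition fitting_immersion (R : realType) (V : vectType R) (d : nat)
    (M : manifold R d) (u : M -> {vspace qform V}) : Prop :=
  [/\ forall x, Gr_mix V d (u x), immersion u &
      forall x a w, atlas a -> chart_dom a x -> w <> 0 ->
        fitting (u x) (differential u x a w)].

Section SphereBundle.
Context (R : realType) (V : vectType R) (M : topologicalType).
Implicit Type u : M -> {vspace qform V}.

Definition punctured_bundle u : set (M * qform V) :=
  [set e | e.2 \in u e.1 /\ e.2 <> 0].

Definition same_ray u : rel (punctured_bundle u) := fun e e' =>
  `[< (val e).1 = (val e').1 /\
      exists2 c : R, 0 < c & (val e').2 = c *: (val e).2 >].

Lemma same_ray_refl u : reflexive (@same_ray u).
Proof. by move=> e; apply/asboolP; split=> //; exists 1; rewrite ?scale1r. Qed.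

Lemma same_ray_sym u : symmetric (@same_ray u).
Proof.
suff h e e' : @same_ray u e e' -> @same_ray u e' e.
  by move=> e e'; apply/idP/idP; exact: h.
move=> /asboolP[e1 [c c0 e2]]; apply/asboolP; split=> //.
exists c^-1; first by rewrite invr_gt0.
by rewrite e2 scalerA mulVf ?scale1r// gt_eqF.
Qed.

Lemma same_ray_trans u : transitive (@same_ray u).
Proof.
move=> e' e e'' /asboolP[e1 [c c0 e2]] /asboolP[e1' [c' c'0 e2']].
apply/asboolP; split; first by rewrite e1.
by exists (c' * c); [exact: mulr_gt0 | rewrite e2' e2 scalerA].
Qed.

Canonical same_ray_equiv u := EquivRel (@same_ray u)
  (@same_ray_refl u) (@same_ray_sym u) (@same_ray_trans u).

Definition sphere_bundle u : topologicalType :=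
  quotient_topology {eq_quot (same_ray_equiv u)}.

Definition ray u (e : punctured_bundle u) : sphere_bundle u :=
  \pi_(quotient_topology {eq_quot (same_ray_equiv u)}) e.

Lemma ray_eqP u (e e' : punctured_bundle u) :
  reflect (ray e = ray e') (same_ray e e').
Proof. exact: eqquotP. Qed.

Definition flow (S : topologicalType) (Phi : R -> S -> S) : Prop :=
  [/\ continuous (fun p : R * S => Phi p.1 p.2),
      forall e, Phi 0 e = e
    & forall s t e, Phi (s + t) e = Phi s (Phi t e)].

Definition fitting_flow u (Phi : R -> sphere_bundle u -> sphere_bundle u) :
    Prop :=
  flow Phi /\
  forall t (e : sphere_bundle u), 0 < t ->
    exists f f' : punctured_bundle u,
      [/\ ray f = e, ray f' = Phi t e & positive ((val f').2 - (val f).2)].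

End SphereBundle.

Definition smooth_action (R : realType) (d : nat) (M : manifold R d)
    (G : groupType) (act : G -> M -> M) : Prop :=
  [/\ forall x, act 1%g x = x,
      forall g h x, act (g * h)%g x = act g (act h x)
    & forall g, smooth_map (act g)].

(* Properness for a discrete group. *)
Definition proper_action (M : topologicalType) (G : Type) (act : G -> M -> M) :
    Prop :=
  forall K : set M, compact K ->
    finite_set [set g | (act g @` K) `&` K !=set0].

Definition SL_representation (R : realType) (V : vectType R)
    (vol : ('I_(\dim {:V}) -> V) -> R) (G : groupType) (rho : G -> 'End(V)) :
    Prop :=
  [/\ forall g, SL vol (rho g), rho 1%g = \1%VF
    & forall g h, rho (g * h)%g = (rho g \o rho h)%VF].

Definition equivariant (R : realType) (V : vectType R) (M : Type)
    (G : Type) (act : G -> M -> M) (rho : G -> 'End(V))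
    (u : M -> {vspace qform V}) : Prop :=
  forall g x, u (act g x) = (act_form (rho g) @: u x)%VS.

(* The graph of the transformation (x, [q]) |-> (g x, [rho(g) . q]), which maps
   the sphere bundle of u to itself when u is equivariant. *)
Definition moves (R : realType) (V : vectType R) (M : topologicalType)
    (G : Type) (act : G -> M -> M) (rho : G -> 'End(V))
    (u : M -> {vspace qform V}) (g : G) (e e' : sphere_bundle u) : Prop :=
  exists f f' : punctured_bundle u,
    [/\ ray f = e, ray f' = e' &
        val f' = (act g (val f).1, act_form (rho g) (val f).2)].

Definition equivariant_flow (R : realType) (V : vectType R)
    (M : topologicalType) (G : Type) (act : G -> M -> M) (rho : G -> 'End(V))
    (u : M -> {vspace qform V}) (Phi : R -> sphere_bundle u -> sphere_bundle u) :
    Prop :=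
  forall g t e e', moves act rho g e e' -> moves act rho g (Phi t e) (Phi t e').

(* Main.v *)
(* Only part (ii) needs a proof: part (i) is the case of a finite group acting
   trivially. The flow is the flow of a vector field X on the punctured bundle
   N = {(x, q) : q in u x, q <> 0}, invariant under Gamma and under positive
   scalings, and such that q has a positive derivative along X.

   Pointwise, X exists because for q <> 0 in P = u x there are w in T_x M and r in
   P such that du(w) q + r is positive. Otherwise a linear form l on Q, positive on
   the cone of positive forms and vanishing on P and on all du(w) q, would make
   (w, p) |-> l (du(w) p) a bilinear form on T_x M * P, two spaces of dimension d,
   with q in its right kernel; hence some w <> 0 in its left kernel, contradicting
   that du(w) is fitting.

   Such directions are glued over a Gamma-locally finite cover of M by coordinate
   balls with Gamma-equivariant nonnegative weights. Dividing the sum by a function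
   on M / Gamma that is large on each ball makes X complete: every point has a
   coordinate ball of radius r around it on which |X| <= r / 2, so all the solutions
   last a uniform time. Smoothness is only used through C^1 charts with Lipschitz
   derivatives, a locally Lipschitz X, and solutions c characterised by
   c t' - c t - (t' - t) X (c t) = O((t' - t)^2). *)
Require Import Defs.
From HB Require Import structures.
From mathcomp Require Import all_boot all_order all_algebra.
From mathcomp Require Import all_classical all_reals all_analysis.
From mathcomp Require Import perm ring lra.
Import Order.TTheory GRing.Theory Num.Theory.
Import numFieldNormedType.Exports.

Set Implicit Arguments.
Unset Strict Implicit.
Unset Printing Implicit Defensive.

Local Open Scope classical_set_scope.
Local Open Scope ring_scope.

(** * The Euler method *)

(** The sphere bundle is only a topological quotient, without charts, whereas fittingness compares
    actual forms. On the punctured bundle the two ends of a trajectory are themselves the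
    representatives whose difference must be positive, and commutation with scalings is what lets
    the flow descend to rays. Scalings are put on the same footing as Gamma by letting a real s act
    as multiplication by [expR s]: pairs (g, s) act by [scaled_act], and one invariance statement
    yields both the descent and the equivariance. Cut-offs of the form max(0, r - s) and norms of
    row vectors are Lipschitz but not smooth, hence the weak regularity asked of X. The estimate
    with quadratic remainder is the one satisfied by Euler polygons; it survives changes of
    coordinates with Lipschitz derivative and holds from every base time in both directions, so that
    no integral equation is needed. Fibres are not compact either: homogeneity of the field brings
    any form back to fibre coordinates of norm 1, so that bounds on compact sets suffice. *)

Lemma eq_imp_le (R : realType) (x y : R) : x = y -> x <= y.
Proof. by move->. Qed.

Lemma coord_le_norm (R : realType) m n (x : 'M[R]_(m, n)) i j :
  `|x i j| <= `|x|.
Proof.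
rewrite [leRHS]mx_normrE.
exact: (le_bigmax _ (fun k : 'I_m * 'I_n => `|x k.1 k.2|) (i, j)).
Qed.

Lemma norm_le_coord (R : realType) m n (x : 'M[R]_(m, n)) (e : R) :
  0 <= e -> (forall i j, `|x i j| <= e) -> `|x| <= e.
Proof.
move=> e0 h; rewrite [leLHS]mx_normrE.
by apply/bigmax_leP; split => // -[i j] _; exact: h.
Qed.

Lemma le_of_dyadic (R : realType) (x a c : R) :
  (forall n, x <= a + c * 2^-1 ^+ n) -> x <= a.
Proof.
move=> h; apply/ler_addgt0Pr => e e0.
have [c0|c0] := leP c 0.
  apply: (le_trans (h 0%N)); rewrite expr0 mulr1 lerD//.
  exact: (le_trans c0 (ltW e0)).
set n := Num.truncn (c / e); apply: (le_trans (h n.+1)); rewrite lerD2l.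
rewrite exprVn ler_pdivrMr ?exprn_gt0// mulrC -ler_pdivrMr//.
apply: (@le_trans _ _ n.+1%:R); first exact/ltW/truncnS_gt.
by rewrite -natrX ler_nat ltnW// ltn_expl.
Qed.

Lemma le_of_inv_nat (R : realType) (x a c : R) :
  (forall n, x <= a + c / n.+1%:R) -> x <= a.
Proof.
move=> h; apply/ler_addgt0Pr => e e0.
have [c0|c0] := leP c 0.
  apply: (le_trans (h 0%N)); rewrite divr1 lerD//.
  exact: (le_trans c0 (ltW e0)).
set n := Num.truncn (c / e); apply: (le_trans (h n)); rewrite lerD2l.
rewrite ler_pdivrMr ?ltr0n// mulrC -ler_pdivrMr//.
exact/ltW/truncnS_gt.
Qed.

(** The increments from rank n on sum to at most [2 * K * 2^-1 ^+ n]. Convergence is proved entry by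
    entry in R, and the limit keeps this explicit rate, into which the errors of the Euler scheme
    are later absorbed. *)
Lemma geometric_limit (R : realType) m (x : nat -> 'rV[R]_m) (K : R) :
  (forall n, `|x n.+1 - x n| <= K * 2^-1 ^+ n) ->
  exists l, forall n, `|l - x n| <= 2 * K * 2^-1 ^+ n.
Proof.
move=> h; have K0 : 0 <= K.
  by have := h 0%N; rewrite expr0 mulr1; apply: le_trans.
have p0 n : 0 <= K * 2^-1 ^+ n by rewrite mulr_ge0// exprn_ge0// invr_ge0.
(* The factor [1 - 2^-1 ^+ k] makes the induction on k close, with equality. *)
have hnk n k : `|x (n + k)%N - x n| <= 2 * K * 2^-1 ^+ n * (1 - 2^-1 ^+ k).
  elim: k => [|k IH]; first by rewrite addn0 !subrr normr0 mulr0.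
  rewrite addnS -(subrKA (x (n + k)%N)); apply: (le_trans (ler_normD _ _)).
  apply: (le_trans (lerD (h _) IH)); rewrite exprD exprS.
  by apply: eq_imp_le; field.
have hnk' n k : `|x (n + k)%N - x n| <= 2 * K * 2^-1 ^+ n.
  apply: (le_trans (hnk n k)); apply: ler_piMr; last by rewrite gerBl exprn_ge0.
  by rewrite !mulr_ge0 ?exprn_ge0.
have cv j : exists l : R, forall n, `|l - x n 0 j| <= 2 * K * 2^-1 ^+ n.
  pose y n := x n 0 j.
  have hy n k : `|y (n + k)%N - y n| <= 2 * K * 2^-1 ^+ n.
    have := coord_le_norm (x (n + k)%N - x n) 0 j.
    by rewrite !mxE => /le_trans; apply; exact: hnk'.
  have cy : cvgn y.
    apply/cauchy_cvgP/cauchy_ballP => e e0.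
    have [N hN] : exists N, 2 * K * 2^-1 ^+ N < e.
      pose N := Num.truncn (2 * K / e); exists N.+1.
      rewrite exprVn ltr_pdivrMr ?exprn_gt0// [e * _]mulrC -ltr_pdivrMr//.
      apply: (@lt_le_trans _ _ N.+1%:R); first exact: truncnS_gt.
      by rewrite -natrX ler_nat ltnW// ltn_expl.
    have hN2 : 2 * K * 2^-1 ^+ N.+1 < e / 2.
      by rewrite exprS mulrCA [ltLHS]mulrC ltr_pM2r// invr_gt0.
    exists (y @` [set n | (N.+1 <= n)%N], y @` [set n | (N.+1 <= n)%N]).
      by split; exists N.+1 => // n /= Nn; exists n.
    move=> [_ _] [/= [n Nn <-] [k Nk <-]].
    rewrite /ball /=.
    have hn : `|y n - y N.+1| < e / 2.
      by apply: le_lt_trans hN2; rewrite -(subnKC Nn); exact: hy.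
    have hk : `|y k - y N.+1| < e / 2.
      by apply: le_lt_trans hN2; rewrite -(subnKC Nk); exact: hy.
    rewrite -(subrKA (y N.+1)) (splitr e); apply: (le_lt_trans (ler_normD _ _)).
    by rewrite ltrD// distrC.
  exists (limn y) => n.
  have : `|y k - y n| @[k --> \oo] --> `|limn y - y n|.
    by apply: cvg_norm; apply: cvgB => //; exact: cvg_cst.
  move=> /cvg_lim <-//; apply: limr_le.
    by apply/cvg_ex; exists `|limn y - y n|; apply: cvg_norm; apply: cvgB => //;
      exact: cvg_cst.
  by exists n => // k /= nk; rewrite -(subnKC nk); exact: hy.
have [l hl] := choice cv; exists (\row_j l j) => n.
apply: norm_le_coord => [|i j]; last by rewrite !mxE ord1; exact: hl.
by rewrite mulr_ge0 ?exprn_ge0 ?mulr_ge0.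
Qed.

(** A discrete Gronwall inequality, from [1 + a <= expR a] at each step. *)
Lemma discrete_gronwall (R : realType) (D : nat -> R) (a b : R) n :
  0 <= a -> 0 <= b -> 0 <= D 0%N ->
  (forall k, (k < n)%N -> D k.+1 <= (1 + a) * D k + b) ->
  D n <= expR (a * n%:R) * (D 0%N + b * n%:R).
Proof.
move=> a0 b0 D0; elim: n => [|n IH] h.
  by rewrite !mulr0 expR0 mul1r addr0.
have {}IH : D n <= expR (a * n%:R) * (D 0%N + b * n%:R).
  by apply: IH => k kn; apply: h; exact: ltnW.
apply: (le_trans (h n (ltnSn n))).
have e1 : 1 <= expR (a * n.+1%:R) by rewrite -expR0 ler_expR mulr_ge0.
have e2 : (1 + a) * expR (a * n%:R) <= expR (a * n.+1%:R).
  rewrite -natr1 mulrDr mulr1 [a * n%:R + a]addrC expRD ler_pM2r ?expR_gt0//.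
  exact: expR_ge1Dx.
apply: (@le_trans _ _ ((1 + a) * (expR (a * n%:R) * (D 0%N + b * n%:R)) + b)).
  by rewrite lerD2r ler_wpM2l// addr_ge0.
rewrite mulrA; set s := D 0%N + _.
have s0 : 0 <= s by rewrite addr_ge0// mulr_ge0.
rewrite (_ : D 0%N + b * n.+1%:R = s + b); last by rewrite /s -natr1; ring.
clearbody s; rewrite [leRHS]mulrDr lerD//.
  exact: ler_wpM2r.
by rewrite -[leLHS]mul1r ler_wpM2r.
Qed.

(** Cut [[0, T]] into n + 1 equal steps: the errors [C * h ^+ 2] add up to a multiple of 1 / (n + 1)
    and vanish in the limit, leaving the growth factor alone. *)
Lemma curve_gronwall (R : realType) (D : R -> R) (L C T : R) :
  0 <= L -> 0 <= C -> 0 <= T -> 0 <= D 0 ->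
  (forall s h, 0 <= s -> 0 <= h -> s + h <= T ->
     D (s + h) <= (1 + L * h) * D s + C * h ^+ 2) ->
  D T <= expR (L * T) * D 0.
Proof.
move=> L0 C0 T0 D0 h; apply: (@le_of_inv_nat _ _ _ (expR (L * T) * C * T ^+ 2)).
move=> n; pose e := T / n.+1%:R; pose F k := D (e * k%:R).
have e0 : 0 <= e by rewrite divr_ge0.
have n0 : n.+1%:R != 0 :> R by rewrite pnatr_eq0.
have FS k : (k < n.+1)%N -> F k.+1 <= (1 + L * e) * F k + C * e ^+ 2.
  move=> kn; rewrite /F -natr1 mulrDr mulr1; apply: h => //.
    by rewrite mulr_ge0.
  rewrite -[e in _ + e]mulr1 -mulrDr natr1 /e mulrAC ler_pdivrMr ?ltr0n//.
  by rewrite ler_wpM2l// ler_nat.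
have := discrete_gronwall (mulr_ge0 L0 e0) (mulr_ge0 C0 (exprn_ge0 2 e0)) _ FS.
rewrite /F mulr0 => /(_ D0); have -> : e * n.+1%:R = T by rewrite /e divfK.
rewrite -[X in expR X]mulrA (_ : e * _ = T); last by rewrite /e divfK.
move=> /le_trans; apply; rewrite mulrDr lerD2l -!mulrA ler_wpM2l ?expR_ge0//.
rewrite /e; apply: eq_imp_le.
by move: (n.+1%:R) n0 => N N0; field.
Qed.

Section EulerMethod.
Variables (R : realType) (m : nat) (f : 'rV[R]_m -> 'rV[R]_m) (B L : R).
Hypothesis fB : forall y, `|f y| <= B.
Hypothesis fL : forall y z, `|f y - f z| <= L * `|y - z|.
Hypothesis L0 : 0 <= L.

Let B0 : 0 <= B. Proof. exact: le_trans (fB 0). Qed.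

Definition euler_step (h : R) (y : 'rV[R]_m) := y + h *: f y.

Lemma euler_step_dist h k y : 0 <= h ->
  `|iter k (euler_step h) y - y| <= k%:R * h * B.
Proof.
move=> h0; elim: k => [|k IH]; first by rewrite subrr normr0 !mul0r.
rewrite iterS {1}/euler_step addrAC; apply: (le_trans (ler_normD _ _)).
rewrite -natr1 !mulrDl mul1r lerD// normrZ ger0_norm//.
by rewrite ler_wpM2l.
Qed.

(** After k steps the polygon has moved by at most [k%:R * h * B], so the Lipschitz bound on f
    controls its deviation from the tangent at y. *)
Lemma euler_step_quadratic h k y : 0 <= h ->
  `|iter k (euler_step h) y - y - (k%:R * h) *: f y| <=
  L * B * (k%:R * h) ^+ 2.
Proof.
move=> h0; elim: k => [|k IH].
  by rewrite !mul0r scale0r subr0 subrr normr0 expr0n mulr0.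
rewrite iterS; set a := iter k _ _ in IH *.
have -> : euler_step h a - y - (k.+1%:R * h) *: f y =
    (a - y - (k%:R * h) *: f y) + h *: (f a - f y).
  by rewrite /euler_step -natr1; apply/rowP => i; rewrite !mxE; ring.
apply: (le_trans (ler_normD _ _)).
apply: (@le_trans _ _ (L * B * (k%:R * h) ^+ 2 + h * (L * (k%:R * h * B)))).
  rewrite lerD// normrZ ger0_norm// ler_wpM2l//.
  apply: (le_trans (fL _ _)); rewrite ler_wpM2l//; exact: euler_step_dist.
have -> : L * B * (k.+1%:R * h) ^+ 2 =
  L * B * (k%:R * h) ^+ 2 + h * (L * (k%:R * h * B)) +
  L * B * h ^+ 2 * (k%:R + 1) by rewrite -natr1; ring.
by rewrite lerDl !mulr_ge0// addr_ge0.
Qed.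

(** Two steps of length h / 2 differ from one of length h by h / 2 times the variation of f over a
    half step, hence by O(h^2); Gronwall sums at most 1 / h such errors. *)
Lemma euler_refine h k y : 0 <= h -> k%:R * h <= 1 ->
  `|iter (k * 2) (euler_step (h / 2)) y - iter k (euler_step h) y| <=
  expR L * (L * B) * h.
Proof.
move=> h0 kh.
pose D j := `|iter (j * 2) (euler_step (h / 2)) y - iter j (euler_step h) y|.
have DS j : (j < k)%N -> D j.+1 <= (1 + L * h) * D j + L * B * h ^+ 2.
  move=> _; rewrite /D mulSn !addSn add0n !iterS.
  set a := iter (j * 2) _ _; set b := iter j _ _.
  have -> : euler_step (h / 2) (euler_step (h / 2) a) - euler_step h b =
      (a - b) + h *: (f a - f b) +
      (h / 2) *: (f (euler_step (h / 2) a) - f a).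
    set c := f (euler_step (h / 2) a).
    rewrite {1}/euler_step -/c /euler_step !scalerBr.
    have e : h *: f a = (h / 2) *: f a + (h / 2) *: f a.
      by rewrite -scalerDl -splitr.
    rewrite e opprD !addrA; apply/rowP => i; rewrite !mxE; ring.
  apply: (le_trans (ler_normD _ _)).
  apply: (@le_trans _ _
      (`|a - b| + h * (L * `|a - b|) + h / 2 * (L * (h / 2 * B)))).
    rewrite lerD//.
      apply: (le_trans (ler_normD _ _)); rewrite lerD// normrZ ger0_norm//.
      by rewrite ler_wpM2l.
    have h20 : 0 <= h / 2 by rewrite divr_ge0.
    rewrite normrZ ger0_norm// ler_wpM2l//; apply: (le_trans (fL _ _)).
    rewrite ler_wpM2l// /euler_step addrC addKr normrZ ger0_norm// ler_wpM2l//.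
  have -> : h / 2 * (L * (h / 2 * B)) = L * B * h ^+ 2 / 4 by field.
  have : 0 <= L * B * h ^+ 2 by rewrite !mulr_ge0// exprn_ge0.
  by move: (L * B * h ^+ 2) => Z Z0; lra.
have := discrete_gronwall (mulr_ge0 L0 h0) _ _ DS.
rewrite /D mul0n /= subrr normr0 add0r => /(_ _ (lexx _)) H.
apply: (le_trans (H _)); first by rewrite !mulr_ge0// exprn_ge0.
have -> : L * B * h ^+ 2 * k%:R = L * B * h * (k%:R * h) by ring.
have -> : L * h * k%:R = L * (k%:R * h) by ring.
rewrite -!mulrA ler_pM ?expR_ge0 ?mulr_ge0//.
  by rewrite ler_expR ler_piMr.
rewrite 2?ler_wpM2l//; apply: ler_piMr => //.
Qed.

(** Compares the indices of the last grid point before a given time on the grids of steps h and h /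
    2. *)
Lemma truncn_double (x : R) : 0 <= x ->
  Num.truncn (2 * x) = (Num.truncn x * 2)%N \/
  Num.truncn (2 * x) = (Num.truncn x * 2).+1.
Proof.
move=> x0; have /andP[a b] := truncn_itv x0.
have [c|c] := ltP (2 * x) (2 * (Num.truncn x)%:R + 1).
  left; apply: truncn_def; rewrite -natr1 natrM.
  by apply/andP; split; lra.
right; apply: truncn_def; rewrite -!natr1 natrM; rewrite -natr1 in b.
by apply/andP; split; lra.
Qed.

Let h_ n : R := 2^-1 ^+ n.
(** The value at the last grid point before t, without interpolation: the jumps are at most
    [B * h_ n] and are counted among the errors. *)
Let poly n (y : 'rV[R]_m) (t : R) :=
  iter (Num.truncn (t / h_ n)) (euler_step (h_ n)) y.

Let h_gt0 n : 0 < h_ n.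
Proof. by rewrite exprn_gt0// invr_gt0. Qed.

Let poly_refine n y t : 0 <= t <= 1 ->
  `|poly n.+1 y t - poly n y t| <= (expR L * (L * B) + B) * h_ n.
Proof.
move=> /andP[t0 t1]; rewrite /poly; set k := Num.truncn (t / h_ n).
have th : 0 <= t / h_ n by rewrite divr_ge0// ltW.
have kh : k%:R * h_ n <= 1.
  have /andP[a _] := truncn_itv th.
  by apply: le_trans t1; rewrite -ler_pdivlMr.
have hS : h_ n.+1 = h_ n / 2 by rewrite /h_ exprSr.
have := euler_refine y (ltW (h_gt0 n)) kh; rewrite -hS => H.
have -> : t / h_ n.+1 = 2 * (t / h_ n).
  by rewrite hS; move: (lt0r_neq0 (h_gt0 n)); move: (h_ n) => z z0; field.
have hn0 := ltW (h_gt0 n).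
have [->|->] := truncn_double th; rewrite -/k.
  by apply: (le_trans H); rewrite mulrDl lerDl mulr_ge0.
rewrite iterS {1}/euler_step addrAC; apply: (le_trans (ler_normD _ _)).
rewrite mulrDl lerD// normrZ mulrC ger0_norm ?(ltW (h_gt0 _))//.
by rewrite ler_pM ?(ltW (h_gt0 _))// hS ler_pdivrMr// ler_peMr// ler1n.
Qed.

(** The limit of the dyadic polygons. Between grid points they satisfy the estimate by
    [euler_step_quadratic], and it passes to the limit with the same constant [L * B]. *)
Lemma forward_solution y : exists g : R -> 'rV[R]_m, g 0 = y /\
  forall t t', 0 <= t -> t <= t' -> t' <= 1 ->
    `|g t' - g t - (t' - t) *: f (g t)| <= L * B * (t' - t) ^+ 2.
Proof.
pose K := expR L * (L * B) + B.
have K0 : 0 <= K by rewrite addr_ge0// !mulr_ge0 ?expR_ge0.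
have ex t : exists l, 0 <= t <= 1 ->
    forall n, `|l - poly n y t| <= 2 * K * h_ n.
  have [t1|] := boolP (0 <= t <= 1); last by exists 0.
  have [l hl] := geometric_limit (fun n => poly_refine n y t1).
  by exists l => _.
have [g hg] := choice ex; exists g; split.
  apply/eqP; rewrite -subr_eq0 -normr_le0.
  apply: (@le_of_dyadic _ _ _ (2 * K)) => n; rewrite add0r.
  by have := hg 0; rewrite lexx ler01 => /(_ isT n);
    rewrite /poly mul0r truncn0.
move=> t t' t0 tt' t1.
(* Coefficients of [h_ n] in the total error: [2 * K] for each of g t' and g t, [L * (2 * K)] for f
   at g t, [L * B * 3] for replacing s ^+ 2 by (t' - t) ^+ 2, and B for replacing s by t' - t, where
   s is the time between the two grid points. *)
pose A := 2 * K + 2 * K + L * (2 * K) + L * B * 3 + B.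
apply: (@le_of_dyadic _ _ _ A) => n; rewrite -/(h_ n).
have ht : `|g t - poly n y t| <= 2 * K * h_ n.
  by apply: hg; rewrite t0 (le_trans tt').
have ht' : `|g t' - poly n y t'| <= 2 * K * h_ n.
  by apply: hg; rewrite t1 (le_trans t0).
have hn0 := h_gt0 n; have hn1 : h_ n <= 1.
  by rewrite exprn_ile1// ?invr_ge0// invf_le1// ler1n.
have q0 : 0 <= t / h_ n by rewrite divr_ge0// ltW.
have q0' : 0 <= t' / h_ n by rewrite divr_ge0 ?(le_trans t0 tt') ?(ltW hn0).
pose k := Num.truncn (t / h_ n); pose k' := Num.truncn (t' / h_ n).
have kk' : (k <= k')%N by rewrite le_truncn// ler_pM2r ?invr_gt0.
have pE : poly n y t' = iter (k' - k) (euler_step (h_ n)) (poly n y t).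
  by rewrite /poly -/k -/k' -iterD subnK.
pose j := (k' - k)%N; pose s := j%:R * h_ n.
have s0 : 0 <= s by rewrite mulr_ge0// ltW.
have /andP[] := truncn_itv q0; have /andP[] := truncn_itv q0'.
rewrite -/k -/k' ler_pdivlMr// ltr_pdivrMr// ler_pdivlMr// ltr_pdivrMr//.
move=> k1' k2' k1 k2.
have sE : s = k'%:R * h_ n - k%:R * h_ n by rewrite /s /j natrB// mulrBl.
have sd : `|s - (t' - t)| <= h_ n.
  move: k2' k2; rewrite sE -!natr1 !mulrDl !mul1r => k2' k2.
  by rewrite ler_norml; apply/andP; split; lra.
have Q := euler_step_quadratic j (poly n y t) (ltW hn0).
rewrite -/s -/j -pE in Q.
have -> : g t' - g t - (t' - t) *: f (g t) =
    (g t' - poly n y t') - (g t - poly n y t)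
    + (poly n y t' - poly n y t - s *: f (poly n y t))
    + (s - (t' - t)) *: f (poly n y t)
    + (t' - t) *: (f (poly n y t) - f (g t)).
  by apply/rowP => i; rewrite !mxE; ring.
have e1 : `|(s - (t' - t)) *: f (poly n y t)| <= h_ n * B.
  by rewrite normrZ ler_pM.
have e2 : `|(t' - t) *: (f (poly n y t) - f (g t))| <= L * (2 * K * h_ n).
  rewrite normrZ -[leRHS]mul1r ler_pM//.
    by rewrite ger0_norm ?subr_ge0// lerBlDr (le_trans t1)// lerDl.
  apply: (le_trans (fL _ _)); rewrite ler_wpM2l// distrC//.
have e3 : s ^+ 2 <= (t' - t) ^+ 2 + 3 * h_ n.
  have le1 : s <= (t' - t) + h_ n by move: sd; rewrite ler_norml; lra.
  have : s ^+ 2 <= ((t' - t) + h_ n) ^+ 2.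
    by rewrite lerXn2r ?nnegrE// (le_trans s0).
  move=> /le_trans; apply.
  have tt1 : t' - t <= 1 by lra.
  have tt0 : 0 <= t' - t by rewrite subr_ge0.
  move: (t' - t) (h_ n) tt0 tt1 hn0 hn1 => a b a0 a1 b0 b1.
  have : a * b <= b by rewrite ler_piMl// ltW.
  have : b * b <= b by rewrite ler_piMl// ltW.
  by rewrite sqrrD expr2 => *; lra.
have LB0 : 0 <= L * B by rewrite mulr_ge0.
have e4 : L * B * s ^+ 2 <= L * B * (t' - t) ^+ 2 + L * B * 3 * h_ n.
  by rewrite -[L * B * 3 * _]mulrA -mulrDr ler_wpM2l.
have nle (a b c d e : 'rV[R]_m) :
    `|a - b + c + d + e| <= `|a| + `|b| + `|c| + `|d| + `|e|.
  by do 3 (apply: (le_trans (ler_normD _ _)); rewrite lerD//);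
     exact: ler_normB.
apply: (le_trans (nle _ _ _ _ _)).
rewrite /A; move: Q e1 e2 e4 ht ht'; clear; move: (h_ n) => z.
set N1 := `|_ - _ - _|; set N2 := `|_ *: f _|; set N3 := `|_ *: (_ - _)|.
by move=> *; lra.
Qed.

End EulerMethod.

(** * Curves with prescribed velocity up to a quadratic error *)

Section TwoCurves.
Context (R : realType) (m : nat).
Implicit Types (a x : R -> 'rV[R]_m).

(** Here x plays the role of the velocity of a. The two times come in either order, so the estimate
    contains its own time reversal and can be chained through any subdivision. *)
Definition quadratic_tangent T C a x := forall t t', `|t| <= T -> `|t'| <= T ->
  `|a t' - a t - (t' - t) *: x t| <= C * (t' - t) ^+ 2.

(** Gronwall for the distance between the curves, run from 0 towards t. The velocities are compared
    along the two curves only, which makes the lemma usable inside a chart. *)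
Lemma quadratic_tangent_dist T C L a1 a2 x1 x2 : 0 <= L -> 0 <= C ->
  quadratic_tangent T C a1 x1 -> quadratic_tangent T C a2 x2 ->
  (forall t, `|t| <= T -> `|x1 t - x2 t| <= L * `|a1 t - a2 t|) ->
  forall t, `|t| <= T -> `|a1 t - a2 t| <= expR (L * `|t|) * `|a1 0 - a2 0|.
Proof.
move=> L0 C0 q1 q2 xL t tT.
(* The sign s is the direction of time: negative t are covered by the same computation. *)
have [s [s1 ts]] : exists s : R, `|s| = 1 /\ t = s * `|t|.
  by exists (if 0 <= t then 1 else -1); case: ifPn => t0;
    [rewrite normr1 mul1r ger0_norm|
     rewrite normrN1 mulN1r ltr0_norm ?opprK// ltNge].
pose D h := `|a1 (s * h) - a2 (s * h)|.
have : D `|t| <= expR (L * `|t|) * D 0.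
  have D0 : 0 <= D 0 by exact: normr_ge0.
  have C20 : 0 <= 2 * C by rewrite mulr_ge0.
  apply: (curve_gronwall L0 C20 (normr_ge0 t) D0) => u h u0 h0 uhT.
  have sE v : 0 <= v -> `|s * v| = v.
    by move=> v0; rewrite normrM s1 mul1r ger0_norm.
  have uT : `|s * u| <= T.
    by rewrite sE//; apply: le_trans tT; apply: le_trans uhT; rewrite lerDl.
  have uhT' : `|s * (u + h)| <= T by rewrite sE ?addr_ge0//; exact: le_trans tT.
  have e : s * (u + h) - s * u = s * h by rewrite mulrDr addrC addKr.
  have := q1 _ _ uT uhT'; have := q2 _ _ uT uhT'; rewrite e.
  rewrite exprMn -(real_normK (num_real s)) s1 expr1n mul1r /D; set b1 := a1 (s * (u + h)); set b2 := a2 (s * (u + h)).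
  set c1 := a1 _; set c2 := a2 _; move=> h2 h1.
  have -> : b1 - b2 = (b1 - c1 - (s * h) *: x1 (s * u)) -
      (b2 - c2 - (s * h) *: x2 (s * u)) + (c1 - c2) +
      (s * h) *: (x1 (s * u) - x2 (s * u)).
    by apply/rowP => i; rewrite !mxE; ring.
  have h3 : `|(s * h) *: (x1 (s * u) - x2 (s * u))| <= h * (L * `|c1 - c2|).
    by rewrite normrZ sE// ler_wpM2l// xL.
  apply: (le_trans (ler_normD _ _)); apply: (le_trans (lerD (ler_normD _ _) h3)).
  apply: (le_trans (lerD (lerD (ler_normB _ _) (lexx _)) (lexx _))).
  by move: h1 h2; set N1 := `|_|; set N2 := `|_ - _ - _|; lra.
by rewrite /D mulr0 -ts.
Qed.

(** Subdividing makes the quadratic errors disappear, so the speed bound B is kept without loss;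
    this exact constant confines solutions to a ball in [flow_box]. *)
Lemma quadratic_tangent_speed T C B a x : 0 <= C ->
  quadratic_tangent T C a x -> (forall t, `|t| <= T -> `|x t| <= B) ->
  forall t t', `|t| <= T -> `|t'| <= T -> `|a t' - a t| <= B * `|t' - t|.
Proof.
move=> C0 q xB t t' tT t'T.
apply: (@le_of_inv_nat _ _ _ (C * (t' - t) ^+ 2)) => n.
pose e := (t' - t) / n.+1%:R; pose b k := a (t + k%:R * e).
have n0 : (n.+1%:R : R) != 0 by rewrite pnatr_eq0.
have inT k : (k <= n.+1)%N -> `|t + k%:R * e| <= T.
  move=> kn; have kn1 : (k%:R / n.+1%:R : R) <= 1.
    by rewrite ler_pdivrMr ?ltr0n// mul1r ler_nat.
  have kn0 : 0 <= (k%:R / n.+1%:R : R) by rewrite divr_ge0.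
  have -> : t + k%:R * e =
      (1 - k%:R / n.+1%:R) * t + (k%:R / n.+1%:R) * t'.
    by rewrite /e; move: (n.+1%:R) n0 => N N0; field.
  move: (k%:R / n.+1%:R : R) kn0 kn1 => l l0 l1.
  apply: (le_trans (ler_normD _ _)); have l2 : 0 <= 1 - l by rewrite subr_ge0.
  rewrite !normrM (ger0_norm l0) (ger0_norm l2).
  have -> : T = (1 - l) * T + l * T by ring.
  by apply: lerD; apply: ler_wpM2l.
have bS k : (k <= n.+1)%N -> `|b k - b 0%N| <= k%:R * (B * `|e| + C * e ^+ 2).
  elim: k => [|k IH] kn; first by rewrite subrr normr0 mul0r.
  have := q _ _ (inT k (ltnW kn)) (inT k.+1 kn).
  have -> : t + k.+1%:R * e - (t + k%:R * e) = e by rewrite -natr1; ring.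
  rewrite -!/(b _) => h.
  have -> : b k.+1 - b 0%N = (b k - b 0%N) + e *: x (t + k%:R * e) +
     (b k.+1 - b k - e *: x (t + k%:R * e)).
    by apply/rowP => i; rewrite !mxE; ring.
  apply: (le_trans (ler_normD _ _)); rewrite -natr1 mulrDl mul1r addrA lerD//.
  apply: (le_trans (ler_normD _ _)); rewrite lerD ?IH// ?(ltnW kn)//.
  by rewrite normrZ mulrC ler_wpM2r// xB// inT// ltnW.
have := bS n.+1 (leqnn _); rewrite /b mul0r addr0.
have -> : t + n.+1%:R * e = t'.
  by rewrite /e; move: (n.+1%:R) n0 => N N0; field.
move=> /le_trans; apply; rewrite mulrDr lerD//.
  rewrite /e normrM normrV ?unitfE// [`|n.+1%:R|]ger0_norm//.
  apply: eq_imp_le; move: (n.+1%:R) n0 => N N0; field.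
  by [].
rewrite /e; apply: eq_imp_le; move: (n.+1%:R) n0 => N N0; field.
by [].
Qed.

(** Negative times come from the forward solution of [- f], run backwards and glued at 0. The
    remaining work is to obtain the estimate for base times on either side of the other time and
    across 0, at the price of a larger constant. *)
Lemma flow_box_solution (f : 'rV[R]_m -> 'rV[R]_m) B L y : 0 <= L ->
  (forall y, `|f y| <= B) -> (forall y z, `|f y - f z| <= L * `|y - z|) ->
  exists g C, [/\ g 0 = y, 0 <= C & quadratic_tangent 1 C g (f \o g)].
Proof.
move=> L0 fB fL; have B0 : 0 <= B by exact: le_trans (fB 0).
have [g [g0 gq]] := forward_solution fB fL L0 y.
have fB' z : `|- f z| <= B by rewrite normrN.
have fL' z w : `|- f z - - f w| <= L * `|z - w| by rewrite -opprD normrN.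
have [g' [g'0 g'q]] := forward_solution fB' fL' L0 y.
have LB0 : 0 <= L * B by rewrite mulr_ge0.
pose a t := if 0 <= t then g t else g' (- t).
have a0 : a 0 = y by rewrite /a lexx.
pose K := B + L * B.
have K0 : 0 <= K by rewrite addr_ge0.
(* the forward estimate read backwards, which costs a Lipschitz correction *)
have flip (b b' : 'rV[R]_m) (s : R) : 0 <= s -> s <= 1 ->
    `|b' - b - s *: f b| <= L * B * s ^+ 2 ->
    `|b - b' - (- s) *: f b'| <= (L * B + L * K) * s ^+ 2.
  move=> s0 s1 h; have bb : `|b' - b| <= K * s.
    rewrite -(subrK (s *: f b) (b' - b)); apply: (le_trans (ler_normD _ _)).
    rewrite addrC mulrDl lerD//.
      by rewrite normrZ ger0_norm// mulrC ler_wpM2r.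
    by apply: (le_trans h); rewrite ler_wpM2l// expr2; apply: ler_piMr.
  have -> : b - b' - (- s) *: f b' = - (b' - b - s *: f b) + s *: (f b' - f b).
    by apply/rowP => i; rewrite !mxE; ring.
  apply: (le_trans (ler_normD _ _)); rewrite normrN mulrDl lerD//.
  rewrite normrZ ger0_norm// expr2 mulrA mulrC ler_wpM2r//.
  by apply: (le_trans (fL _ _)); rewrite -mulrA ler_wpM2l.
pose C := L * B + L * K.
have C0 : 0 <= C by rewrite addr_ge0 ?mulr_ge0.
have LBC : L * B <= C by rewrite lerDl mulr_ge0.
have sameP t t' : 0 <= t <= 1 -> 0 <= t' <= 1 ->
    `|a t' - a t - (t' - t) *: f (a t)| <= C * (t' - t) ^+ 2.
  move=> /andP[t0 t1] /andP[t'0 t'1]; rewrite /a t0 t'0.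
  have [tt'|t't] := leP t t'.
    by apply: (le_trans (gq _ _ _ _ _)) => //; rewrite ler_wpM2r// exprn_even_ge0.
  have := flip _ _ _ _ _ (gq t' t t'0 (ltW t't) t1); rewrite opprB sqrrB.
  rewrite (_ : t ^+ 2 - t * t' *+ 2 + t' ^+ 2 = (t' - t) ^+ 2); last by ring.
  by apply; lra.
have sameN t t' : -1 <= t <= 0 -> -1 <= t' <= 0 ->
    `|a t' - a t - (t' - t) *: f (a t)| <= C * (t' - t) ^+ 2.
  have aN s : s <= 0 -> a s = g' (- s).
    by rewrite le_eqVlt /a => /orP[/eqP->|s0];
      [rewrite lexx oppr0 g0 g'0|rewrite leNgt s0].
  move=> /andP[t1 t0] /andP[t'1 t'0]; rewrite !aN//.
  have [tt'|t't] := leP t t'.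
    have h : `|g' (- t) - g' (- t') - (t' - t) *: (- f (g' (- t')))| <=
        L * B * (t' - t) ^+ 2.
      have := g'q (- t') (- t); rewrite opprK (addrC (- t)); apply; lra.
    move: h; set b := g' (- t'); set b' := g' (- t) => hh.
    have s0 : 0 <= t' - t by lra.
    have s1 : t' - t <= 1 by lra.
    have bb : `|b' - b| <= K * (t' - t).
      rewrite -(subrK ((t' - t) *: - f b) (b' - b)).
      apply: (le_trans (ler_normD _ _)); rewrite addrC mulrDl lerD//.
        by rewrite normrZ ger0_norm// mulrC ler_wpM2r.
      by apply: (le_trans hh); rewrite ler_wpM2l// expr2; apply: ler_piMr.
    have -> : b - b' - (t' - t) *: f b' =
        - (b' - b - (t' - t) *: - f b) + (t' - t) *: (f b - f b').
      by apply/rowP => i; rewrite !mxE; ring.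
    apply: (le_trans (ler_normD _ _)); rewrite normrN mulrDl lerD//.
    rewrite normrZ ger0_norm// [leRHS]mulrC expr2 -mulrA ler_wpM2l//.
    apply: (le_trans (fL _ _)); rewrite mulrC -mulrA ler_wpM2l// distrC.
    by rewrite mulrC [X in _ <= X]mulrC.
  have := g'q (- t) (- t'); rewrite opprK (_ : - t' + t = - (t' - t)); last by ring.
  rewrite scalerN scaleNr opprK sqrrN => h; apply: (le_trans (h _ _ _)); try lra.
  by rewrite ler_wpM2r// exprn_even_ge0.
pose CC := C + (C + L * (B + C)).
have CCC : C <= CC by rewrite /CC lerDl addr_ge0// mulr_ge0// addr_ge0.
(* when t and t' have opposite signs, go through 0 *)
have cross t t' : `|t| <= 1 -> `|t'| <= 1 -> `|t| <= `|t' - t| ->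
    `|t'| <= `|t' - t| ->
    `|a t' - a 0 - (t' - 0) *: f (a 0)| <= C * (t' - 0) ^+ 2 ->
    `|a 0 - a t - (0 - t) *: f (a t)| <= C * (0 - t) ^+ 2 ->
    `|a t' - a t - (t' - t) *: f (a t)| <= CC * (t' - t) ^+ 2.
  rewrite !subr0 !sub0r sqrrN => t1 t'1 tt tt' h1 h2.
  have sqle (x z : R) : `|x| <= `|z| -> x ^+ 2 <= z ^+ 2.
    by move=> xz; rewrite -(real_normK (num_real x)) -(real_normK (num_real z))
       lerXn2r ?nnegrE.
  have d0 : `|a 0 - a t| <= (B + C) * `|t|.
    rewrite -(subrK ((- t) *: f (a t)) (a 0 - a t)).
    apply: (le_trans (ler_normD _ _)); rewrite addrC mulrDl lerD//.
      by rewrite normrZ normrN mulrC ler_wpM2r.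
    apply: (le_trans h2); rewrite ler_wpM2l// -(real_normK (num_real t)) expr2.
    by rewrite ler_piMl.
  have -> : a t' - a t - (t' - t) *: f (a t) = (a t' - a 0 - t' *: f (a 0)) +
     ((a 0 - a t - (- t) *: f (a t)) + t' *: (f (a 0) - f (a t))).
    by apply/rowP => i; rewrite !mxE; ring.
  apply: (le_trans (ler_normD _ _)); rewrite mulrDl lerD//.
    by apply: (le_trans h1); rewrite ler_wpM2l// sqle.
  apply: (le_trans (ler_normD _ _)); rewrite mulrDl lerD//.
    by apply: (le_trans h2); rewrite ler_wpM2l// sqle.
  rewrite normrZ -(real_normK (num_real (t' - t))) expr2 mulrA mulrC.
  rewrite ler_pM//; apply: (le_trans (fL _ _)); rewrite -mulrA ler_wpM2l//.
  by apply: (le_trans d0); rewrite ler_wpM2l// addr_ge0.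
exists a, CC; split => //; first exact: le_trans CCC.
move=> t t'; rewrite !ler_norml => /andP[t1 t2] /andP[t'1 t'2].
have up : C * (t' - t) ^+ 2 <= CC * (t' - t) ^+ 2.
  by rewrite ler_wpM2r// exprn_even_ge0.
have [t0|t0] := leP 0 t; have [t'0|t'0] := leP 0 t'.
- by apply: (le_trans (sameP _ _ _ _) up); apply/andP.
- have t'm := ltW t'0; apply: cross.
  + by rewrite ler_norml t1.
  + by rewrite ler_norml t'1.
  + by rewrite ger0_norm// ler0_norm; lra.
  + by rewrite !ler0_norm; lra.
  + by apply: sameN; apply/andP; split=> //; lra.
  + by apply: sameP; apply/andP; split=> //; lra.
- have tm := ltW t0; apply: cross.
  + by rewrite ler_norml t1.
  + by rewrite ler_norml t'1.
  + by rewrite ler0_norm// ger0_norm; lra.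
  + by rewrite !ger0_norm; lra.
  + by apply: sameP; apply/andP; split=> //; lra.
  + by apply: sameN; apply/andP; split=> //; lra.
- have tm := ltW t0; have t'm := ltW t'0.
  by apply: (le_trans (sameN _ _ _ _) up); apply/andP.
Qed.

End TwoCurves.

(** * Lipschitz maps on compact balls *)

Lemma dist_continuous (R : realType) m (y : 'rV[R]_m) :
  continuous (fun z : 'rV[R]_m => `|z - y|).
Proof.
move=> z; apply: (@cvg_norm R 'rV[R]_m _ (nbhs z) _ (fun z => z - y)).
by apply: (@cvgB R 'rV[R]_m); [exact: cvg_id|exact: cvg_cst].
Qed.

Lemma compact_cball (R : realType) m (y : 'rV[R]_m) (r : R) :
  compact [set z : 'rV[R]_m | `|z - y| <= r].
Proof.
apply: bounded_closed_compact.
  exists (r + `|y|); split; first exact: num_real.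
  move=> M yM z /= zr; apply: ltW; apply: le_lt_trans yM.
  by rewrite -(subrK y z); apply: (le_trans (ler_normD _ _)); rewrite lerD2r.
rewrite (_ : mkset _ = (fun z : 'rV[R]_m => `|z - y|) @^-1` [set x | x <= r])//.
apply: preimage_closed; last exact: closed_le.
by move=> z _; exact: dist_continuous.
Qed.

(** Near the diagonal of the square of K this is the hypothesis. Near a pair of distinct points f
    varies by a bounded amount while the distance is bounded below, so any large constant works.
    Compactness is applied with the filter of neighbourhoods of +oo as parameter, which makes the
    constant uniform. *)
Lemma compact_lipschitz (R : realType) m p (K : set 'rV[R]_m)
    (f : 'rV[R]_m -> 'rV[R]_p) : compact K ->
  (forall y, K y -> exists C r, 0 < r /\ forall z w, K z -> K w ->
     `|z - y| < r -> `|w - y| < r -> `|f z - f w| <= C * `|z - w|) ->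
  exists2 C, 0 <= C & forall y z, K y -> K z -> `|f y - f z| <= C * `|y - z|.
Proof.
move=> cK hf.
pose P (C : R) (yz : 'rV[R]_m * 'rV[R]_m) := K yz.1 -> K yz.2 ->
  `|f yz.1 - f yz.2| <= C * `|yz.1 - yz.2|.
have Hloc : forall x, (K `*` K) x ->
    \forall x' \near x & C \near +oo, P C x'.
  move=> [a b] /= [Ka Kb].
  have [Ca [ra [ra0 ha]]] := hf a Ka; have [Cb [rb [rb0 hb]]] := hf b Kb.
  have nearball (c : 'rV[R]_m) r : 0 < r -> nbhs c [set z | `|z - c| < r].
    move=> r0; rewrite nbhsE /=; exists (ball c r); last first.
      by move=> z; rewrite -ball_normE /= distrC.
    by split; [exact: ball_open|exact: ballxx].
  have [ab|ab] := eqVneq a b.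
    subst b; exists ([set z | `|z - a| < ra] `*` [set z | `|z - a| < ra],
       [set C : R | Ca < C]); first split => /=.
    - by exists ([set z | `|z - a| < ra], [set z | `|z - a| < ra]) => //; split; exact: nearball.
    - by exists Ca; split => //; exact: num_real.
    move=> [[y z] C] /= [[ya za] CC] Ky Kz.
    by apply: (le_trans (ha _ _ Ky Kz ya za)); rewrite ler_wpM2r// ltW.
  (* Points within a quarter of the distance from a and from b stay at least e apart. *)
  pose e := `|a - b| / 4.
  have e0 : 0 < e by rewrite divr_gt0// normr_gt0 subr_eq0.
  pose Ba := `|Ca| * ra; pose Bb := `|Cb| * rb.
  pose B := `|f a - f b| + Ba + Bb.
  exists ([set z | `|z - a| < ra /\ `|z - a| < e] `*`
          [set z | `|z - b| < rb /\ `|z - b| < e],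
       [set C : R | B / e < C]); first split => /=.
  - by exists ([set z | `|z - a| < ra /\ `|z - a| < e],
      [set z | `|z - b| < rb /\ `|z - b| < e]) => //; split; apply: filterI; exact: nearball.
  - by exists (B / e); split => //; exact: num_real.
  move=> [[y z] C] /= [[[ya ya'] [zb zb']] CC] Ky Kz.
  have B0 : 0 <= B by rewrite !addr_ge0// mulr_ge0// ltW.
  have fy : `|f y - f a| <= Ba.
    apply: (le_trans (ha _ _ Ky Ka ya _)); first by rewrite subrr normr0.
    apply: (@le_trans _ _ (`|Ca| * `|y - a|)); first by rewrite ler_wpM2r// ler_norm.
    by rewrite ler_wpM2l// ltW.
  have fz : `|f z - f b| <= Bb.
    apply: (le_trans (hb _ _ Kz Kb zb _)); first by rewrite subrr normr0.
    apply: (@le_trans _ _ (`|Cb| * `|z - b|)); first by rewrite ler_wpM2r// ler_norm.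
    by rewrite ler_wpM2l// ltW.
  apply: (@le_trans _ _ B).
    rewrite (_ : f y - f z = (f a - f b) + (f y - f a) - (f z - f b)); last first.
      by apply/rowP => i; rewrite !mxE; ring.
    apply: (le_trans (ler_normB _ _)); rewrite lerD//.
    by apply: (le_trans (ler_normD _ _)); rewrite lerD//.
  have eyz : e <= `|y - z|.
    have : `|a - b| <= `|y - z| + `|y - a| + `|z - b|.
      rewrite (_ : a - b = (y - z) - (y - a) + (z - b)); last first.
        by apply/rowP => i; rewrite !mxE; ring.
      by apply: (le_trans (ler_normD _ _)); rewrite lerD//; exact: ler_normB.
    have aux (A Y Z W : R) :
        0 <= Y -> A <= W + Y + Z -> Y < A / 4 -> Z < A / 4 -> A / 4 <= W by lra.
    by move=> /(aux _ _ _ _ (normr_ge0 _)); apply.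
  rewrite -ler_pdivrMr; last exact: lt_le_trans eyz.
  apply: ltW; apply: le_lt_trans CC; rewrite ler_wpM2l//.
  by rewrite lef_pV2 ?posrE// (lt_le_trans e0).
have /compact_near_coveringP cKK := compact_setX cK cK.
have [C0 [_ hC]] := cKK R (pinfty_nbhs R) P _ Hloc.
exists (Num.max C0 0 + 1).
  by rewrite addr_ge0// le_max lexx orbT.
move=> y z Ky Kz; apply: (hC _ _ (y, z)) => //.
by apply: (@le_lt_trans _ _ (Num.max C0 0)); rewrite ?ltrDl// le_max lexx.
Qed.

Section BoxRetraction.
Context (R : realType) (m : nat) (y : 'rV[R]_m) (r : R).
Hypothesis r0 : 0 <= r.

(** For the max norm balls are boxes, and clamping each coordinate is a retraction that does not
    increase distances. It extends a field from a ball to the whole space with the same bounds. *)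
Definition box_retract (z : 'rV[R]_m) : 'rV[R]_m :=
  \row_j Num.max (y 0 j - r) (Num.min (z 0 j) (y 0 j + r)).

Lemma box_retract_in z : `|box_retract z - y| <= r.
Proof.
apply: norm_le_coord => // i j; rewrite !mxE ord1 ler_norml.
rewrite /Order.max /Order.min.
by case: (ltP (z 0 j)) => a; case: ltP => b; apply/andP; split; have := r0; lra.
Qed.

Lemma box_retract_id z : `|z - y| <= r -> box_retract z = z.
Proof.
move=> zr; apply/rowP => j; rewrite !mxE.
have := le_trans (coord_le_norm (z - y) 0 j) zr; rewrite !mxE ler_norml => /andP[].
rewrite /Order.max /Order.min.
by case: (ltP (z 0 j)) => a; case: ltP => b c e; have := r0; lra.
Qed.

Lemma box_retract_lip z w : `|box_retract z - box_retract w| <= `|z - w|.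
Proof.
apply: norm_le_coord => // i j; apply: (@le_trans _ _ `|z 0 j - w 0 j|); last first.
  by have := coord_le_norm (z - w) 0 j; rewrite !mxE.
rewrite !mxE ler_norml; have := ler_norm (z 0 j - w 0 j).
have := lerNnormlW (lexx `|z 0 j - w 0 j|).
rewrite /Order.max /Order.min => h1 h2.
by case: (ltP (z 0 j)) => a; case: (ltP (w 0 j)) => b;
  do 2 (case: ltP => ?); apply/andP; split; have := r0; lra.
Qed.

End BoxRetraction.

(** * Complete flows on manifolds *)

Lemma near_dist (R : realType) (V : normedModType R) (x : V) (A : set V) :
  nbhs x A <-> exists2 r : R, 0 < r & forall z, `|z - x| < r -> A z.
Proof.
split=> [/nbhs_ballP[r r0 rA]|[r r0 rA]].
  by exists r => // z zx; apply: rA; rewrite -ball_normE /= distrC.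
apply/nbhs_ballP; exists r => // z; rewrite -ball_normE /= distrC; exact: rA.
Qed.

Lemma cvg_dist (R : realType) (V : normedModType R) (T : Type)
    (F : set_system T) (FF : Filter F) (f : T -> V) (l : V) :
  (forall e : R, 0 < e -> \forall x \near F, `|f x - l| < e) <-> f @ F --> l.
Proof.
split=> [h|/cvgrPdist_lt h e e0].
  by apply/cvgrPdist_lt => e /h; apply: filterS => x; rewrite distrC.
by have := h e e0; apply: filterS => x; rewrite distrC.
Qed.

Lemma near_rV (R : realType) m (x : 'rV[R]_m) (A : set 'rV[R]_m) :
  nbhs x A <-> exists2 r : R, 0 < r & forall z, `|z - x| < r -> A z.
Proof. exact: (@near_dist R 'rV[R]_m). Qed.

Lemma near_R (R : realType) (x : R) (A : set R) :
  nbhs x A <-> exists2 r : R, 0 < r & forall z, `|z - x| < r -> A z.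
Proof. exact: (@near_dist R R^o). Qed.

Lemma cvg_rV (R : realType) m (T : Type)
    (F : set_system T) (FF : Filter F) (f : T -> 'rV[R]_m) (l : 'rV[R]_m) :
  (forall e : R, 0 < e -> \forall x \near F, `|f x - l| < e) <-> f @ F --> l.
Proof. exact: (@cvg_dist R 'rV[R]_m). Qed.

Lemma continuous_rV (R : realType) m (T : topologicalType) (f : T -> 'rV[R]_m)
    (x : T) : {for x, continuous f} <->
  forall e : R, 0 < e -> \forall y \near x, `|f y - f x| < e.
Proof. by split=> h; apply/(@cvg_rV R m T (nbhs x)). Qed.

Section CompleteFlow.
Context (R : realType) (m : nat) (N : topologicalType) (I : Type).
Variables (dom : I -> set N) (k : I -> N -> 'rV[R]_m) (kinv : I -> 'rV[R]_m -> N).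
Variable X : I -> N -> 'rV[R]_m.

(** The Lipschitz clause makes g continuous without any bound on X; in a change of chart it also
    turns a remainder quadratic in the coordinates into one quadratic in time. *)
Definition solution_at i (g : R -> N) t0 := exists C e : R,
  [/\ 0 < e, 0 <= C & forall t t', `|t - t0| < e -> `|t' - t0| < e ->
  [/\ dom i (g t), `|k i (g t') - k i (g t)| <= C * `|t' - t| &
   `|k i (g t') - k i (g t) - (t' - t) *: X i (g t)| <= C * (t' - t) ^+ 2]].

Definition solution (J : set R) (g : R -> N) :=
  forall t, J t -> exists i, solution_at i g t.

Definition manifold_charts := [/\ hausdorff_space N,
  forall i, open (dom i),
  forall i e, dom i e -> {for e, continuous (k i)},
  forall i e, dom i e -> {for k i e, continuous (kinv i)} &
  forall i e, dom i e -> kinv i (k i e) = e].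

(** J stands for the derivative of the coordinate change from i to j, acting on row vectors.
    Everything is stated at points of N, so that no composite of charts with partial domains
    appears. *)
Definition transitions := forall i j e, dom i e -> dom j e ->
  exists J : N -> 'M[R]_m, exists (C : R) (O : set N), [/\ 0 <= C, nbhs e O &
  forall e1, O e1 ->
   [/\ X j e1 = X i e1 *m J e1, forall v : 'rV_m, `|v *m J e1| <= C * `|v| &
    forall e2, O e2 ->
      `|k j e2 - k j e1 - (k i e2 - k i e1) *m J e1| <=
      C * `|k i e2 - k i e1| ^+ 2]].

Definition locally_lipschitz_field := forall i e, dom i e ->
  exists (C : R) (O : set N), [/\ 0 <= C, nbhs e O &
   forall e1 e2, O e1 -> O e2 ->
     `|X i e1 - X i e2| <= C * `|k i e1 - k i e2|].

(* A field bounded by r / 2 on a ball of radius r around a point cannot leave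
   this ball before time 1 when started in the ball of radius r / 2. *)
Definition uniform_time := forall e, exists i (r : R), [/\ 0 < r, dom i e &
  forall y, `|y - k i e| <= r ->
    [/\ dom i (kinv i y), k i (kinv i y) = y & `|X i (kinv i y)| <= r / 2]].

Hypothesis charts : manifold_charts.
Hypothesis trans : transitions.
Hypothesis lip : locally_lipschitz_field.
Hypothesis time : uniform_time.

Lemma solution_at_continuous i g t : solution_at i g t -> {for t, continuous g}.
Proof.
have [_ domO kc kic kK] := charts.
move=> [C [e [e0 C0 h]]].
have dt : dom i (g t).
  by have [] := h t t; rewrite ?subrr ?normr0.
have kg : {for t, continuous (k i \o g)}.
  apply/continuous_rV => r r0.
  apply/near_R; exists (Num.min e (r / (C + 1))).
    by rewrite lt_min e0 divr_gt0// ltr_wpDl.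
  move=> s; rewrite lt_min => /andP[se sr].
  have [//|//|_ + _] := h t s; first by rewrite subrr normr0.
  move=> /le_lt_trans; apply; apply: (@le_lt_trans _ _ ((C + 1) * `|s - t|)).
    by rewrite ler_wpM2r// lerDl.
  by rewrite mulrC -ltr_pdivlMr// ltr_wpDl.
have kkg : {for t, continuous (kinv i \o (k i \o g))}.
  by apply: continuous_comp => //; exact: kic.
have E : \forall s \near t, (kinv i \o (k i \o g)) s = g s.
  apply/near_R; exists e => // s se /=; rewrite kK//.
  by have [] := h s t se; rewrite ?subrr ?normr0.
rewrite /prop_for /continuous_at -(nbhs_singleton E).
apply: cvg_trans kkg; apply: near_eq_cvg.
by apply: filterS E => s ->.
Qed.

(** Expand the coordinate change to first order at [g s]: the remainder is quadratic in the
    increment of coordinates, hence in time, and the linear part sends X i to X j. *)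
Lemma solution_at_chart i j g t : solution_at i g t -> dom j (g t) ->
  solution_at j g t.
Proof.
have [_ domO _ _ _] := charts.
move=> si dj; have gc := solution_at_continuous si.
move: si => [C [e [e0 C0 h]]].
have di : dom i (g t) by have [] := h t t; rewrite ?subrr ?normr0.
have [J [K [ O [K0 Og hO]]]] := trans di dj.
have /gc/near_R[r r0 hr] : nbhs (g t) (O `&` dom j).
  by apply: filterI => //; apply: open_nbhs_nbhs; split.
exists (K * C ^+ 2 * (e *+ 2) + K * C + K * C ^+ 2), (Num.min e r); split.
- by rewrite lt_min e0.
- by rewrite !addr_ge0 ?mulr_ge0 ?exprn_ge0 ?mulrn_wge0// ltW.
move=> s s'; rewrite !lt_min => /andP[se sr] /andP[s'e s'r].
have [/= Os ds] := hr _ sr; have [/= Os' _] := hr _ s'r.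
have [_ h1 h2] := h s s' se s'e.
have [XE JC /(_ _ Os') q] := hO _ Os.
set a := k i (g s') - k i (g s) in h1 h2 q *.
have sq : K * `|a| ^+ 2 <= K * C ^+ 2 * (s' - s) ^+ 2.
  rewrite -mulrA ler_wpM2l// -(real_normK (num_real (s' - s))) -exprMn.
  by rewrite lerXn2r ?nnegrE// mulr_ge0.
have ss : `|s' - s| <= e *+ 2.
  rewrite -(subrKA t) mulr2n; apply: (le_trans (ler_normD _ _)).
  by rewrite lerD// ltW// distrC.
split => //.
  rewrite -(subrK (a *m J (g s)) (k j (g s') - k j (g s))).
  apply: (le_trans (ler_normD _ _)).
  rewrite [leRHS](_ : _ = K * C ^+ 2 * (e *+ 2) * `|s' - s| +
    (K * (C * `|s' - s|) + K * C ^+ 2 * `|s' - s|)); last by ring.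
  rewrite lerD//.
    apply: (le_trans q); apply: (le_trans sq); rewrite -[leRHS]mulrA ler_wpM2l//.
      by rewrite mulr_ge0// exprn_ge0.
    by rewrite -(real_normK (num_real (s' - s))) expr2 ler_wpM2r.
  apply: (le_trans (JC _)); rewrite -[leLHS]addr0 lerD//.
    by rewrite ler_wpM2l.
  by rewrite mulr_ge0// mulr_ge0// exprn_ge0.
rewrite XE.
rewrite (_ : k j (g s') - k j (g s) - _ =
  (k j (g s') - k j (g s) - a *m J (g s)) +
  (a - (s' - s) *: X i (g s)) *m J (g s)); last first.
  by rewrite [(a - _) *m _]mulmxBl -scalemxAl addrA subrK.
apply: (le_trans (ler_normD _ _)).
rewrite [leRHS](_ : _ = K * C ^+ 2 * (e *+ 2) * (s' - s) ^+ 2 +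
  (K * C ^+ 2 * (s' - s) ^+ 2 + K * (C * (s' - s) ^+ 2))); last by ring.
rewrite -[leLHS]add0r lerD//.
  rewrite mulr_ge0 ?exprn_even_ge0// ?mulr_ge0 ?exprn_ge0//.
  by rewrite mulrn_wge0// ltW.
rewrite lerD//; first exact: le_trans sq.
by apply: (le_trans (JC _)); rewrite ler_wpM2l.
Qed.

Lemma solution_shift J g s : solution J g ->
  solution [set t | J (s + t)] (fun t => g (s + t)).
Proof.
move=> sg t /= /sg[i [C [e [e0 C0 h]]]]; exists i, C, e; split => // u u' ue u'e.
have E v : s + v - (s + t) = v - t by rewrite opprD addrACA subrr add0r.
have := h (s + u) (s + u'); rewrite !E => /(_ ue u'e).
by rewrite opprD addrACA subrr add0r.
Qed.

(** Gronwall in the chart i, with initial distance 0. *)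
Lemma solution_eq_near g1 g2 t i : solution_at i g1 t -> solution_at i g2 t ->
  g1 t = g2 t -> \forall s \near t, g1 s = g2 s.
Proof.
have [_ domO _ _ kK] := charts.
move=> s1 s2 g12; have c1 := solution_at_continuous s1.
have c2 := solution_at_continuous s2.
move: s1 s2 => [C1 [e1 [e10 C10 h1]]] [C2 [e2 [e20 C20 h2]]].
have d1 : dom i (g1 t) by have [] := h1 t t; rewrite ?subrr ?normr0.
have [L [ O [L0 Og LO]]] := lip d1.
have /c1/near_R[r1 r10 hr1] : nbhs (g1 t) O by [].
have /c2/near_R[r2 r20 hr2] : nbhs (g2 t) O by rewrite -g12.
pose e := Num.min (Num.min e1 e2) (Num.min r1 r2).
have e0 : 0 < e by rewrite !lt_min e10 e20 r10 r20.
apply/near_R; exists (e / 2); first by rewrite divr_gt0.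
move=> s se.
have T0 : 0 < e / 2 by rewrite divr_gt0.
have inE u : `|u| <= e / 2 -> [/\ `|t + u - t| < e1, `|t + u - t| < e2,
    `|t + u - t| < r1 & `|t + u - t| < r2].
  move=> ue; have : `|t + u - t| < e.
    by rewrite addrC addKr; apply: (le_lt_trans ue); rewrite ltr_pdivrMr// ltr_pMr// ltr1n.
  by rewrite !lt_min => /andP[/andP[-> ->] /andP[-> ->]].
have dE (u u' : R) : t + u' - (t + u) = u' - u.
  by rewrite opprD addrACA subrr add0r.
pose C := Num.max C1 C2.
have q1 : quadratic_tangent (e / 2) C (fun u => k i (g1 (t + u)))
    (fun u => X i (g1 (t + u))).
  move=> u u' /inE[a _ _ _] /inE[a' _ _ _]; have [_ _] := h1 _ _ a a'.
  rewrite dE => /le_trans; apply; rewrite ler_wpM2r ?exprn_even_ge0//.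
  by rewrite le_max lexx.
have q2 : quadratic_tangent (e / 2) C (fun u => k i (g2 (t + u)))
    (fun u => X i (g2 (t + u))).
  move=> u u' /inE[_ a _ _] /inE[_ a' _ _]; have [_ _] := h2 _ _ a a'.
  rewrite dE => /le_trans; apply; rewrite ler_wpM2r ?exprn_even_ge0//.
  by rewrite le_max lexx orbT.
have C0 : 0 <= C by rewrite le_max C10.
have := quadratic_tangent_dist L0 C0 q1 q2 _ (t := s - t).
have se' : `|s - t| <= e / 2 by exact: ltW.
have ts : t + (s - t) = s by rewrite addrC subrK.
rewrite addr0 g12 subrr normr0 mulr0 ts => H.
have {}H : `|k i (g1 s) - k i (g2 s)| <= 0.
  apply: H => // u /inE[_ _ a b]; apply: LO; [exact: hr1|exact: hr2].
have [a1 a2 _ _] := inE _ se'; rewrite ts in a1 a2.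
have [ds1 _ _] := h1 s s a1 a1; have [ds2 _ _] := h2 s s a2 a2.
move: H; rewrite normr_le0 subr_eq0 => /eqP H.
by rewrite -(kK _ _ ds1) -(kK _ _ ds2) H.
Qed.

(** The coincidence set is clopen in the connected set J: open by [solution_eq_near] in a common
    chart, closed because N is Hausdorff. *)
Lemma solution_unique J g1 g2 t0 : open J -> connected J ->
  solution J g1 -> solution J g2 -> J t0 -> g1 t0 = g2 t0 ->
  forall t, J t -> g1 t = g2 t.
Proof.
have [haus _ _ _ _] := charts.
move=> oJ cJ s1 s2 Jt0 g0.
pose A := [set t | J t /\ g1 t = g2 t].
have AE : A = J; last by move=> t; rewrite -AE => -[].
apply: cJ; first by exists t0.
- exists A => //; last by rewrite setIidr// => t [].
  rewrite openE => t [Jt gt].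
  have [i si] := s1 _ Jt; have [j sj] := s2 _ Jt.
  have di : dom i (g2 t).
    have [C [e [e0 _ h]]] := si; rewrite -gt.
    by have [] := h t t; rewrite ?subrr ?normr0.
  have := solution_eq_near si (solution_at_chart sj di) gt.
  have nJ : nbhs t J by exact: (open_nbhs_nbhs (conj oJ Jt)).
  by move=> H; exact: filterS (filterI nJ H).
- exists (~` (J `\` A)); last first.
    apply/seteqP; split => [t [Jt gt]|t [Jt /= nA]].
      by split => // -[_]; apply.
    by split => //; apply: contrapT => gt; apply: nA; split => // -[].
  apply: open_closedC; rewrite openE => t [Jt nA].
  have gt : g1 t != g2 t by apply/eqP => gt; apply: nA.
  have := haus; rewrite open_hausdorff.
  move=> /(_ _ _ gt)[[U W] /= [Ut Wt] [oU oW /eqP UW]].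
  have [i si] := s1 _ Jt; have [j sj] := s2 _ Jt.
  have nU : nbhs t (g1 @^-1` U).
    apply: (solution_at_continuous si); apply: open_nbhs_nbhs.
    by split => //; rewrite inE in Ut.
  have nW : nbhs t (g2 @^-1` W).
    apply: (solution_at_continuous sj); apply: open_nbhs_nbhs.
    by split => //; rewrite inE in Wt.
  have nJ : nbhs t J by exact: (open_nbhs_nbhs (conj oJ Jt)).
  apply: filterS (filterI nJ (filterI nU nW)) => s [Js [Us Ws]].
  split => // -[_ gs]; have : (U `&` W) (g1 s) by split => //; rewrite gs.
  by rewrite UW.
Qed.

Let unit_itv : set R := [set t | `|t| < 1].

Let unit_itv_open : open unit_itv.
Proof.
rewrite openE => t t1; apply/near_R; exists (1 - `|t|); first by rewrite subr_gt0.
move=> z zt; rewrite /unit_itv /= -(subrK t z).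
by apply: (le_lt_trans (ler_normD _ _)); rewrite -ltrBrDr.
Qed.

(** The field is read in the chart given by [uniform_time] and extended from the ball to the whole
    space by the box retraction, so that [flow_box_solution] applies. Solutions starting within half
    the radius of that ball move by at most the other half up to time 1, hence never see the
    extension. *)
Lemma flow_box e : exists i (r : R), [/\ 0 < r, dom i e &
  exists (G : N -> R -> N) (L : R),
  [/\ 0 <= L, forall e', dom i e' -> `|k i e' - k i e| <= r ->
    [/\ G e' 0 = e', solution unit_itv (G e') &
     forall t, `|t| <= 1 -> dom i (G e' t)],
   forall e1 t t', dom i e1 -> `|k i e1 - k i e| <= r -> `|t| <= 1 ->
     `|t'| <= 1 -> `|k i (G e1 t') - k i (G e1 t)| <= L * `|t' - t| &
   forall e1 e2 t, dom i e1 -> `|k i e1 - k i e| <= r ->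
     dom i e2 -> `|k i e2 - k i e| <= r -> `|t| <= 1 ->
     `|k i (G e1 t) - k i (G e2 t)| <= expR L * `|k i e1 - k i e2|]].
Proof.
have [_ domO kc kic kK] := charts.
have [i [r [r0 de hr]]] := time e; exists i, (r / 2).
have r20 : 0 < r / 2 by rewrite divr_gt0.
split => //; pose y0 := k i e.
pose f0 y := X i (kinv i y).
have [L0 L00 hL0] : exists2 C, 0 <= C & forall y z,
    [set z | `|z - y0| <= r] y -> [set z | `|z - y0| <= r] z ->
    `|f0 y - f0 z| <= C * `|y - z|.
  apply: compact_lipschitz; first exact: compact_cball.
  move=> y /= yr; have [dy ky _] := hr _ yr.
  have [C [ O [C0 Oy hO]]] := lip dy.
  have : {for y, continuous (kinv i)} by rewrite -{1}ky; exact: kic.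
  move=> /(_ _ Oy)/near_rV[s s0 hs]; exists C, s; split => // z w zr wr zs ws.
  have [_ kz _] := hr _ zr; have [_ kw _] := hr _ wr.
  by rewrite -[in leRHS]kz -[in leRHS]kw; apply: hO; exact: hs.
pose f y := f0 (box_retract y0 r y).
have rin y := box_retract_in y0 (ltW r0) y.
have fB y : `|f y| <= r / 2 by have [_ _] := hr _ (rin y).
have fL y z : `|f y - f z| <= L0 * `|y - z|.
  apply: (le_trans (hL0 _ _ (rin y) (rin z))); rewrite ler_wpM2l//.
  exact: box_retract_lip (ltW r0) _ _.
have [g hg] := choice (fun y => flow_box_solution y L00 fB fL).
have {hg}[Cg hg] := choice hg.
have g0 y : g y 0 = y by have [] := hg y.
have gS y t t' : `|t| <= 1 -> `|t'| <= 1 ->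
    `|g y t' - g y t| <= r / 2 * `|t' - t|.
  move=> t1 t'1; have [_ C0 q] := hg y.
  by apply: (quadratic_tangent_speed C0 q) => // s _; exact: fB.
have gin y t : `|y - y0| <= r / 2 -> `|t| <= 1 -> `|g y t - y0| <= r.
  move=> yr t1; rewrite -(subrKA y) (splitr r).
  apply: (le_trans (ler_normD _ _)); rewrite lerD//.
  have := @gS y 0 t; rewrite normr0 ler01 => /(_ isT t1).
  rewrite g0 subr0 => /le_trans; apply; apply: ler_piMr => //; exact: ltW.
exists (fun e' t => kinv i (g (k i e') t)), (Num.max (r / 2) L0).
have kg e' t : `|k i e' - k i e| <= r / 2 -> `|t| <= 1 ->
    [/\ dom i (kinv i (g (k i e') t)),
     k i (kinv i (g (k i e') t)) = g (k i e') t &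
     X i (kinv i (g (k i e') t)) = f (g (k i e') t)].
  move=> er t1; have gr := gin _ _ er t1; have [d1 kE _] := hr _ gr.
  by split => //; rewrite /f box_retract_id// ltW.
split.
- by rewrite le_max (ltW r20).
- move=> e' de' er; split; first by rewrite g0 kK.
    move=> t t1; exists i, (Num.max (Cg (k i e')) (r / 2)), (1 - `|t|).
    split; [by rewrite subr_gt0|by rewrite le_max (ltW r20) orbT|].
    move=> s s' st s't.
    have sin u : `|u - t| < 1 - `|t| -> `|u| <= 1.
      move=> ut; rewrite -(subrK t u); apply: (le_trans (ler_normD _ _)).
      by rewrite -lerBrDr ltW.
    have [d1 k1 x1] := kg _ _ er (sin _ st); have [_ k2 _] := kg _ _ er (sin _ s't).
    rewrite k1 k2 x1; split => //.
      apply: (le_trans (gS _ _ _ (sin _ st) (sin _ s't))).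
      by rewrite ler_wpM2r// le_max lexx orbT.
    have [_ _ q] := hg (k i e').
    apply: (le_trans (q _ _ (sin _ st) (sin _ s't))).
    by rewrite ler_wpM2r ?exprn_even_ge0// le_max lexx.
  by move=> t t1; have [] := kg _ _ er t1.
- move=> e1 t t' d1 er t1 t'1.
  have [_ -> _] := kg _ _ er t1; have [_ -> _] := kg _ _ er t'1.
  by apply: (le_trans (gS _ _ _ t1 t'1)); rewrite ler_wpM2r// le_max lexx.
- move=> e1 e2 t d1 er1 d2 er2 t1.
  have [_ -> _] := kg _ _ er1 t1; have [_ -> _] := kg _ _ er2 t1.
  have [_ C1 q1] := hg (k i e1); have [_ C2 q2] := hg (k i e2).
  pose C := Num.max (Cg (k i e1)) (Cg (k i e2)).
  have C0 : 0 <= C by rewrite le_max C1.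
  have q1' : quadratic_tangent 1 C (g (k i e1)) (f \o g (k i e1)).
    move=> s s' s1 s'1; apply: (le_trans (q1 _ _ s1 s'1)).
    by rewrite ler_wpM2r ?exprn_even_ge0// le_max lexx.
  have q2' : quadratic_tangent 1 C (g (k i e2)) (f \o g (k i e2)).
    move=> s s' s1 s'1; apply: (le_trans (q2 _ _ s1 s'1)).
    by rewrite ler_wpM2r ?exprn_even_ge0// le_max lexx orbT.
  have := quadratic_tangent_dist L00 C0 q1' q2' _ t1; rewrite !g0.
  move=> /(_ (fun s _ => fL _ _)) /le_trans; apply.
  rewrite ler_wpM2r// ler_expR; apply: (@le_trans _ _ L0).
    exact: ler_piMr.
  by rewrite le_max lexx orbT.
Qed.

Lemma solution_subset (J J' : set R) g : J `<=` J' -> solution J' g -> solution J g.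
Proof. by move=> JJ' sg t /JJ'; exact: sg. Qed.

Lemma interval_connected (J : set R) :
  (forall x y z, J x -> J y -> x <= z <= y -> J z) -> connected J.
Proof. by move=> h; apply/connected_intervalP => x y Jx Jy z; exact: h. Qed.

Let unit_itv_shift s : let J := [set t | unit_itv t /\ unit_itv (s + t)] in
  open J /\ connected J.
Proof.
split.
  apply: openI => //.
  rewrite openE => t t1.
  have /near_R[r r0 hr] : nbhs (s + t) unit_itv.
    exact: (open_nbhs_nbhs (conj unit_itv_open t1)).
  apply/near_R; exists r => // z zt; apply: hr.
  by rewrite opprD addrACA subrr add0r.
apply: interval_connected => x y z [x1 sx1] [y1 sy1] /andP[xz zy].
move: x1 sx1 y1 sy1; rewrite /unit_itv /= !ltr_norml.
move=> /andP[? ?] /andP[? ?] /andP[? ?] /andP[? ?].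
by split; rewrite /unit_itv /= ?ltr_norml; apply/andP; split; lra.
Qed.

(** At each point some solution is chosen, with no regularity in the point. Uniqueness identifies
    these choices near any e with the solutions of the flow box at e, which depend continuously on
    time and starting point. *)
Lemma local_flow : exists phi : N -> R -> N,
  [/\ forall e, phi e 0 = e, forall e, solution unit_itv (phi e),
   forall e s t, `|s| < 1 -> `|t| < 1 -> `|s + t| < 1 ->
     phi e (s + t) = phi (phi e s) t &
   forall t e, `|t| < 1 -> {for (t, e), continuous (fun p : R * N => phi p.2 p.1)}].
Proof.
have [haus domO kc kic kK] := charts.
have ex e : exists g : R -> N, g 0 = e /\ solution unit_itv g.
  have [i [r [r0 de [G [L [L0 hG _ _]]]]]] := flow_box e.
  have [|G0 sG _] := hG e de; first by rewrite subrr normr0 ltW.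
  by exists (G e).
have [phi hphi] := choice ex.
have uo : open unit_itv by [].
have uc : connected unit_itv.
  apply: interval_connected => x y z.
  rewrite /unit_itv /= !ltr_norml => /andP[? ?] /andP[? ?] /andP[? ?].
  by apply/andP; split; lra.
have u0 : unit_itv 0 by rewrite /unit_itv /= normr0.
exists phi; split.
- by move=> e; have [] := hphi e.
- by move=> e; have [] := hphi e.
- move=> e s t s1 t1 st1; have [p0 sp] := hphi e; have [q0 sq] := hphi (phi e s).
  have [oJ cJ] := unit_itv_shift s.
  apply: (solution_unique (g1 := fun t => phi e (s + t)) (t0 := 0) oJ cJ) => //.
  + by apply: (solution_subset _ (solution_shift (s := s) sp)) => u [].
  + by apply: (solution_subset _ sq) => u [].
  + by split => //; rewrite addr0.
  + by rewrite addr0 q0.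
- move=> t e t1.
  have [i [r [r0 de [G [L [L0 hG hL hE]]]]]] := flow_box e.
  have pG e' u : dom i e' -> `|k i e' - k i e| <= r -> `|u| < 1 ->
      phi e' u = G e' u.
    move=> de' er u1; have [p0 sp] := hphi e'; have [g0 sg _] := hG e' de' er.
    by apply: (solution_unique uo uc sp sg u0) => //; rewrite p0 g0.
  have ee : `|k i e - k i e| <= r by rewrite subrr normr0 ltW.
  have [_ _ dG] := hG e de ee.
  have nt : nbhs t unit_itv by exact: (open_nbhs_nbhs (conj uo t1)).
  have ne : nbhs e [set e' | dom i e' /\ `|k i e' - k i e| < r].
    apply: filterI; first exact: (open_nbhs_nbhs (conj (domO i) de)).
    have := kc _ _ de; move/continuous_rV; exact.
  have cG : {for (t, e), continuous (fun p : R * N => k i (G p.2 p.1))}.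
    apply/continuous_rV => eps eps0.
    pose K1 := L + 1; pose K2 := expR L + 1.
    have K10 : 0 < K1 by rewrite ltr_wpDl.
    have K20 : 0 < K2 by rewrite ltr_wpDl// expR_ge0.
    have n1 : nbhs t [set u | `|u - t| < eps / 2 / K1].
      by apply/near_R; exists (eps / 2 / K1) => //; rewrite !divr_gt0.
    have n2 : nbhs e [set e' | `|k i e' - k i e| < eps / 2 / K2].
      have := kc _ _ de; move/continuous_rV; apply; by rewrite !divr_gt0.
    exists (unit_itv `&` [set u | `|u - t| < eps / 2 / K1],
      [set e' | dom i e' /\ `|k i e' - k i e| < r] `&`
      [set e' | `|k i e' - k i e| < eps / 2 / K2]).
      by split; apply: filterI.
    move=> [u e'] /= [[u1 ut] [[de' er] ek]].
    rewrite -(subrKA (k i (G e u))) (splitr eps).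
    apply: (le_lt_trans (ler_normD _ _)); rewrite ltrD//.
      apply: (le_lt_trans (hE _ _ _ de' (ltW er) de ee (ltW u1))).
      apply: (@le_lt_trans _ _ (K2 * `|k i e' - k i e|)).
        by rewrite ler_wpM2r// lerDl.
      by rewrite mulrC -ltr_pdivlMr.
    apply: (le_lt_trans (hL _ _ _ de ee (ltW t1) (ltW u1))).
    apply: (@le_lt_trans _ _ (K1 * `|u - t|)).
      by rewrite ler_wpM2r// lerDl.
    by rewrite mulrC -ltr_pdivlMr.
  have ckG : {for (t, e), continuous (kinv i \o (fun p : R * N => k i (G p.2 p.1)))}.
    apply: continuous_comp => //=.
    by apply: kic; apply: dG; exact: ltW.
  have E : \forall p \near (t, e),
      (kinv i \o (fun p : R * N => k i (G p.2 p.1))) p = phi p.2 p.1.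
    exists (unit_itv, [set e' | dom i e' /\ `|k i e' - k i e| < r]) => //.
    move=> [u e'] /= [u1 [de' er]].
    have er' := ltW er; rewrite pG// kK//.
    by have [_ _ dG'] := hG e' de' er'; exact: (dG' _ (ltW u1)).
  rewrite /prop_for /continuous_at -(nbhs_singleton E).
  apply: cvg_trans ckG; apply: near_eq_cvg.
  by apply: filterS E => s ->.
Qed.

Lemma iter_commute (T : Type) (f g : T -> T) n x :
  (forall y, f (g y) = g (f y)) ->
  iter n (fun y => f (g y)) x = iter n f (iter n g x).
Proof.
move=> fg; elim: n => //= n ->; congr f.
by move: (iter n g x) => y; elim: n => //= n <-; rewrite fg.
Qed.

(** [Phi t] is the n-th iterate of the local flow at time t / n, for any n > |t|. The choice of n
    does not matter because two choices have their product as a common refinement; the group law and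
    continuity are then checked with a fixed n. *)
Lemma complete_flow : exists Phi : R -> N -> N,
  [/\ flow Phi, forall e, solution setT (Phi^~ e) &
   forall g, solution setT g -> forall t, g t = Phi t (g 0)].
Proof.
have [phi [p0 ps pD pc]] := local_flow.
pose E n t e := iter n (phi^~ (t / n%:R)) e.
(* By the partial group law, one step of length less than 1 equals j steps that are j times
   shorter. *)
have E1 n j t e : `|t| < n%:R -> (0 < j)%N ->
    phi e (t / n%:R) = iter j (phi^~ (t / (n * j)%N%:R)) e.
  move=> tn j0.
  have n0 : 0 < n%:R :> R by exact: le_lt_trans tn.
  have j0' : 0 < j%:R :> R by rewrite ltr0n.
  pose s := t / n%:R.
  have s1 : `|s| < 1 by rewrite normrM normfV (ger0_norm (ltW n0)) ltr_pdivrMr// mul1r.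
  have -> : t / (n * j)%N%:R = s / j%:R by rewrite natrM invfM mulrA.
  have bnd i : (i <= j)%N -> `|i%:R * (s / j%:R)| < 1.
    move=> ij; apply: le_lt_trans s1.
    rewrite mulrCA normrM ler_piMr// ger0_norm ?divr_ge0//.
    by rewrite ler_pdivrMr// mul1r ler_nat.
  have H i : (i <= j)%N -> iter i (phi^~ (s / j%:R)) e = phi e (i%:R * (s / j%:R)).
    elim: i => [|i IH] ij; first by rewrite mul0r p0.
    rewrite iterS IH ?(ltnW ij)// -natr1 mulrDl mul1r pD//.
    - by apply: bnd; exact: ltnW.
    - by have := bnd 1%N j0; rewrite mul1r.
    - by have := bnd _ ij; rewrite -natr1 mulrDl mul1r.
  by rewrite H// mulrCA divff ?mulr1// gt_eqF.
have EM n j t e : `|t| < n%:R -> (0 < j)%N -> E n t e = E (n * j)%N t e.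
  by move=> tn j0; rewrite /E iterM; apply: eq_iter => y; exact: E1.
have Enm n j t e : `|t| < n%:R -> `|t| < j%:R -> E n t e = E j t e.
  move=> tn tj.
  have n0 : (0 < n)%N by rewrite -(ltr0n R); exact: le_lt_trans tn.
  have j0 : (0 < j)%N by rewrite -(ltr0n R); exact: le_lt_trans tj.
  by rewrite (EM n j)// (EM j n)// mulnC.
pose Phi t e := E (Num.truncn `|t|).+1 t e.
have PhiE n t e : `|t| < n%:R -> Phi t e = E n t e.
  by move=> tn; apply: Enm => //; exact: truncnS_gt.
have Phi1 t e : `|t| < 1 -> Phi t e = phi e t.
  by move=> t1; rewrite (PhiE 1%N)// /E /= divr1.
have PhiD s t e : Phi (s + t) e = Phi s (Phi t e).
  have [n stn] : exists n, `|s| + `|t| < n%:R.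
    by exists (Num.truncn (`|s| + `|t|)).+1; exact: truncnS_gt.
  have n0 : 0 < n%:R :> R by apply: le_lt_trans stn; rewrite addr_ge0.
  have sn : `|s| < n%:R by apply: le_lt_trans stn; rewrite lerDl.
  have tn : `|t| < n%:R by apply: le_lt_trans stn; rewrite lerDr.
  have stn' : `|s + t| < n%:R by apply: le_lt_trans stn; exact: ler_normD.
  have le1 (u : R) : `|u| < n%:R -> `|u / n%:R| < 1.
    by move=> un; rewrite normrM normfV (ger0_norm (ltW n0)) ltr_pdivrMr// mul1r.
  rewrite !(PhiE n)// /E -iter_commute.
    apply: eq_iter => y; rewrite [s + t]addrC mulrDl pD ?le1//.
    by rewrite -mulrDl le1// addrC.
  move=> y; rewrite -!pD ?le1//; first by rewrite addrC.
    by rewrite -mulrDl le1.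
  by rewrite -mulrDl le1// addrC.
have Phi0 e : Phi 0 e = e by rewrite Phi1 ?normr0.
have Phis e : solution setT (Phi^~ e).
  move=> t _; have u0 : unit_itv 0 by rewrite /unit_itv /= normr0.
  have [i [C [r [r0 C0 h]]]] := ps (Phi t e) 0 u0.
  exists i, C, (Num.min r 1); split => //; first by rewrite lt_min r0 ltr01.
  move=> s s'; rewrite !lt_min => /andP[sr s1] /andP[s'r s'1].
  have PE u : `|u - t| < 1 -> Phi u e = phi (Phi t e) (u - t).
    by move=> ut; rewrite -Phi1// -PhiD subrK.
  rewrite (PE _ s1) (PE _ s'1).
  have e1 : s' - t - (s - t) = s' - s by rewrite opprB addrA subrK.
  have := h (s - t) (s' - t); rewrite !subr0 e1 => hh.
  exact: hh sr s'r.
exists Phi; split => //; first split => //.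
  move=> [t e]; have [n tn] : exists n, `|t| + 1 < n%:R.
    by exists (Num.truncn (`|t| + 1)).+1; exact: truncnS_gt.
  have n0 : 0 < n%:R :> R by apply: le_lt_trans tn; rewrite addr_ge0.
  have cE j : {for (t, e), continuous
      (fun p : R * N => iter j (phi^~ (p.1 / n%:R)) p.2)}.
    elim: j => [|j IH]; first exact: cvg_snd.
    set F := (fun p : R * N => iter j (phi^~ (p.1 / n%:R)) p.2) in IH.
    pose H := fun p : R * N => (p.1 / n%:R, F p).
    have cH : {for (t, e), continuous H}.
      apply: (cvg_pair (G := nbhs (t / n%:R)) (H := nbhs (F (t, e)))); last exact: IH.
      by apply: cvgM; [exact: cvg_fst|exact: cvg_cst].
    apply: (@continuous_comp _ _ _ H (fun p : R * N => phi p.2 p.1)) => //.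
    apply: pc; rewrite /H /= normrM normfV (ger0_norm (ltW n0)) ltr_pdivrMr// mul1r.
    by apply: le_lt_trans tn; rewrite lerDl.
  have EE : \forall p \near (t, e), iter n (phi^~ (p.1 / n%:R)) p.2 = Phi p.1 p.2.
    exists ([set u | `|u - t| < 1], setT).
      split; [by apply/near_R; exists 1|exact: filterT].
    move=> [u e'] /= [ut _]; rewrite (PhiE n)//; apply: le_lt_trans tn.
    by rewrite -[u](subrK t) (le_trans (ler_normD _ _))// addrC lerD2l ltW.
  rewrite /prop_for /continuous_at -(nbhs_singleton EE).
  apply: cvg_trans (cE n); apply: near_eq_cvg.
  by apply: filterS EE => s ->.
move=> g sg t; apply: (solution_unique openT _ sg (Phis (g 0))) => //.
  exact: interval_connected.
Qed.

End CompleteFlow.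

(** * Functions with a Lipschitz derivative *)

Section PartialDerivatives.
Context (R : realType) (n : nat).
Implicit Types (f : 'rV[R]_n -> R) (y z v : 'rV[R]_n).

Let basis (i : 'I_n) : 'rV[R]_n := delta_mx 0 i.

Lemma derive_along f y v (t : R) : derivable f (y + t *: v) v ->
  is_derive t 1 (fun s : R => f (y + s *: v)) ('D_v f (y + t *: v)).
Proof.
have E : (fun h : R => h^-1 *: (f (h *: v + (y + t *: v)) - f (y + t *: v))) =
   (fun h : R => h^-1 *: (f (y + (h *: 1 + t) *: v) - f (y + t *: v))).
  apply/funext => h; congr (_ *: (f _ - _)).
  by rewrite addrCA scalerDl [h *: 1]mulr1 addrA.
move=> df; apply: DeriveDef.
  by rewrite /derivable/= -E.
by rewrite /derive/= -E.
Qed.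

(** The segment is parametrised by l in [[0, 1]] so that t may have any sign. *)
Lemma mvt_direction f y v (t : R) :
  (forall l : R, 0 <= l <= 1 -> derivable f (y + (l * t) *: v) v) ->
  exists2 l : R, 0 <= l <= 1 &
    f (y + t *: v) - f y = t * 'D_v f (y + (l * t) *: v).
Proof.
move=> df; pose h (s : R) := f (y + s *: v); pose g (l : R) := h (l * t).
pose dg (l : R) := 'D_v f (y + (l * t) *: v) * t.
have gd (l : R) : 0 <= l <= 1 -> is_derive l 1 g (dg l).
  move=> l01; apply: (@is_derive1_comp _ h ( *%R^~ t)).
    by apply: derive_along; exact: df.
  by apply: is_derive_eq; rewrite scaler0 add0r; exact: mulr1.
have hs (l : R) : l \in `[0, 1] -> 0 <= l <= 1 by rewrite in_itv.
have gc : {within `[(0 : R), 1], continuous g}.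
  apply: continuous_in_subspaceT => s sab.
  apply: differentiable_continuous; apply/derivable1_diffP.
  by have [] := gd s (hs _ (set_mem sab)).
have [||l l01 gE] := @MVT_segment R g dg 0 1 ler01.
- by move=> s /subset_itv_oo_cc s0t; apply: gd; exact: hs.
- exact: gc.
exists l; first exact: hs.
by move: gE; rewrite /g /h mul1r mul0r scale0r addr0 subr0 mulr1 /dg mulrC.
Qed.

(** Go from y to y' by changing one coordinate at a time. In the max norm the intermediate points do
    not leave the ball, nor are they further from y than y' is. *)
Lemma mvt_coordinates f z (r : R) y y' :
  (forall i x, `|x - z| < r -> derivable f x (basis i)) ->
  `|y - z| < r -> `|y' - z| < r ->
  exists2 x : 'I_n -> 'rV[R]_n,
    forall i, `|x i - y| <= `|y' - y| /\ `|x i - z| < r &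
    f y' - f y = \sum_i (y' - y) 0 i * 'D_(basis i) f (x i).
Proof.
move=> df yr y'r.
pose p k : 'rV[R]_n := \row_j (if (j < k)%N then y' 0 j else y 0 j).
have r0 : 0 < r by exact: le_lt_trans yr.
have inb (x : 'rV[R]_n) : (forall j, exists2 l : R, 0 <= l <= 1 &
    x 0 j = y 0 j + l * (y' 0 j - y 0 j)) -> `|x - y| <= `|y' - y| /\ `|x - z| < r.
  move=> h; split.
    apply: norm_le_coord => // i j; rewrite ord1; have [l /andP[l0 l1] xE] := h j.
    have := coord_le_norm (y' - y) 0 j.
    have e : x 0 j - y 0 j = l * (y' 0 j - y 0 j).
      by rewrite xE addrAC subrr add0r.
    rewrite !mxE e => /(le_trans _); apply.
    by rewrite normrM ger0_norm// ler_piMl.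
  apply: (@le_lt_trans _ _ (Num.max `|y - z| `|y' - z|)); last by rewrite gt_max yr.
  apply: norm_le_coord => [|i j]; first by rewrite le_max normr_ge0.
  rewrite ord1; have [l /andP[l0 l1] xE] := h j; rewrite !mxE.
  have -> : x 0 j - z 0 j = (1 - l) * (y - z) 0 j + l * (y' - z) 0 j.
    by rewrite !mxE xE; ring.
  have l2 : 0 <= 1 - l by rewrite subr_ge0.
  apply: (le_trans (ler_normD _ _)); rewrite !normrM (ger0_norm l0) (ger0_norm l2).
  set m := Num.max _ _.
  have -> : m = (1 - l) * m + l * m by ring.
  apply: lerD; apply: ler_wpM2l => //; apply: (le_trans (coord_le_norm _ _ _)).
    by rewrite le_max lexx.
  by rewrite le_max lexx orbT.
have step (i : 'I_n) : exists x : 'rV[R]_n,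
    (`|x - y| <= `|y' - y| /\ `|x - z| < r) /\
    f (p i.+1) - f (p i) = (y' - y) 0 i * 'D_(basis i) f x.
  pose t := (y' - y) 0 i.
  have pE : p i.+1 = p i + t *: basis i.
    apply/rowP => j; rewrite !mxE ltnS eqxx /=.
    have [ji|ij|ji] := ltngtP j i.
    - rewrite (_ : (j == i) = false) ?mulr0 ?addr0//.
      by apply/eqP => ji'; rewrite ji' ltnn in ji.
    - rewrite (_ : (j == i) = false) ?mulr0 ?addr0//.
      by apply/eqP => ji'; rewrite ji' ltnn in ij.
    - have -> : j = i by exact: ord_inj.
      by rewrite eqxx mulr1 /t !mxE addrC subrK.
  have pin (l : R) : 0 <= l <= 1 ->
      `|p i + (l * t) *: basis i - y| <= `|y' - y| /\
      `|p i + (l * t) *: basis i - z| < r.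
    move=> l01; apply: inb => j; rewrite !mxE eqxx /=.
    have [ji|ij] := eqVneq j i.
      by exists l => //; rewrite ji ltnn mulr1 /t !mxE.
    rewrite mulr0 addr0; case: ifP => _.
      by exists 1; [rewrite ler01 lexx|rewrite mul1r addrC subrK].
    by exists 0; [rewrite ler01 lexx|rewrite mul0r addr0].
  have [l l01|l l01 fE] := @mvt_direction f (p i) (basis i) t.
    by apply: df; have [] := pin l l01.
  by exists (p i + (l * t) *: basis i); split; [exact: pin|rewrite pE fE].
have [x hx] := choice step; exists x; first by move=> i; have [] := hx i.
have -> : f y' - f y = \sum_(0 <= i < n) (f (p i.+1) - f (p i)).
  rewrite telescope_sumr//; congr (f _ - f _); apply/rowP => j; rewrite !mxE//.
  by rewrite ltn_ord.
by rewrite big_mkord; apply: eq_bigr => i _; have [_ ->] := hx i.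
Qed.

Lemma lipschitz_of_partials f z (r B : R) :
  (forall i x, `|x - z| < r -> derivable f x (basis i)) ->
  (forall i x, `|x - z| < r -> `|'D_(basis i) f x| <= B) ->
  forall y y', `|y - z| < r -> `|y' - z| < r ->
    `|f y' - f y| <= n%:R * B * `|y' - y|.
Proof.
move=> df fB y y' yr y'r; have [x hx ->] := mvt_coordinates df yr y'r.
apply: (le_trans (ler_norm_sum _ _ _)).
apply: (@le_trans _ _ (\sum_(i < n) B * `|y' - y|)).
  apply: ler_sum => i _; rewrite normrM mulrC ler_pM//.
    by apply: fB; have [] := hx i.
  exact: coord_le_norm.
by rewrite sumr_const card_ord -mulrA mulr_natl.
Qed.

End PartialDerivatives.

(* The constant C controls both the estimates and, through its inverse, the
   radius on which they hold, so that it may always be increased. *)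
Definition grad_est (R : realType) n C (z : 'rV[R]_n) (f : 'rV[R]_n -> R)
    (G : 'rV[R]_n -> 'cV[R]_n) : Prop :=
  0 < C /\ forall y y', `|y - z| < C^-1 -> `|y' - z| < C^-1 ->
    `|f y' - f y - ((y' - y) *m G y) 0 0| <= C * `|y' - y| ^+ 2 /\
    `|G y' - G y| <= C * `|y' - y|.

Definition c11 (R : realType) n (f : 'rV[R]_n -> R) (z : 'rV[R]_n) : Prop :=
  exists C G, grad_est C z f G.

(** Continuous second partial derivatives are bounded near z, so the first ones are Lipschitz, and
    the mean value expansion along coordinates has a quadratic remainder. *)
Lemma Ck2_c11 (R : realType) d (U : set 'rV[R]_d) f z :
  open U -> U z -> Ck 2 U f ->
  exists C, grad_est C z f (fun y => \col_i 'D_(delta_mx 0 i) f y).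
Proof.
move=> oU Uz [fc hf].
have [r0 r00 hr0] : exists2 r : R, 0 < r & forall y, `|y - z| < r -> U y.
  by apply/near_rV; exact: (open_nbhs_nbhs (conj oU Uz)).
have bnd (ij : 'I_d * 'I_d) : exists B : R, 0 < B /\ forall y, `|y - z| < B^-1 ->
    `|'D_(delta_mx 0 ij.1) ('D_(delta_mx 0 ij.2) f) y| <= B.
  have [_ [_ h2]] := hf ij.2; have [_ [h3 _]] := h2 ij.1.
  set g := 'D_ _ _ in h3 *.
  have : \forall y \near z, `|g y - g z| < 1.
    have /(@cvg_dist R R^o) : g @ z --> g z by exact: h3.
    exact.
  (* The bound proper is [1 + |g z|]; the summand r^-1 forces the inverse of the constant to be at
     most r. *)
  move=> /near_rV[r r1 hr]; exists (1 + `|g z| + r^-1); split.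
    by rewrite addr_gt0 ?invr_gt0// ltr_pwDl.
  move=> y yr; have {}yr : `|y - z| < r.
    apply: (lt_le_trans yr); rewrite invf_ple ?posrE ?lerDr//.
    by rewrite addr_gt0 ?invr_gt0// ltr_pwDl.
  apply: (@le_trans _ _ (1 + `|g z|)); last by rewrite lerDl invr_ge0 ltW.
  have tri : `|g y| <= `|g y - g z| + `|g z|.
    by rewrite -{1}(subrK (g z) (g y)) ler_normD.
  by apply: (le_trans tri); rewrite lerD2r ltW// hr.
have [B hB] := choice bnd.
pose C1 := \sum_ij B ij + r0^-1.
have B0 ij : 0 <= B ij by have [/ltW] := hB ij.
have C10 : 0 < C1 by rewrite ltr_wpDl ?invr_gt0// sumr_ge0.
have leC1 ij : B ij <= C1.
  rewrite /C1 (bigD1 ij)//= -addrA lerDl addr_ge0 ?invr_ge0 ?(ltW r00)//.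
  exact: sumr_ge0.
have inU y : `|y - z| < C1^-1 -> U y.
  move=> yz; apply: hr0; apply: (lt_le_trans yz).
  by rewrite invf_ple ?posrE// lerDr sumr_ge0.
have inB ij y : `|y - z| < C1^-1 -> `|y - z| < (B ij)^-1.
  move=> yz; apply: (lt_le_trans yz); rewrite lef_pV2 ?posrE//.
  by have [] := hB ij.
have D2 j y y' : `|y - z| < C1^-1 -> `|y' - z| < C1^-1 ->
   `|'D_(delta_mx 0 j) f y' - 'D_(delta_mx 0 j) f y| <= d%:R * C1 * `|y' - y|.
  move=> yz y'z; apply: (@lipschitz_of_partials R d ('D_(delta_mx 0 j) f) z
    C1^-1 C1 _ _ y y' yz y'z) => i x xz.
    by have [_ [_ h2]] := hf j; have [h3 _] := h2 i; apply: h3; exact: inU.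
  have [_ h] := hB (i, j); apply: (le_trans (h _ (inB _ _ xz))).
  exact: leC1.
pose C := C1 + (1 + d%:R) * (d%:R * C1).
have dC : 0 <= d%:R * C1 by rewrite mulr_ge0// ltW.
have C1C : C1 <= C by rewrite lerDl mulr_ge0// addr_ge0.
have C0 : 0 < C by exact: lt_le_trans C1C.
exists C; split => // y y' yz y'z.
have CC1 : C^-1 <= C1^-1 by rewrite lef_pV2 ?posrE.
have {}yz := lt_le_trans yz CC1; have {}y'z := lt_le_trans y'z CC1.
have dCC : d%:R * (d%:R * C1) <= C.
  by rewrite /C mulrDl mul1r addrA lerDr addr_ge0// ltW.
have dCC' : d%:R * C1 <= C.
  by rewrite /C mulrDl mul1r addrCA lerDl addr_ge0 ?mulr_ge0// ltW.
split.
  have pd i x : `|x - z| < C1^-1 -> derivable f x (delta_mx 0 i).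
    by move=> xz; have [h _] := hf i; apply: h; exact: inU.
  have [x hx ->] := mvt_coordinates pd yz y'z.
  rewrite !mxE -sumrB.
  apply: (le_trans (ler_norm_sum _ _ _)).
  apply: (@le_trans _ _ (\sum_(i < d) (d%:R * C1) * `|y' - y| ^+ 2)).
    apply: ler_sum => i _; rewrite !mxE -mulrBr normrM expr2 mulrA mulrC.
    have [xy xz] := hx i.
    apply: ler_pM => //; last by have := coord_le_norm (y' - y) 0 i; rewrite !mxE.
    by apply: (le_trans (D2 _ _ _ yz xz)); rewrite ler_wpM2l.
  by rewrite sumr_const card_ord -[leLHS]mulr_natl mulrA ler_wpM2r// exprn_ge0.
apply: norm_le_coord => [|i j]; first by rewrite mulr_ge0// ltW.
rewrite !mxE; apply: (le_trans (D2 _ _ _ yz y'z)).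
by rewrite ler_wpM2r.
Qed.

Lemma mulmx_norm (R : realType) m n p (A : 'M[R]_(m, n)) (B : 'M[R]_(n, p)) :
  `|A *m B| <= n%:R * `|A| * `|B|.
Proof.
apply: norm_le_coord => [|i j]; first by rewrite !mulr_ge0.
rewrite mxE; apply: (le_trans (ler_norm_sum _ _ _)).
apply: (@le_trans _ _ (\sum_(k < n) `|A| * `|B|)).
  by apply: ler_sum => k _; rewrite normrM ler_pM ?coord_le_norm.
by rewrite sumr_const card_ord -[leLHS]mulr_natl mulrA.
Qed.

Section C11Closure.
Context (R : realType) (n : nat).
Implicit Types (f : 'rV[R]_n -> R) (z : 'rV[R]_n) (G : 'rV[R]_n -> 'cV[R]_n).

Let grad_est_bounded C z f G := grad_est C z f G /\
  forall y y', `|y - z| < C^-1 -> `|y' - z| < C^-1 ->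
    [/\ `|f y| <= C, `|G y| <= C & `|f y' - f y| <= C * `|y' - y|].

(** Products also need bounds on the functions and on their gradients. Validity for every larger
    constant lets two functions share one. *)
Let grad_est_bounds z f : c11 f z ->
  exists G C, forall C', C <= C' -> grad_est_bounded C' z f G.
Proof.
move=> [C [G [C0 h]]]; exists G.
pose D := C + 1 + `|G z|.
have D0 : 0 <= D by rewrite !addr_ge0// ltW.
pose E := C + D + (C * (1 + 1) + n%:R * D) + (`|f z| + (C * (1 + 1) + n%:R * D)) + 1.
have K0 : 0 <= C * (1 + 1) + n%:R * D by rewrite addr_ge0// mulr_ge0// ?addr_ge0// ltW.
have fz0 := normr_ge0 (f z).
have CE : C <= E by rewrite /E; lra.
have DE : D <= E by rewrite /E; have := C0; lra.
have oneE : 1 <= E by rewrite /E; have := C0; lra.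
have KE : C * (1 + 1) + n%:R * D <= E by rewrite /E; have := C0; lra.
have FE : `|f z| + (C * (1 + 1) + n%:R * D) <= E by rewrite /E; have := C0; lra.
exists E => C' EC'.
have E0 : 0 < E by exact: lt_le_trans oneE.
have C'0 : 0 < C' by exact: lt_le_trans EC'.
have CC' : C <= C' by exact: le_trans EC'.
have inv (y : 'rV[R]_n) : `|y - z| < C'^-1 -> `|y - z| < C^-1 /\ `|y - z| < 1.
  move=> yz; split; apply: (lt_le_trans yz); first by rewrite lef_pV2 ?posrE.
  by rewrite invf_le1// (le_trans oneE).
have zz : `|z - z| < C^-1 by rewrite subrr normr0 invr_gt0.
split.
  split => // y y' /inv[yz _] /inv[y'z _]; have [h1 h2] := h y y' yz y'z.
  by split; [apply: (le_trans h1)|apply: (le_trans h2)];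
    rewrite ler_wpM2r// exprn_ge0.
have Gb y : `|y - z| < C'^-1 -> `|G y| <= D.
  move=> /inv[yz y1]; have [_ h2] := h z y zz yz.
  rewrite -(subrK (G z) (G y)); apply: (le_trans (ler_normD _ _)).
  rewrite lerD2r; apply: (le_trans h2); apply: (@le_trans _ _ C).
    by apply: ler_piMr; exact: ltW.
  by rewrite lerDl.
have fl y y' : `|y - z| < C'^-1 -> `|y' - z| < C'^-1 ->
    `|f y' - f y| <= (C * (1 + 1) + n%:R * D) * `|y' - y|.
  move=> yz y'z; have Gy := Gb y yz; have [{}yz y1] := inv y yz.
  have [{}y'z y'1] := inv y' y'z.
  have [h1 _] := h y y' yz y'z.
  rewrite -(subrK (((y' - y) *m G y) 0 0) (f y' - f y)).
  apply: (le_trans (ler_normD _ _)); rewrite mulrDl lerD//.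
    apply: (le_trans h1); rewrite expr2 mulrA ler_wpM2r// ler_wpM2l ?(ltW C0)//.
    rewrite -(subrKA z); apply: (le_trans (ler_normD _ _)).
    by rewrite lerD// ltW// distrC.
  apply: (le_trans (coord_le_norm _ 0 0)); apply: (le_trans (mulmx_norm _ _)).
  by rewrite -!mulrA ler_wpM2l// mulrC ler_wpM2r.
move=> y y' yz y'z; split.
- apply: le_trans EC'; apply: le_trans FE.
  have -> : f y = f z + (f y - f z) by rewrite addrC subrK.
  apply: (le_trans (ler_normD _ _)); rewrite lerD2l.
  have zz' : `|z - z| < C'^-1 by rewrite subrr normr0 invr_gt0.
  apply: (le_trans (fl _ _ zz' yz)); apply: ler_piMr => //.
  by have [_ /ltW] := inv y yz.
- by apply: le_trans EC'; apply: le_trans DE; exact: Gb.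
- by apply: (le_trans (fl _ _ yz y'z)); rewrite ler_wpM2r// (le_trans KE).
Qed.

Lemma c11_cst (c : R) z : c11 (fun=> c) z.
Proof.
exists 1, (fun=> 0); split => // y y' _ _.
by rewrite mulmx0 mxE !subrr !normr0 !mul1r exprn_ge0.
Qed.

Lemma c11_near f f' z : (\forall y \near z, f y = f' y) -> c11 f z -> c11 f' z.
Proof.
move=> /near_rV[r r0 ff'] /grad_est_bounds[G [C h]].
pose D := Num.max C r^-1.
have [[D0 hD] _] : grad_est_bounded D z f G by apply: h; rewrite le_max lexx.
exists D, G; split => // y y' yz y'z.
have Dr : D^-1 <= r by rewrite invf_ple ?posrE// le_max lexx orbT.
by rewrite -!ff'; [exact: hD|exact: lt_le_trans Dr|exact: lt_le_trans Dr].
Qed.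

Lemma c11_add f f' z : c11 f z -> c11 f' z -> c11 (fun y => f y + f' y) z.
Proof.
move=> /grad_est_bounds[G [C h]] /grad_est_bounds[G' [C' h']].
pose D := Num.max C C'.
have [[D0 hD] _] : grad_est_bounded D z f G by apply: h; rewrite le_max lexx.
have [[_ hD'] _] : grad_est_bounded D z f' G'.
  by apply: h'; rewrite le_max lexx orbT.
exists (D + D), (fun y => G y + G' y); split; first by rewrite addr_gt0.
have le2 (y : 'rV[R]_n) : `|y - z| < (D + D)^-1 -> `|y - z| < D^-1.
  by move=> /lt_le_trans; apply; rewrite lef_pV2 ?posrE ?addr_gt0// lerDl ltW.
move=> y y' /le2 yz /le2 y'z.
have [h1 h2] := hD _ _ yz y'z; have [h3 h4] := hD' _ _ yz y'z; split.
  have -> : ((y' - y) *m (G y + G' y)) 0 0 =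
    ((y' - y) *m G y) 0 0 + ((y' - y) *m G' y) 0 0 by rewrite mulmxDr mxE.
  set a := (_ *m G y) 0 0 in h1 *; set b := (_ *m G' y) 0 0 in h3 *.
  rewrite (_ : _ - _ = (f y' - f y - a) + (f' y' - f' y - b)); last by ring.
  by apply: (le_trans (ler_normD _ _)); rewrite mulrDl lerD.
rewrite opprD addrACA; apply: (le_trans (ler_normD _ _)).
by rewrite mulrDl lerD.
Qed.

Lemma c11_mul f f' z : c11 f z -> c11 f' z -> c11 (fun y => f y * f' y) z.
Proof.
move=> /grad_est_bounds[G [C h]] /grad_est_bounds[G' [C' h']].
pose D := Num.max C C'.
have [[D0 hD] bD] : grad_est_bounded D z f G by apply: h; rewrite le_max lexx.
have [[_ hD'] bD'] : grad_est_bounded D z f' G'.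
  by apply: h'; rewrite le_max lexx orbT.
pose E := D + D * D *+ 4.
have DD : 0 <= D * D by rewrite mulr_ge0 ?ltW.
have DE : D <= E by rewrite lerDl mulrn_wge0.
have E0 : 0 < E by exact: lt_le_trans DE.
have D4 : D * D *+ 4 <= E by rewrite lerDr ltW.
exists E, (fun y => f y *: G' y + f' y *: G y); split => //.
have le2 (y : 'rV[R]_n) : `|y - z| < E^-1 -> `|y - z| < D^-1.
  by move=> /lt_le_trans; apply; rewrite lef_pV2 ?posrE.
move=> y y' /le2 yz /le2 y'z.
have [h1 h2] := hD _ _ yz y'z; have [h3 h4] := hD' _ _ yz y'z.
have [b1 b2 b3] := bD _ _ yz y'z; have [b4 b5 b6] := bD' _ _ yz y'z.
have [c1 c2 c3] := bD _ _ y'z yz; have [c4 c5 c6] := bD' _ _ y'z yz.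
have vv : 0 <= `|y' - y| ^+ 2 by rewrite exprn_ge0.
split.
  have -> : ((y' - y) *m (f y *: G' y + f' y *: G y)) 0 0 =
    f y * ((y' - y) *m G' y) 0 0 + f' y * ((y' - y) *m G y) 0 0.
    by rewrite mulmxDr -!scalemxAr !mxE.
  set a := (_ *m G y) 0 0 in h1 *; set b := (_ *m G' y) 0 0 in h3 *.
  rewrite (_ : _ - _ = f y * (f' y' - f' y - b) + f' y * (f y' - f y - a)
     + (f y' - f y) * (f' y' - f' y)); last by ring.
  apply: (@le_trans _ _ (D * D *+ 4 * `|y' - y| ^+ 2)); last by rewrite ler_wpM2r.
  apply: (@le_trans _ _ (D * (D * `|y' - y| ^+ 2) + D * (D * `|y' - y| ^+ 2) +
      (D * `|y' - y|) * (D * `|y' - y|))); last first.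
    rewrite [leRHS](_ : _ = D * (D * `|y' - y| ^+ 2) + D * (D * `|y' - y| ^+ 2) +
      (D * `|y' - y|) * (D * `|y' - y|) + D * D * `|y' - y| ^+ 2); last by ring.
    by rewrite lerDl mulr_ge0.
  apply: (le_trans (ler_normD _ _)); apply: lerD; last by rewrite normrM ler_pM.
  by apply: (le_trans (ler_normD _ _)); apply: lerD; rewrite normrM ler_pM.
rewrite (_ : _ - _ = (f y' - f y) *: G' y' + f y *: (G' y' - G' y) +
  ((f' y' - f' y) *: G y' + f' y *: (G y' - G y))); last first.
  by apply/matrixP => i j; rewrite !mxE; ring.
apply: (@le_trans _ _ (D * D *+ 4 * `|y' - y|)); last by rewrite ler_wpM2r.
rewrite [leRHS](_ : _ = D * `|y' - y| * D + D * (D * `|y' - y|) +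
  (D * `|y' - y| * D + D * (D * `|y' - y|))); last by ring.
apply: (le_trans (ler_normD _ _)); apply: lerD;
  by apply: (le_trans (ler_normD _ _)); apply: lerD; rewrite normrZ ler_pM.
Qed.

Lemma c11_sum (I : Type) (r : seq I) (f : I -> 'rV[R]_n -> R) z :
  (forall i, c11 (f i) z) -> c11 (fun y => \sum_(i <- r) f i y) z.
Proof.
move=> h; elim: r => [|i r IH].
  by apply: c11_near (c11_cst 0 z); near=> y; rewrite big_nil.
apply: c11_near (c11_add (h i) IH); near=> y; by rewrite big_cons.
Unshelve. all: by end_near. Qed.

Lemma c11_coord (j : 'I_n) z : c11 (fun y => y 0 j) z.
Proof.
exists 1, (fun=> delta_mx j 0); split => // y y' _ _.
by rewrite -colE !mxE !subrr !normr0 !mul1r exprn_ge0.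
Qed.

(** Serves to regard a function of the base coordinates as a function of base and fibre coordinates,
    through a projection. *)
Lemma c11_comp_linear p (A : 'M[R]_(n, p)) (f : 'rV[R]_p -> R) z :
  c11 f (z *m A) -> c11 (fun y => f (y *m A)) z.
Proof.
move=> [C [G [C0 h]]].
pose K := (n%:R + p%:R) * `|A| + 1.
have K1 : 1 <= K by rewrite lerDr mulr_ge0// addr_ge0.
have K0 : 0 < K by exact: lt_le_trans K1.
have AK (v : 'rV[R]_n) : `|v *m A| <= K * `|v|.
  apply: (le_trans (mulmx_norm _ _)); rewrite mulrAC ler_wpM2r//.
  by rewrite /K mulrDl -addrA lerDl addr_ge0// mulr_ge0.
have AG (g : 'cV[R]_p) : `|A *m g| <= K * `|g|.
  apply: (le_trans (mulmx_norm _ _)); rewrite ler_wpM2r//.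
  by rewrite /K mulrDl addrAC lerDr addr_ge0// mulr_ge0.
have KK : 1 <= K ^+ 2 by rewrite expr_ge1// ltW.
have C'0 : 0 < C * K ^+ 2 by rewrite mulr_gt0// exprn_gt0.
exists (C * K ^+ 2), (fun y => A *m G (y *m A)); split => //.
have inb (y : 'rV[R]_n) : `|y - z| < (C * K ^+ 2)^-1 ->
    `|y *m A - z *m A| < C^-1.
  move=> yz; rewrite -mulmxBl; apply: (le_lt_trans (AK _)).
  rewrite mulrC -ltr_pdivlMr//; apply: (lt_le_trans yz).
  rewrite invfM ler_pM2l ?invr_gt0// lef_pV2 ?posrE ?exprn_gt0//.
  by rewrite expr2 ler_peMl// ltW.
move=> y y' /inb yz /inb y'z; have [h1 h2] := h _ _ yz y'z; split.
  rewrite mulmxA mulmxBl; apply: (le_trans h1).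
  rewrite -mulrA ler_wpM2l ?(ltW C0)// -exprMn lerXn2r ?nnegrE//.
    by rewrite mulr_ge0// ltW.
  by rewrite -mulmxBl.
rewrite -mulmxBr; apply: (le_trans (AG _)).
rewrite expr2 mulrCA -!mulrA ler_wpM2l ?(ltW K0)//; apply: (le_trans h2).
by rewrite ler_wpM2l ?(ltW C0)// -mulmxBl.
Qed.

End C11Closure.

(** * Jacobians acting on row vectors *)

Definition has_jac (R : realType) n p (f : 'rV[R]_n -> 'rV[R]_p) y J :=
  exists C : R, 0 < C /\ forall y', `|y' - y| < C^-1 ->
    `|f y' - f y - (y' - y) *m J| <= C * `|y' - y| ^+ 2.

Section Jacobian.
Context (R : realType).
Implicit Types n p : nat.

Lemma has_jac_le n p (f : 'rV[R]_n -> 'rV[R]_p) y J : has_jac f y J ->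
  exists C : R, forall D, C <= D -> 0 < D /\ forall y', `|y' - y| < D^-1 ->
    `|f y' - f y - (y' - y) *m J| <= D * `|y' - y| ^+ 2.
Proof.
move=> [C [C0 h]]; exists C => D CD; have D0 := lt_le_trans C0 CD.
split => // y' yy'; apply: (le_trans (h y' _)).
  by apply: (lt_le_trans yy'); rewrite lef_pV2 ?posrE.
by rewrite ler_wpM2r// exprn_ge0.
Qed.

Lemma has_jac_lipschitz n p (f : 'rV[R]_n -> 'rV[R]_p) y J : has_jac f y J ->
  exists C : R, 0 < C /\ forall y', `|y' - y| < C^-1 ->
    `|f y' - f y| <= C * `|y' - y|.
Proof.
move=> [C [C0 h]]; pose D := C + 1 + n%:R * `|J|.
have nJ0 : 0 <= n%:R * `|J| by rewrite mulr_ge0.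
have CD : C <= D by rewrite /D -addrA lerDl addr_ge0.
have D1 : 1 <= D by rewrite /D addrAC lerDr addr_ge0// ltW.
have D0 : 0 < D by exact: lt_le_trans D1.
exists D; split => // y' yy'.
have y1 : `|y' - y| <= 1.
  by apply: ltW; apply: (lt_le_trans yy'); rewrite invf_le1.
have yC : `|y' - y| < C^-1.
  by apply: (lt_le_trans yy'); rewrite lef_pV2 ?posrE.
rewrite -(subrK ((y' - y) *m J) (f y' - f y)); apply: (le_trans (ler_normD _ _)).
rewrite mulrDl lerD//.
  apply: (le_trans (h _ yC)); rewrite expr2 mulrA ler_wpM2r//.
  apply: (@le_trans _ _ C); last by rewrite lerDl.
  by apply: ler_piMr => //; exact: ltW.
by apply: (le_trans (mulmx_norm _ _)); rewrite mulrAC.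
Qed.

(** Compare both expansions at [y + t *: v] for t = 1 / (2 C (k + 1)): the linear parts differ by a
    multiple of t which is O(t^2), and k is arbitrary. *)
Lemma has_jac_unique n p (f : 'rV[R]_n -> 'rV[R]_p) y J1 J2 :
  has_jac f y J1 -> has_jac f y J2 -> J1 = J2.
Proof.
move=> /has_jac_le[C1 h1] /has_jac_le[C2 h2].
pose C := Num.max C1 C2.
have [C0 {}h1] : 0 < C /\ _ := h1 C ltac:(by rewrite le_max lexx).
have [_ {}h2] : 0 < C /\ _ := h2 C ltac:(by rewrite le_max lexx orbT).
apply/eqP; rewrite -subr_eq0; apply/eqP.
suff H (v : 'rV[R]_n) : `|v| <= 1 -> v *m (J1 - J2) = 0.
  apply/row_matrixP => i; rewrite row0 rowE; apply: H.
  apply: norm_le_coord => // a b; rewrite mxE.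
  by case: (_ && _); rewrite ?normr1 ?normr0.
move=> v1; apply/eqP; rewrite -normr_le0.
apply: (@le_of_inv_nat _ _ _ (C *+ 2 * (C^-1 / 2))) => k; rewrite add0r.
pose t := C^-1 / 2 / k.+1%:R; have k0 : 0 < (k.+1%:R : R) by rewrite ltr0n.
have t0 : 0 < t by rewrite !divr_gt0 ?invr_gt0.
have tC : t < C^-1.
  rewrite /t ltr_pdivrMr// ltr_pdivrMr// -mulrA ltr_pMr ?invr_gt0//.
  by rewrite -natrM ltr1n muln2.
have tv : `|y + t *: v - y| <= t.
  by rewrite addrC addKr normrZ gtr0_norm// ler_piMr// ltW.
have e1 := h1 _ (le_lt_trans tv tC); have e2 := h2 _ (le_lt_trans tv tC).
have sq : `|y + t *: v - y| ^+ 2 <= t ^+ 2.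
  by rewrite lerXn2r ?nnegrE// ltW.
have E : t * `|v *m (J1 - J2)| <= C *+ 2 * t ^+ 2.
  rewrite -[t in leLHS]gtr0_norm// -normrZ.
  have -> : t *: (v *m (J1 - J2)) =
      (f (y + t *: v) - f y - (y + t *: v - y) *m J2) -
      (f (y + t *: v) - f y - (y + t *: v - y) *m J1).
    have aux (G : zmodType) (F a b : G) : (F - b) - (F - a) = a - b.
      by rewrite opprB addrC addrA subrK.
    by rewrite aux addrAC subrr add0r -!scalemxAl mulmxBr scalerBr.
  apply: (le_trans (ler_normB _ _)); rewrite mulr2n mulrDl lerD//.
    by apply: (le_trans e2); rewrite ler_wpM2l// ltW.
  by apply: (le_trans e1); rewrite ler_wpM2l// ltW.
have {}E : `|v *m (J1 - J2)| <= C *+ 2 * t.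
  by rewrite -(ler_pM2l t0); apply: (le_trans E); rewrite expr2 mulrCA.
by apply: (le_trans E); rewrite /t !mulrA.
Qed.

Lemma has_jac_comp n p q (f : 'rV[R]_n -> 'rV[R]_p) (g : 'rV[R]_p -> 'rV[R]_q)
    y J J' : has_jac f y J -> has_jac g (f y) J' ->
  has_jac (fun x => g (f x)) y (J *m J').
Proof.
move=> hf; have [K [K0 fK]] := has_jac_lipschitz hf.
move: hf => [C [C0 hf]] [C' [C'0 hg]].
have pJ : 0 <= p%:R * `|J'| by rewrite mulr_ge0.
pose D := C + K + C' * K + (p%:R * `|J'| * C + C' * K ^+ 2).
have p1 : 0 <= C' * K by rewrite mulr_ge0// ltW.
have p2 : 0 <= p%:R * `|J'| * C by rewrite mulr_ge0// ltW.
have p3 : 0 <= C' * K ^+ 2 by rewrite mulr_ge0 ?exprn_ge0// ltW.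
have CD : C <= D by rewrite /D; lra.
have KD : K <= D by rewrite /D; lra.
have D2 : p%:R * `|J'| * C + C' * K ^+ 2 <= D by rewrite /D; lra.
have D3 : C' * K <= D by rewrite /D; lra.
have D0 : 0 < D by exact: lt_le_trans CD.
exists D; split => // x xy.
have xC : `|x - y| < C^-1 by apply: (lt_le_trans xy); rewrite lef_pV2 ?posrE.
have xK : `|x - y| < K^-1 by apply: (lt_le_trans xy); rewrite lef_pV2 ?posrE.
have fx := fK _ xK.
have fC' : `|f x - f y| < C'^-1.
  apply: (le_lt_trans fx); rewrite mulrC -ltr_pdivlMr//.
  apply: (lt_le_trans xy); rewrite -invfM lef_pV2 ?posrE ?mulr_gt0//.
have h1 := hf _ xC; have h2 := hg _ fC'.
have -> : g (f x) - g (f y) - (x - y) *m (J *m J') =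
   (g (f x) - g (f y) - (f x - f y) *m J') +
   (f x - f y - (x - y) *m J) *m J'.
  by rewrite [(f x - f y - _) *m J']mulmxBl mulmxA addrA subrK.
apply: (le_trans (ler_normD _ _)); rewrite addrC.
apply: (@le_trans _ _ ((p%:R * `|J'| * C + C' * K ^+ 2) * `|x - y| ^+ 2));
  last by rewrite ler_wpM2r// exprn_ge0.
rewrite mulrDl lerD//.
  by apply: (le_trans (mulmx_norm _ _)); rewrite mulrAC -!mulrA !ler_wpM2l.
apply: (le_trans h2); rewrite -mulrA ler_wpM2l ?(ltW C'0)// -exprMn.
by rewrite lerXn2r ?nnegrE// mulr_ge0// ltW.
Qed.

Lemma has_jac_near n p (f g : 'rV[R]_n -> 'rV[R]_p) y J :
  (\forall x \near y, f x = g x) -> has_jac f y J -> has_jac g y J.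
Proof.
move=> fg; have fgy := nbhs_singleton fg.
move: fg => /near_rV[r r0 fg] /has_jac_le[C h].
have [D0 hD] := h (Num.max C r^-1) ltac:(by rewrite le_max lexx).
exists (Num.max C r^-1); split => // x xy.
rewrite -fg -?fgy; first exact: hD.
by apply: (lt_le_trans xy); rewrite invf_ple ?posrE// le_max lexx orbT.
Qed.

Lemma has_jac_linear n p (A : 'M[R]_(n, p)) y : has_jac (fun x => x *m A) y A.
Proof.
exists 1; split => // x _.
by rewrite mulmxBl subrr normr0 mul1r exprn_ge0.
Qed.

(** A total function, with value 0 where no expansion exists: fields can then be defined everywhere
    and the cocycle identities are equations between matrices. *)
Definition jac n p (f : 'rV[R]_n -> 'rV[R]_p) y : 'M[R]_(n, p) :=
  xget 0 [set J | has_jac f y J].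

Lemma has_jacE n p (f : 'rV[R]_n -> 'rV[R]_p) y J : has_jac f y J -> jac f y = J.
Proof.
move=> h; apply: (has_jac_unique _ h); rewrite /jac.
exact: (@xgetPex _ 0 [set J | has_jac f y J] (ex_intro _ J h)).
Qed.

Definition c11v n p (f : 'rV[R]_n -> 'rV[R]_p) z := forall j, c11 (fun y => f y 0 j) z.

(** Collects with one constant what is needed around z: the Jacobian exists at every nearby point,
    is bounded and Lipschitz, and the expansion is uniform in its base point. *)
Lemma c11v_est n p (f : 'rV[R]_n -> 'rV[R]_p) z : c11v f z ->
  exists C : R, 0 < C /\ forall y, `|y - z| < C^-1 ->
   [/\ has_jac f y (jac f y), `|jac f y| <= C & forall y', `|y' - z| < C^-1 ->
    [/\ `|f y' - f y - (y' - y) *m jac f y| <= C * `|y' - y| ^+ 2,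
        `|jac f y' - jac f y| <= C * `|y' - y| &
        `|f y' - f y| <= C * `|y' - y|]].
Proof.
move=> h; have /choice[c hc] : forall j, exists CG : R * ('rV[R]_n -> 'cV[R]_n),
    grad_est CG.1 z (fun y => f y 0 j) CG.2.
  by move=> j; have [C [G CG]] := h j; exists (C, G).
pose J y : 'M[R]_(n, p) := \matrix_(i, j) (c j).2 y i 0.
pose C := \sum_j (c j).1 + 1.
have c0 j : 0 < (c j).1 by have [] := hc j.
have C1 : 1 <= C by rewrite lerDr sumr_ge0// => j _; exact: ltW.
have C0 : 0 < C by exact: lt_le_trans C1.
have cC j : (c j).1 <= C.
  rewrite /C (bigD1 j)//= -addrA lerDl addr_ge0// sumr_ge0// => k _; exact: ltW.
have inC y j : `|y - z| < C^-1 -> `|y - z| < (c j).1^-1.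
  by move=> /lt_le_trans; apply; rewrite lef_pV2 ?posrE.
have JE y j (v : 'rV[R]_n) : (v *m J y) 0 j = (v *m (c j).2 y) 0 0.
  by rewrite !mxE; apply: eq_bigr => i _; rewrite mxE.
have e1 y y' : `|y - z| < C^-1 -> `|y' - z| < C^-1 ->
    `|f y' - f y - (y' - y) *m J y| <= C * `|y' - y| ^+ 2 /\
    `|J y' - J y| <= C * `|y' - y|.
  move=> yz y'z; split.
    apply: norm_le_coord => [|i j]; first by rewrite mulr_ge0 ?exprn_ge0// ltW.
    have sub3 (a b e : 'rV[R]_p) : (a - b - e) 0 j = a 0 j - b 0 j - e 0 j.
      by rewrite !mxE.
    rewrite ord1 sub3 JE.
    have [_ /(_ _ _ (inC _ j yz) (inC _ j y'z))[h1 _]] := hc j.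
    by apply: (le_trans h1); rewrite ler_wpM2r// exprn_ge0.
  apply: norm_le_coord => [|i j]; first by rewrite mulr_ge0// ltW.
  rewrite !mxE.
  have [_ /(_ _ _ (inC _ j yz) (inC _ j y'z))[_ h2]] := hc j.
  have := coord_le_norm ((c j).2 y' - (c j).2 y) i 0; rewrite !mxE => /le_trans.
  by apply; apply: (le_trans h2); rewrite ler_wpM2r.
have jJ y : `|y - z| < C^-1 -> has_jac f y (J y).
  (* The added term keeps y' in the ball of radius [C^-1] around z, where the estimates hold. *)
  move=> yz; pose D := C + (C^-1 - `|y - z|)^-1.
  have d0 : 0 < C^-1 - `|y - z| by rewrite subr_gt0.
  have D0 : 0 < D by rewrite addr_gt0 ?invr_gt0.
  exists D; split => // y' yy'.
  have y'z : `|y' - z| < C^-1.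
    rewrite -(subrKA y); apply: (le_lt_trans (ler_normD _ _)).
    rewrite -ltrBrDr; apply: (lt_le_trans yy').
    by rewrite invf_ple ?posrE// lerDr ltW.
  have [h1 _] := e1 _ _ yz y'z; apply: (le_trans h1).
  by rewrite ler_wpM2r ?exprn_ge0// lerDl invr_ge0 ltW.
pose D := C + (C + `|J z|) + (C *+ 2 + n%:R * (C + `|J z|)).
have b1 : 0 <= C + `|J z| by rewrite addr_ge0// ltW.
have b2 : 0 <= C *+ 2 + n%:R * (C + `|J z|).
  by rewrite addr_ge0 ?mulr_ge0 ?mulrn_wge0// ltW.
have CD : C <= D by rewrite /D -addrA lerDl addr_ge0.
have D0 : 0 < D by exact: lt_le_trans CD.
have D2 : C + `|J z| <= D.
  by move: b2; rewrite /D; set X := _ *+ 2 + _; move=> X0; lra.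
have D3 : C *+ 2 + n%:R * (C + `|J z|) <= D.
  by rewrite /D; set X := _ *+ 2 + _; move: b1; lra.
have inD y : `|y - z| < D^-1 -> `|y - z| < C^-1.
  by move=> /lt_le_trans; apply; rewrite lef_pV2 ?posrE.
have zz : `|z - z| < C^-1 by rewrite subrr normr0 invr_gt0.
have d1 y : `|y - z| < C^-1 -> `|y - z| <= 1.
  by move=> /ltW /le_trans; apply; rewrite invf_le1.
exists D; split => // y yz; have {}yz := inD _ yz.
rewrite (has_jacE (jJ _ yz)); split; first exact: jJ.
- apply: le_trans D2; rewrite -(subrK (J z) (J y)).
  apply: (le_trans (ler_normD _ _)); rewrite lerD2r.
  have [_ h2] := e1 _ _ zz yz; apply: (le_trans h2).
  by apply: ler_piMr; [exact: ltW|exact: d1].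
- move=> y' /inD y'z; rewrite (has_jacE (jJ _ y'z)).
  have [h1 h2] := e1 _ _ yz y'z; split.
  + by apply: (le_trans h1); rewrite ler_wpM2r// exprn_ge0.
  + by apply: (le_trans h2); rewrite ler_wpM2r.
  rewrite -(subrK ((y' - y) *m J y) (f y' - f y)).
  apply: (le_trans (ler_normD _ _)).
  apply: (@le_trans _ _ ((C *+ 2 + n%:R * (C + `|J z|)) * `|y' - y|));
    last by rewrite ler_wpM2r.
  rewrite mulrDl lerD//.
    apply: (le_trans h1); rewrite expr2 mulrA ler_wpM2r//.
    rewrite -[leRHS]mulr_natr ler_wpM2l ?(ltW C0)//.
    rewrite -(subrKA z); apply: (le_trans (ler_normD _ _)).
    by rewrite lerD ?d1// distrC d1.
  apply: (le_trans (mulmx_norm _ _)); rewrite mulrAC ler_wpM2r// ler_wpM2l//.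
  rewrite -(subrK (J z) (J y)).
  apply: (le_trans (ler_normD _ _)); rewrite lerD2r.
  have [_ h3] := e1 _ _ zz yz; apply: (le_trans h3).
  by apply: ler_piMr; [exact: ltW|exact: d1].
Qed.

Lemma c11v_jac n p (f : 'rV[R]_n -> 'rV[R]_p) z : c11v f z ->
  has_jac f z (jac f z).
Proof.
by move=> /c11v_est[C [C0 h]]; have [] := h z; rewrite ?subrr ?normr0 ?invr_gt0.
Qed.

End Jacobian.

(** * Transverse directions *)

Section ConeSeparation.
Context (R : realType) (W : vectType R).
Implicit Types (C : set W) (L : {vspace W}).

Definition open_convex_cone C :=
  [/\ forall x y, C x -> C y -> C (x + y),
      forall (c : R) x, 0 < c -> C x -> C (c *: x) &
      forall x v, C x -> exists2 e : R, 0 < e & forall t, `|t| < e -> C (x + t *: v)].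

(** L is a maximal subspace missing C. The cone [K], which is C enlarged by L, is disjoint from its
    opposite, and by maximality every vector outside L lies in one of the two. For e outside [L +
    <[p]>] the line [p + s *: e] never meets L, so by connectedness it stays in K; letting s be
    large excludes [- e] from K, and the same argument for [- e] excludes e. *)
Lemma cone_hyperplane C L p : open_convex_cone C -> C p ->
  (forall x, C x -> x \notin L) ->
  (forall e, e \notin L -> exists2 x, C x & x \in (L + <[e]>)%VS) ->
  (L + <[p]> = fullv)%VS.
Proof.
move=> [CD CZ CO] Cp CL maxL.
pose K x := exists2 l, l \in L & C (x + l).
have K0 x : K x -> K (- x) -> False.
  move=> [l lL Cl] [l' l'L Cl']; have := CL _ (CD _ _ Cl Cl').
  by rewrite addrACA subrr add0r rpredD.
have Kcov x : x \notin L -> K x \/ K (- x).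
  move=> /maxL[y Cy /memv_addP[l lL [v /vlineP[k ->] yE]]].
  have [k0|k0|k0] := ltgtP k 0.
  - right; exists ((- k)^-1 *: l); first exact: memvZ.
    have -> : - x + (- k)^-1 *: l = (- k)^-1 *: y.
      by rewrite yE scalerDr scalerA invrN mulNr mulVf ?scaleN1r 1?addrC// lt_eqF.
    by apply: CZ => //; rewrite invr_gt0 oppr_gt0.
  - left; exists (k^-1 *: l); first exact: memvZ.
    have -> : x + k^-1 *: l = k^-1 *: y.
      by rewrite yE scalerDr scalerA mulVf ?scale1r 1?addrC// gt_eqF.
    by apply: CZ => //; rewrite invr_gt0.
  - by have := CL _ Cy; rewrite yE k0 scale0r addr0 lL.
have KO x v : K x -> exists2 e : R, 0 < e & forall t, `|t| < e -> K (x + t *: v).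
  move=> [l lL Cl]; have [e e0 he] := CO _ v Cl; exists e => // t te.
  by exists l => //; rewrite addrAC; exact: he.
have KZ c x : 0 < c -> K x -> K (c *: x).
  move=> c0 [l lL Cl]; exists (c *: l); first exact: memvZ.
  by rewrite -scalerDr; exact: CZ.
have Kp : K p by exists 0; rewrite ?mem0v ?addr0.
have pL := CL _ Cp.
apply/eqP; rewrite eqEsubv subvf; apply/subvP => f _; apply: contrapT => /negP fLp.
have fn e : e \notin (L + <[p]>)%VS -> ~ K (- e).
  move=> eLp Ke; have nL (s : R) : p + s *: e \notin L.
    apply/negP => peL; have [s0|s0] := eqVneq s 0.
      by move: pL; rewrite -[p]addr0 -(scale0r e) -s0 peL.
    move/negP: eLp; apply; apply/memv_addP.
    exists (s^-1 *: (p + s *: e)); first exact: memvZ.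
    exists (- s^-1 *: p); first by apply/vlineP; exists (- s^-1).
    by rewrite scalerDr scalerA mulVf// scale1r scaleNr addrAC subrr add0r.
  pose A := [set s : R | K (p + s *: e)].
  have AT : A = setT; last first.
    have [r r0 hr] := KO _ (- p) Ke.
    pose s := (r / 2)^-1; have s0 : 0 < s by rewrite invr_gt0 divr_gt0.
    have : A s by rewrite AT.
    rewrite /A /= => Ks; apply: (K0 _ Ks).
    have -> : - (p + s *: e) = s *: (- e + (r / 2) *: (- p)).
      rewrite scalerDr scalerA mulVf ?scale1r ?gt_eqF ?divr_gt0//.
      by rewrite scalerN opprD addrC.
    apply: KZ => //; apply: hr; rewrite gtr0_norm ?divr_gt0//.
    by rewrite ltr_pdivrMr// ltr_pMr// ltr1n.
  have cT : connected (setT : set R) by exact/connected_intervalP.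
  apply: cT; first by exists 0; rewrite /A /= scale0r addr0.
    exists A; last by rewrite setTI.
    rewrite openE => s As; apply/near_R; have [r r0 hr] := KO _ e As.
    exists r => // t tr; have := hr _ tr.
    by rewrite -addrA -scalerDl [s + _]addrC subrK.
  exists A; last by rewrite setTI.
  rewrite -[A]setCK; apply: open_closedC; rewrite openE => s As.
  have Ks : K (- (p + s *: e)) by have [] := Kcov _ (nL s).
  apply/near_R; have [r r0 hr] := KO _ (- e) Ks.
  exists r => // t tr At; apply: (K0 _ At); have := hr _ tr.
  suff -> : - (p + s *: e) + (t - s) *: - e = - (p + t *: e) by [].
  rewrite scalerN -opprD -addrA -scalerDl; congr (- (p + _ *: _)).
  by rewrite addrC subrK.
have fLp' : - f \notin (L + <[p]>)%VS by rewrite memvN.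
have /Kcov[Kf|Kf] : f \notin L.
- by apply: contra fLp => fL; rewrite (subvP (addvSl _ _)).
- by apply: (fn _ fLp'); rewrite opprK.
- exact: (fn _ fLp).
Qed.

(** A finite-dimensional Hahn-Banach theorem. Enlarge L by one vector at a time while it misses C;
    when this stops, any p in C spans a complement of L, and the coordinate along p is the
    functional. If it were nonpositive at x in C, adding a multiple of p to x would give a point of
    C in L. *)
Lemma cone_separation C L : open_convex_cone C ->
  (forall x, C x -> x \notin L) ->
  exists l : 'Hom(W, R^o), (forall x, x \in L -> l x = 0) /\
    forall x, C x -> (0 : R) < l x.
Proof.
move=> CC; have [n] := ubnP (\dim {:W} - \dim L); elim: n L => // n IH L.
rewrite ltnS => dL CL.
have [[e eL he]|maxL] := pselect (exists2 e, e \notin L &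
    forall x, C x -> x \notin (L + <[e]>)%VS).
  have dLe : (\dim L < \dim (L + <[e]>))%N.
    rewrite ltnNge; apply: contra eL => h.
    have /eqP -> : (L == L + <[e]>)%VS by rewrite eqEdim addvSl.
    by rewrite (subvP (addvSr _ _))// memv_line.
  have dn : (\dim {:W} - \dim (L + <[e]>) < n)%N.
    by apply: leq_trans dL; rewrite ltn_sub2l// (leq_trans dLe)// dimvS// subvf.
  have [l [lL lC]] := IH _ dn he.
  by exists l; split => // x xL; apply: lL; rewrite (subvP (addvSl _ _)).
(* For an empty cone the zero functional does. *)
have [[p Cp]|C0] := pselect (exists p, C p); last first.
  exists 0; split => [x _|x Cx]; first by rewrite zero_lfunE.
  by case: C0; exists x.
have full : (L + <[p]> = fullv)%VS.
  apply: (cone_hyperplane CC Cp CL) => e eL; apply: contrapT => h; apply: maxL.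
  by exists e => // x Cx; apply/negP => xL; apply: h; exists x.
have pL := CL _ Cp.
have cap : (<[p]> :&: L = 0)%VS.
  apply/eqP; rewrite -subv0; apply/subvP => x /memv_capP[/vlineP[k ->] kL].
  have [->|k0] := eqVneq k 0; first by rewrite scale0r mem0v.
  by move: pL; rewrite -[p](scalerK k0) memvZ.
have p0 : p != 0 by apply: contraNneq pL => ->; exact: mem0v.
pose l0 (x : W) : R^o := coord [tuple p] 0 (daddv_pi <[p]> L x).
have l0l : linear l0 by move=> c x y; rewrite /l0 !linearP.
have lE := linfun_linear l0l.
have l0p k : l0 (k *: p) = k.
  rewrite /l0 daddv_pi_id// ?memvZ ?memv_line// linearZ /=.
  have := @coord_free R W 1 [tuple p] 0 0; rewrite seq1_free => /(_ p0) /= ->.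
  exact: mulr1.
have l0L x : x \in L -> l0 x = 0.
  move=> xL; rewrite /l0; have := @daddv_pi_add _ _ <[p]>%VS L x cap.
  rewrite addvC full memvf => /(_ isT); rewrite [X in _ + X]daddv_pi_id ?(capvC L)//.
  by move=> /(canRL (addrK _)); rewrite subrr => ->; rewrite linear0.
exists (linfun l0); split => [x xL|x Cx]; rewrite lE; first exact: l0L.
have : x \in (L + <[p]>)%VS by rewrite full memvf.
move=> /memv_addP[y yL [v /vlineP[k ->] xE]].
have lxk : l0 x = k.
  by rewrite xE -[y]scale1r l0l l0L// l0p scaler0 add0r.
rewrite -[X in _ < X]/(l0 x) lxk ltNge; apply/negP => k0; have [CD CZ _] := CC.
have : C (x + (- k) *: p).
  move: k0; rewrite le_eqVlt => /orP[/eqP->|k0]; first by rewrite oppr0 scale0r addr0.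
  by apply: CD => //; apply: CZ => //; rewrite oppr_gt0.
by move=> /CL; rewrite xE scaleNr addrK yL.
Qed.

(* A functional separating P + {D w q0} from the cone makes (w, q) |-> l (D w q)
   a square bilinear form with q0 in one kernel, hence with some w in the other. *)
Lemma transverse_direction (P : {vspace W}) d C (D : 'rV[R]_d -> 'End(W)) q0 :
  open_convex_cone C -> \dim P = d -> linear D -> q0 \in P -> q0 != 0 ->
  (forall w, w != 0 -> exists q p, [/\ q \in P, C p & p - D w q \in P]) ->
  exists w r, r \in P /\ C (D w q0 + r).
Proof.
move=> CC dP Dl q0P q00 fit; apply: contrapT => nex.
pose h (w : 'rV[R]_d) : W := D w q0.
have hl : linear h by move=> c x y; rewrite /h Dl add_lfunE scale_lfunE.
have hE := linfun_linear hl.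
pose L := (P + limg (linfun h))%VS.
have [x Cx|l [lL lC]] := cone_separation (L := L) CC.
  apply/negP => /memv_addP[r rP [v /memv_imgP[w _ ->] xE]]; apply: nex.
  by exists w, r; split => //; rewrite -[D w q0]/(h w) -hE addrC -xE.
have lP r : r \in P -> l r = 0.
  by move=> rP; apply: lL; rewrite (subvP (addvSl _ _)).
have lD w : l (D w q0) = 0.
  apply: lL; rewrite (subvP (addvSr _ _))//; apply/memv_imgP.
  by exists w; rewrite ?memvf// hE.
pose b (i : 'I_d) : W := (vbasis P)`_i.
pose c (i : 'I_d) : R := coord (vbasis P) (cast_ord (esym dP) i) q0.
have sumP q : q \in P -> exists a : 'I_d -> R, q = \sum_i a i *: b i.
  move=> qP; exists (fun i => coord (vbasis P) (cast_ord (esym dP) i) q).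
  rewrite [LHS](coord_vbasis qP) (reindex (cast_ord (esym dP))) //=.
  by exists (cast_ord dP) => i _; rewrite ?cast_ordK ?cast_ordKV.
have [a q0E] := sumP _ q0P.
pose B : 'M[R]_d := \matrix_(i, j) (l (D (delta_mx 0 i) (b j)) : R).
have Da (w : 'rV[R]_d) q : l (D w q) = \sum_i w 0 i * (l (D (delta_mx 0 i) q) : R).
  pose g w := D w q.
  have gl : linear g by move=> k x y; rewrite /g Dl add_lfunE scale_lfunE.
  have gE := linfun_linear gl.
  rewrite -[D w q]/(g w) -gE {1}(row_sum_delta w) linear_sum /= linear_sum.
  by apply: eq_bigr => i _; rewrite linearZ linearZ /= gE.
have B0 : (\row_j a j) *m B^T = 0.
  apply/rowP => i; rewrite !mxE; under eq_bigr do rewrite !mxE.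
  have H := lD (delta_mx 0 i); rewrite q0E !linear_sum in H.
  by rewrite -[RHS]H; apply: eq_bigr => j _; rewrite !linearZ.
have a0 : \row_j a j != 0.
  apply: contraNneq q00 => a0; rewrite q0E big1// => j _.
  have /rowP/(_ j) := a0; rewrite !mxE => ->; exact: scale0r.
(* The coordinates of q0 are killed by the transpose of B, so the determinant vanishes and B has a
   left kernel vector too; B is square because [\dim P = d]. *)
have /det0P[w w0 wB] : \det B == 0.
  by rewrite -det_tr; apply/det0P; exists (\row_j a j).
have [q [p [qP Cp pq]]] := fit w w0.
have lw : l (D w q) = 0.
  have [a' ->] := sumP _ qP; rewrite linear_sum linear_sum big1// => j _.
  rewrite linearZ linearZ /=; have /rowP/(_ j) := wB; rewrite !mxE => wBj.
  rewrite Da (_ : \sum_i _ = 0) ?scaler0// -[RHS]wBj.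
  by apply: eq_bigr => i _; rewrite mxE.
have := lC _ Cp; rewrite -(subrK (D w q) p) linearD /= lw addr0 lP// ltxx.
by [].
Qed.

End ConeSeparation.

(** * Positive forms *)

Section Coordinates.
Context (R : realType) (W : vectType R).

Definition uncoords (a : 'rV[R]_(\dim {:W})) : W :=
  passmx.vecof (vbasis {:W}) a.

Lemma coordsK : cancel (@coords R W) uncoords.
Proof. by move=> w; exact/passmx.rVofK/vbasisP. Qed.

Lemma uncoordsK : cancel uncoords (@coords R W).
Proof. by move=> w; exact/passmx.vecofK/vbasisP. Qed.

Lemma coords_linear : linear (@coords R W).
Proof. exact: passmx.rVof_linear. Qed.

Lemma uncoords_linear : linear uncoords.
Proof. exact: passmx.vecof_linear. Qed.

HB.instance Definition _ := GRing.isLinear.Build R W _ _ (@coords R W)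
  coords_linear.
HB.instance Definition _ := GRing.isLinear.Build R _ W _ uncoords
  uncoords_linear.

Lemma uncoordsE (a : 'rV[R]_(\dim {:W})) : uncoords a = \sum_i a 0 i *: (vbasis {:W})`_i.
Proof. by []. Qed.

Lemma coords_eq0 (w : W) : (coords w == 0) = (w == 0).
Proof. by rewrite -[0 in LHS](linear0 (@coords R W)) (inj_eq (can_inj coordsK)). Qed.

End Coordinates.

Lemma sphere_compact (R : realType) n : compact [set x : 'rV[R]_n | `|x| = 1].
Proof.
have cl : closed [set x : 'rV[R]_n | `|x| = 1].
  rewrite (_ : mkset _ = (fun z : 'rV[R]_n => `|z - 0|) @^-1` [set 1]).
    by apply: preimage_closed => [z _|]; [exact: dist_continuous|exact: closed_eq].
  by apply/seteqP; split => x /=; rewrite subr0.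
apply: (subclosed_compact cl (@compact_cball R n 0 1)).
by move=> x /= x1; rewrite subr0 x1.
Qed.

Section PositiveForms.
Context (R : realType) (V : vectType R).
Local Notation Q := (qform V).
Local Notation D := (\dim {:Q}).
Local Notation n := (\dim {:V}).

Lemma qevalD (p q : Q) v w : qeval (p + q) v w = qeval p v w + qeval q v w.
Proof. by have := qeval_linear 1 p q v w; rewrite scale1r mul1r. Qed.

Lemma qevalZ c (p : Q) v w : qeval (c *: p) v w = c * qeval p v w.
Proof.
have qe0 : qeval (0 : Q) v w = 0.
  by have := qeval_linear (-1) (0 : Q) 0 v w; rewrite scaler0 addr0 mulN1r addNr.
by have := qeval_linear c p 0 v w; rewrite addr0 qe0 addr0.
Qed.

Lemma qeval_sum (I : Type) (r : seq I) (F : I -> Q) v w :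
  qeval (\sum_(i <- r) F i) v w = \sum_(i <- r) qeval (F i) v w.
Proof.
apply: (big_morph (fun q => qeval q v w)) => [p q|]; first exact: qevalD.
by have := qevalZ 0 0 v w; rewrite scale0r mul0r.
Qed.

Lemma qeval_ext (p q : Q) : (forall v w, qeval p v w = qeval q v w) -> p = q.
Proof.
by move=> h; apply: val_inj; apply/lfunP => v; apply/lfunP => w; exact: h.
Qed.

Lemma qeval_suml (q : Q) (I : finType) (a : I -> R) (x : I -> V) w :
  qeval q (\sum_i a i *: x i) w = \sum_i a i * qeval q (x i) w.
Proof.
rewrite /qeval linear_sum sum_lfunE; apply: eq_bigr => i _.
by rewrite linearZ /= scale_lfunE.
Qed.

Lemma qeval_sumr (q : Q) (I : finType) (a : I -> R) (x : I -> V) v :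
  qeval q v (\sum_i a i *: x i) = \sum_i a i * qeval q v (x i).
Proof.
by rewrite /qeval linear_sum; apply: eq_bigr => i _; rewrite linearZ.
Qed.

Lemma qeval_comb (q : Q) (a : 'rV[R]_n) :
  qeval q (uncoords a) (uncoords a) =
  \sum_i \sum_j a 0 i * a 0 j * qeval q (vbasis {:V})`_i (vbasis {:V})`_j.
Proof.
rewrite {1}uncoordsE qeval_suml; apply: eq_bigr => i _.
rewrite uncoordsE qeval_sumr mulr_sumr; apply: eq_bigr => j _.
by rewrite mulrA.
Qed.

Definition eval_row (k : 'rV[R]_D) (a : 'rV[R]_n) :=
  qeval (uncoords k : Q) (uncoords a) (uncoords a).

Lemma eval_rowE k a : eval_row k a = \sum_l k 0 l * (\sum_i \sum_j a 0 i * a 0 j *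
  qeval ((vbasis {:Q})`_l) (vbasis {:V})`_i (vbasis {:V})`_j).
Proof.
rewrite /eval_row [uncoords k]uncoordsE qeval_sum; apply: eq_bigr => l _.
by rewrite qevalZ qeval_comb.
Qed.

Lemma cvg_sumR (T I : Type) (F : set_system T) (FF : Filter F) (r : seq I)
    (f : I -> T -> R) (l : I -> R) :
  (forall i, f i x @[x --> F] --> l i) ->
  (\sum_(i <- r) f i x) @[x --> F] --> \sum_(i <- r) l i.
Proof.
by move=> h; apply: (@cvg_big R^o) => //; exact: (@add_continuous R^o).
Qed.

Lemma eval_row_continuous :
  continuous (fun p : 'rV[R]_D * 'rV[R]_n => eval_row p.1 p.2).
Proof.
move=> [k a]; rewrite /continuous_at /=.
rewrite (_ : (fun p => _) = fun p : 'rV[R]_D * 'rV[R]_n =>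
  \sum_l p.1 0 l * (\sum_i \sum_j p.2 0 i * p.2 0 j *
  qeval ((vbasis {:Q})`_l) (vbasis {:V})`_i (vbasis {:V})`_j)); last first.
  by apply/funext => p; rewrite eval_rowE.
rewrite eval_rowE.
have c1 (l : 'I_D) : (p.1 : 'rV[R]_D) 0 l @[p --> (k, a)] --> k 0 l.
  apply: (@cvg_comp _ _ _ fst (fun x : 'rV[R]_D => x 0 l) _ (nbhs k)).
    exact: cvg_fst.
  exact: coord_continuous.
have c2 (l : 'I_n) : (p.2 : 'rV[R]_n) 0 l @[p --> (k, a)] --> a 0 l.
  apply: (@cvg_comp _ _ _ snd (fun x : 'rV[R]_n => x 0 l) _ (nbhs a)).
    exact: cvg_snd.
  exact: coord_continuous.
apply: cvg_sumR => l; apply: cvgM => //; apply: cvg_sumR => i.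
by apply: cvg_sumR => j; apply: cvgM; [exact: cvgM|exact: cvg_cst].
Qed.

(** By homogeneity the compact unit sphere suffices, which is what makes positivity an open
    condition. *)
Lemma positiveP (q : Q) :
  positive q <-> forall a, `|a| = 1 -> 0 < eval_row (coords q) a.
Proof.
split=> [qp a a1|h v v0].
  rewrite /eval_row coordsK; apply: qp => /(congr1 (@coords R V)).
  rewrite uncoordsK linear0 => a0; move/eqP: a1.
  by rewrite a0 normr0 eq_sym oner_eq0.
pose a := coords v; have a0 : 0 < `|a|.
  by rewrite normr_gt0 coords_eq0; apply/eqP.
have := h (`|a|^-1 *: a); rewrite normrZ normfV normr_id mulVf ?gt_eqF//.
move=> /(_ erefl); rewrite /eval_row coordsK.
have -> : uncoords (`|a|^-1 *: a) = `|a|^-1 *: v.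
  by rewrite linearZ /= coordsK.
by rewrite /qeval !linearZ /= scale_lfunE linearZ /= !pmulr_rgt0 ?invr_gt0.
Qed.

(** By joint continuity, positivity of k at a unit vector a persists for nearby forms at nearby
    vectors; compactness of the sphere then gives one neighbourhood of k for all of them. *)
Lemma positive_open : open [set k : 'rV[R]_D | positive (uncoords k : Q)].
Proof.
rewrite openE => k /= kp.
have /compact_near_coveringP h := @sphere_compact R n.
have := h _ (nbhs k) (fun k' a => 0 < eval_row k' a) _.
have H (a : 'rV[R]_n) : `|a| = 1 ->
    \forall a' \near a & k' \near k, 0 < eval_row k' a'.
  move=> a1; have p0 : 0 < eval_row k a.
    by rewrite -[k]uncoordsK; move/positiveP : kp; apply.
  have /cvgrPdist_lt cc := @eval_row_continuous (k, a).
  have [[U W] [/= Uk Wa] UW] := cc _ p0.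
  exists (W, U) => //= -[a' k'] /= [Wa' Uk'].
  have /= := UW (k', a') (conj Uk' Wa').
  by rewrite ltr_distlC subrr => /andP[].
move=> /(_ _ H) kk; apply: filterS kk => k' h'.
by apply/positiveP => a a1; rewrite uncoordsK; exact: h'.
Qed.

Lemma positiveD (p q : Q) : positive p -> positive q -> positive (p + q).
Proof. by move=> pp pq v v0; rewrite qevalD addr_gt0// ?pp ?pq. Qed.

Lemma positiveZ c (p : Q) : 0 < c -> positive p -> positive (c *: p).
Proof. by move=> c0 pp v v0; rewrite qevalZ mulr_gt0// pp. Qed.

Lemma positive_cone : open_convex_cone (fun q : Q => positive q).
Proof.
split; [exact: positiveD|by move=> c x; exact: positiveZ|move=> q v qp].
have : nbhs (coords q) [set k : 'rV[R]_D | positive (uncoords k : Q)].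
  by apply: open_nbhs_nbhs; split; [exact: positive_open|rewrite /= coordsK].
move=> /near_rV[r r0 hr]; exists (r / (`|coords v| + 1)).
  by rewrite divr_gt0// ltr_wpDl.
move=> t tr; have := hr (coords (q + t *: v)); rewrite /= coordsK; apply.
rewrite linearD linearZ /= addrC addKr normrZ.
apply: (@le_lt_trans _ _ (`|t| * (`|coords v| + 1))).
  by rewrite ler_wpM2l// lerDl.
by rewrite -ltr_pdivlMr// ltr_wpDl.
Qed.

End PositiveForms.

Lemma nbhs_initial (S : choiceType) (T : topologicalType) (f : S -> T)
    (s : initial_topology f) (A : set S) :
  nbhs s A <-> exists2 B, nbhs (f s) B & f @^-1` B `<=` A.
Proof.
split.
  move=> sA; have [ O oO OA] := @open_interior (initial_topology f) A.
  exists O; last by rewrite OA; exact: (@interior_subset (initial_topology f) A).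
  have Os : (f @^-1` O) s by rewrite OA.
  exact: (open_nbhs_nbhs (conj oO Os)).
move=> [B]; rewrite nbhsE => -[ O [oO Os] OB] BA.
rewrite nbhsE; exists (f @^-1` O); last by move=> x Ox; apply: BA; exact: OB.
by split => //; exists O.
Qed.

Lemma linear_mulmx (R : realType) n p (f : 'rV[R]_n -> 'rV[R]_p) : linear f ->
  exists A : 'M[R]_(n, p), forall x, f x = x *m A.
Proof.
move=> fl; pose g : {linear 'rV[R]_n -> 'rV[R]_p} :=
  HB.pack f (GRing.isLinear.Build _ _ _ _ f fl).
by exists (lin1_mx g) => x; rewrite mul_rV_lin1.
Qed.

Lemma c11v_continuous (R : realType) n p (f : 'rV[R]_n -> 'rV[R]_p) z :
  c11v f z -> {for z, continuous f}.
Proof.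
move=> /c11v_est[C [C0 h]]; apply/continuous_rV => e e0.
have zz : `|z - z| < C^-1 by rewrite subrr normr0 invr_gt0.
have [_ _ {}h] := h z zz.
apply/near_rV; exists (Num.min C^-1 (e / C)).
  by rewrite lt_min invr_gt0 C0 divr_gt0.
move=> y; rewrite lt_min => /andP[y1 y2]; have [_ _ l] := h y y1.
by apply: (le_lt_trans l); rewrite mulrC -ltr_pdivlMr.
Qed.

(** Smoothness of transition maps is stated through [coords], that is in the basis [vbasis] of row
    vectors, which need not be the canonical one. *)
Lemma coords_entry (R : realType) n (v : 'rV[R]_n) i :
  v 0 i = \sum_k coords v 0 k * ((vbasis {: 'rV[R]_n})`_k) 0 i.
Proof.
rewrite -{1}[v]coordsK uncoordsE summxE; apply: eq_bigr => k _.
by rewrite !mxE.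
Qed.

Lemma lsubmx_mulmx (R : realType) m n : exists A : 'M[R]_(m + n, m),
  forall y : 'rV[R]_(m + n), lsubmx y = y *m A.
Proof. by apply: linear_mulmx => c x y; rewrite linearP. Qed.

Lemma lsubmx_continuous (R : realType) m n :
  continuous (@lsubmx R 1 m n).
Proof.
move=> y; apply/continuous_rV => r r0; apply/near_rV; exists r => // z zy.
rewrite -linearB; apply: le_lt_trans zy; apply: norm_le_coord => // i j.
by rewrite mxE coord_le_norm.
Qed.

Lemma rsubmx_continuous (R : realType) m n :
  continuous (@rsubmx R 1 m n).
Proof.
move=> y; apply/continuous_rV => r r0; apply/near_rV; exists r => // z zy.
rewrite -linearB; apply: le_lt_trans zy; apply: norm_le_coord => // i j.
by rewrite mxE coord_le_norm.
Qed.
Lemma positive_sum (R : realType) (V : vectType R) (I : eqType) (s : seq I)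
    (w : I -> R) (q : I -> qform V) : (forall i, i \in s -> 0 <= w i) ->
  (forall i, i \in s -> 0 < w i -> positive (q i)) ->
  (exists2 i, i \in s & 0 < w i) -> positive (\sum_(i <- s) w i *: q i).
Proof.
move=> w0 wq [i is0 wi] v v0; rewrite qeval_sum.
have ge0 j : j \in s -> 0 <= qeval (w j *: q j) v v.
  move=> js; rewrite qevalZ; have := w0 j js; rewrite le_eqVlt => /predU1P[<-|wj].
    by rewrite mul0r.
  by rewrite ltW// mulr_gt0// wq.
rewrite (big_rem i)//= ltr_wpDr//; last by rewrite qevalZ mulr_gt0// wq.
by rewrite big_seq sumr_ge0// => j /mem_rem; exact: ge0.
Qed.

(** * Invariant locally finite covers *)

(** The near-covering form of compactness, applied to the filter of finite sequences of points of A
    ordered by inclusion. *)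
Lemma compact_finite_cover (T : topologicalType) (A : set T) (f : T -> set T) :
  compact A -> (forall x, A x -> nbhs x (f x)) ->
  exists s : seq T, (forall y, y \in s -> A y) /\
    forall x, A x -> exists2 y, y \in s & f y x.
Proof.
move=> /compact_near_coveringP cA fn.
pose D (s : seq T) := forall y, y \in s -> A y.
pose F := filter_from [set s | D s] (fun s : seq T =>
  [set s' : seq T | {subset s <= s'} /\ D s']).
have FF : Filter F.
  apply: filter_from_filter; first by exists [::].
  move=> s t sA tA; exists (s ++ t).
    by move=> y; rewrite mem_cat => /orP[/sA|/tA].
  move=> w [sub wA]; split; split => // y yy; apply: sub.
    by rewrite mem_cat yy.
  by rewrite mem_cat yy orbT.
have [x Ax|s sA h] := cA _ F (fun (s : seq T) x => exists2 y, y \in s & f y x) FF.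
  exists (f x, [set s : seq T | x \in s]).
    split => /=; first exact: fn.
    exists [:: x]; first by move=> y; rewrite inE => /eqP ->.
    by move=> w [sub _]; apply: sub; rewrite inE.
  by move=> [y s] /= [fy xs]; exists x.
by exists s; split => // x Ax; exact: (h s (conj (fun y ys => ys) sA) x Ax).
Qed.

Section InvariantCover.
Context (M : topologicalType) (G : groupType) (act : G -> M -> M).
Hypothesis haus : hausdorff_space M.
Hypothesis sc : @second_countable M.
Hypothesis act1 : forall x, act 1%g x = x.
Hypothesis actM : forall g h x, act (g * h)%g x = act g (act h x).
Hypothesis act_cont : forall g, continuous (act g).
Hypothesis proper : proper_action act.

Context (T : Type) (inner outer : T -> set M).
Hypothesis inner_open : forall t, open (inner t).
Hypothesis outer_compact : forall t, compact (outer t).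
Hypothesis inner_outer : forall t, inner t `<=` outer t.
Hypothesis cells : forall x U, open U -> U x ->
  exists2 t, inner t x & outer t `<=` U.

Let actK g : cancel (act g) (act g^-1%g).
Proof. by move=> x; rewrite -actM mulVg act1. Qed.
Let actKV g : cancel (act g^-1%g) (act g).
Proof. by move=> x; rewrite -actM mulgV act1. Qed.

Definition orbit_of (A : set M) : set M :=
  [set x | exists g, A (act g^-1%g x)].

Lemma orbit_ofS A B : A `<=` B -> orbit_of A `<=` orbit_of B.
Proof. by move=> AB x [g /AB]; exists g. Qed.

Lemma orbit_of_inv A g x : orbit_of A x -> orbit_of A (act g x).
Proof. by move=> [h Ah]; exists (g * h)%g; rewrite invgM actM actK. Qed.

Lemma orbit_of_sub A : A `<=` orbit_of A.
Proof. by move=> x Ax; exists 1%g; rewrite invg1 act1. Qed.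

Lemma orbit_of_open A : open A -> open (orbit_of A).
Proof.
move=> oA; rewrite (_ : orbit_of A = \bigcup_(g in setT) (act g^-1%g @^-1` A)).
  by apply: bigcup_open => g _; apply: open_comp => // x _; exact: act_cont.
by apply/seteqP; split => [x [g Ag]|x [g _ Ag]]; exists g.
Qed.

(** Properness, applied to the union of K and L. *)
Lemma finite_meeting K L : compact K -> compact L ->
  finite_set [set g | exists y, K y /\ L (act g^-1%g y)].
Proof.
move=> cK cL; apply: sub_finite_set (proper (compactU cK cL)) => g [y [Ky Ly]].
exists y; split; last by left.
by exists (act g^-1%g y); [right|exact: actKV].
Qed.

Lemma compact_nbhd (x : M) (U : set M) : open U -> U x ->
  exists K : set M, [/\ compact K, nbhs x K & K `<=` U].
Proof.
move=> oU Ux; have [t tx tU] := cells oU Ux; exists (outer t); split => //.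
by apply: filterS (@inner_outer t) _; apply: open_nbhs_nbhs.
Qed.

(** Only finitely many translates of L meet a compact neighbourhood of a point, and each translate
    is closed. *)
Lemma orbit_of_closed L : compact L -> closed (orbit_of L).
Proof.
move=> cL; rewrite -[orbit_of L]setCK; apply: open_closedC; rewrite openE => x nx.
have [K [cK Kx _]] := compact_nbhd openT (I : setT x).
have fin := finite_meeting cK cL.
have cl g : closed (act g^-1%g @^-1` L).
  have cl := compact_closed haus cL.
  by apply: preimage_closed => // y _; exact: act_cont.
pose F := [set g | exists y, K y /\ L (act g^-1%g y)].
have : nbhs x (\bigcap_(g in F) ~` (act g^-1%g @^-1` L)).
  have [X FX] := finite_fsetP.1 fin; rewrite -/F in FX.
  rewrite FX; apply: filter_bigI => g _; apply: open_nbhs_nbhs; split; first exact: closed_openC.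
  by move=> Lg; apply: nx; exists g.
move=> H; apply: filterS (filterI Kx H) => y [Ky Fy] [g Lg].
by apply: (Fy g) => //; exists y.
Qed.

Let countable_cells : exists B K : nat -> set M,
  [/\ forall i, open (B i), forall i, compact (K i), forall i, B i `<=` K i &
      forall x, exists i, B i x].
Proof.
have [BB /countable_injP[f finj] [Bo Bb]] := sc.
pose ok b := BB b /\ exists t, b `<=` inner t.
pose B i := \bigcup_(b in [set b | ok b /\ f b = i]) b.
have hK i : exists K, compact K /\ B i `<=` K.
  have [[b [[Bb' [t bt]] fb]]|nb] := pselect (exists b, ok b /\ f b = i).
    exists (outer t); split => // x [b' [[Bb'' _] fb'] b'x].
    apply: inner_outer; apply: bt.
    suff <- : b' = b by [].
    by apply: finj; rewrite ?inE// fb.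
  exists set0; split; first exact: compact0.
  by move=> x [b hb bx]; case: nb; exists b.
have [K hK'] := choice hK; exists B, K; split.
- by move=> i; apply: bigcup_open => b [[bB _] _]; exact: Bo.
- by move=> i; have [] := hK' i.
- by move=> i; have [] := hK' i.
move=> x; have [t tx _] := cells openT (I : setT x).
have nx : nbhs x (inner t) by apply: open_nbhs_nbhs.
have [b [bB bx] bt] := Bb x _ nx.
by exists (f b), b => //; split => //; split => //; exists t.
Qed.

(** Inner cells must cover while outer cells must be locally finite. The [A n] are the layers of an
    exhaustion by compact sets, taken modulo the group. Each is compact, hence covered by finitely
    many inner cells whose outer cells avoid [Dp n], the saturation of a compact set two stages
    below. A neighbourhood inside [U (m k)] therefore meets translates of cells of the layers 0 to k
    only, and finitely many of them by properness. *)
Lemma invariant_cover (t0 : T) : exists (t : nat * nat -> T) (S : set (nat * nat)),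
  (forall x : M, exists i g, S i /\ inner (t i) (act g^-1%g x)) /\
  (forall x : M, exists2 W : set M, nbhs x W & finite_set
     [set ig : (nat * nat) * G | S ig.1 /\
        exists y, W y /\ outer (t ig.1) (act ig.2^-1%g y)]).
Proof.
have [B [K [oB cK BK Bx]]] := countable_cells.
pose L n := \bigcup_(i in `I_n) K i.
pose U n := \bigcup_(i in `I_n) B i.
have cL n : compact (L n).
  elim: n => [|n IH].
    by rewrite /L II0 bigcup_set0; exact: compact0.
  have -> : L n.+1 = L n `|` K n.
    apply/seteqP; split => [x [i /=]|x [[i /= il Ki]|Kn]].
    - rewrite ltnS leq_eqVlt => /orP[/eqP->|il] Ki; first by right.
      by left; exists i.
    - by exists i => //=; exact: ltnW.
    - by exists n => /=.
  exact: compactU.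
have oU n : open (U n) by exact: bigcup_open.
have UL n : U n `<=` L n by move=> x [i il /BK Ki]; exists i.
have Umono n m : (n <= m)%N -> U n `<=` U m.
  by move=> nm x [i il Bi]; exists i => //=; exact: leq_trans nm.
have Lmono n m : (n <= m)%N -> L n `<=` L m.
  by move=> nm x [i il Bi]; exists i => //=; exact: leq_trans nm.
have next n : exists m, (n < m)%N /\ L n `<=` U m.
  have /compact_near_coveringP h := cL n.
  have := h nat \oo (fun m x => U m x) _.
  move=> /(_ _ _)[x _|N _ hN].
    have [i Bi] := Bx x; exists (B i, [set m | (i < m)%N]).
      split => /=; first by apply: open_nbhs_nbhs.
      by exists i.+1.
    by move=> [y m] /= [By im]; exists i.
  exists (maxn N n.+1); split; first by rewrite leq_max leqnn orbT.
  by apply: hN => /=; exact: leq_maxl.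
have [nu hnu] := choice next.
pose m n := iter n nu 0%N.
have mS n : (m n < m n.+1)%N by have [] := hnu (m n).
have mmono : {homo m : a b / (a <= b)%N}.
  by apply: homo_leq => // [a b c|a]; [exact: leq_trans|exact: ltnW].
have LU n : L (m n) `<=` U (m n.+1) by have [] := hnu (m n).
have mge n : (n <= m n)%N by elim: n => // n IH; exact: leq_ltn_trans IH (mS n).
(* Contained in the saturation of [U (m n)], which the layer [A n] avoids; empty for n = 0. *)
pose Dp n := if n is n'.+1 then orbit_of (L (m n')) else set0.
have Dclosed n : closed (Dp n).
  by case: n => [|n]; [exact: closed0|exact: orbit_of_closed].
pose A n := L (m n.+1) `\` orbit_of (U (m n)).
have cA n : compact (A n).
  apply: (subclosed_compact _ (cL (m n.+1))); last by move=> x [].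
  apply: closedI; first exact: (compact_closed haus (cL _)).
  exact/open_closedC/orbit_of_open.
have cell_at n x : exists t, A n x -> inner t x /\ outer t `<=` ~` Dp n.
  have [[Lx nU]|nA] := pselect (A n x); last by exists t0.
  have nD : (~` Dp n) x.
    case: n Lx nU => [|n] Lx nU Dx; first by case: Dx.
    apply: nU.
    exact: (orbit_ofS (@LU n)).
  have [t tx tD] := cells (closed_openC (Dclosed n)) nD.
  by exists t.
have layer n : exists F : seq T, (forall x, A n x -> exists2 i, (i < size F)%N &
     inner (nth t0 F i) x) /\
     forall i, (i < size F)%N -> outer (nth t0 F i) `<=` ~` Dp n.
  have [tt htt] := choice (cell_at n).
  have [x Ax|s [sA cov]] := compact_finite_cover (f := inner \o tt) (cA n).
    by apply: open_nbhs_nbhs; split => //=; have [] := htt x Ax.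
  exists (map tt s); split.
    move=> x /cov[y ys yx]; exists (index y s).
      by rewrite size_map index_mem.
    by rewrite (nth_map y) ?index_mem// nth_index.
  move=> i; rewrite size_map => iF.
  have [y0 _] : exists y0 : M, True.
    by case: (s) iF => // y0 s' _; exists y0.
  by rewrite (nth_map y0)//; have /htt[] := sA _ (mem_nth y0 iF).
have [F hF] := choice layer.
exists (fun i => nth t0 (F i.1) i.2), [set i | (i.2 < size (F i.1))%N]; split.
  move=> x; have exU : exists n, `[< orbit_of (U (m n)) x >].
    have [i Bi] := Bx x; exists i.+1; apply/asboolP; apply: orbit_of_sub.
    by exists i => //=; exact: leq_trans (mge _).
  (* The minimal index is positive, because [m 0 = 0] and [U 0] is empty. *)
  case: (ex_minnP exU) => -[|n] /asboolP Un minn.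
    by case: Un => g []; rewrite /m /=.
  case: Un => g Ug; have Ag : A n (act g^-1%g x).
    split; first exact: UL.
    move=> /(orbit_of_inv g); rewrite actKV => Un.
    by have := minn n (introT (asboolP _) Un); rewrite ltnn.
  have [i iF ix] := (hF n).1 _ Ag.
  by exists (n, i), g.
move=> x; have [i Bi] := Bx x; pose k := i.+1.
have Ux : U (m k) x by exists i => //=; exact: leq_trans (mge _).
have [C [cC Cx CU]] := compact_nbhd (oU (m k)) Ux.
exists C => //.
pose P := [set j : nat * nat | (j.1 <= k)%N /\ (j.2 < size (F j.1))%N].
pose H j := [set g | exists y, C y /\ outer (nth t0 (F j.1) j.2) (act g^-1%g y)].
apply: (@sub_finite_set _ _ (P `*`` H)).
  move=> [[n j] g] /= [jF [y [Cy oy]]]; split; last by exists y.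
  split => //=; rewrite leqNgt; apply/negP => kn.
  have := (hF n).2 _ jF _ oy; case: n kn jF oy => // n kn jF oy /=; apply.
  apply: (orbit_of_inv g^-1%g); apply: orbit_of_sub; apply: UL.
  by apply: (Umono (m k)); [exact: mmono|exact: CU].
apply: finite_setXR.
  apply: (@sub_finite_set _ _ (\bigcup_(n in `I_k.+1) (pair n @` `I_(size (F n))))).
    by move=> [n j] /= [nk jF]; exists n => //=; exists j.
  by apply: bigcup_finite => // n _; exact: finite_image.
by move=> j _; exact: finite_meeting.
Qed.

End InvariantCover.

(** * Locally Lipschitz maps *)

Section LocallyLipschitz.
Context (R : realType) (T : topologicalType) (dist : T -> T -> R).

(** [dist] is left abstract: it will be the distance of row vectors, or the distance of coordinates
    in a patch of the bundle, which varies with the patch. *)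
Definition loc_lip (W : normedModType R) (F : T -> W) (x : T) :=
  exists (C : R) (A : set T), [/\ 0 <= C, nbhs x A &
    forall y z, A y -> A z -> `|F y - F z| <= C * dist y z].

Context (x : T).
Hypothesis dist0 : forall y z, 0 <= dist y z.
Hypothesis dist_small : forall e : R, 0 < e ->
  exists2 A, nbhs x A & forall y z, A y -> A z -> dist y z <= e.

Lemma loc_lip_bounded (W : normedModType R) (F : T -> W) : loc_lip F x ->
  exists C : R, forall C', C <= C' -> 0 <= C' /\ exists2 A, nbhs x A &
    forall y z, A y -> A z -> `|F y| <= C' /\ `|F y - F z| <= C' * dist y z.
Proof.
move=> [C [A [C0 Ax h]]]; have [B Bx hB] := dist_small ltr01.
exists (C + `|F x|) => C' CC'.
have CC : C <= C' by apply: le_trans CC'; rewrite lerDl.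
split; first exact: le_trans CC.
exists (A `&` B); first exact: filterI.
have Ax' := nbhs_singleton Ax; have Bx' := nbhs_singleton Bx.
move=> y z [Ay By] [Az Bz]; split.
  apply: le_trans CC'; rewrite -(subrK (F x) (F y)).
  apply: (le_trans (ler_normD _ _)); rewrite lerD2r.
  by apply: (le_trans (h _ _ Ay Ax')); rewrite ler_piMr// hB.
by apply: (le_trans (h _ _ Ay Az)); rewrite ler_wpM2r.
Qed.

Lemma loc_lip_cst (W : normedModType R) (w : W) : loc_lip (fun=> w) x.
Proof.
exists 0, setT; split => //; first exact: filterT.
by move=> y z _ _; rewrite subrr normr0 mul0r.
Qed.

Lemma loc_lip_near (W : normedModType R) (F F' : T -> W) :
  (\forall y \near x, F y = F' y) -> loc_lip F x -> loc_lip F' x.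
Proof.
move=> E [C [A [C0 Ax h]]]; exists C, (A `&` [set y | F y = F' y]); split => //.
  exact: filterI.
by move=> y z [Ay <-] [Az <-]; exact: h.
Qed.

Lemma loc_lip_add (W : normedModType R) (F F' : T -> W) :
  loc_lip F x -> loc_lip F' x -> loc_lip (fun y => F y + F' y) x.
Proof.
move=> [C [A [C0 Ax h]]] [C' [B [C'0 Bx h']]].
exists (C + C'), (A `&` B); split; [exact: addr_ge0|exact: filterI|].
move=> y z [Ay By] [Az Bz]; rewrite opprD addrACA.
by apply: (le_trans (ler_normD _ _)); rewrite mulrDl lerD ?h ?h'.
Qed.

Lemma loc_lip_sum (W : normedModType R) (J : Type) (r : seq J) (F : J -> T -> W) :
  (forall j, loc_lip (F j) x) -> loc_lip (fun y => \sum_(j <- r) F j y) x.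
Proof.
move=> h; elim: r => [|j r IH].
  apply: loc_lip_near (loc_lip_cst 0); near=> y; by rewrite big_nil.
apply: loc_lip_near (loc_lip_add (h j) IH); near=> y; by rewrite big_cons.
Unshelve. all: by end_near. Qed.

Lemma loc_lip_bilinear (W1 W2 W3 : normedModType R) (f : W1 -> W2 -> W3) (K : R)
    (F : T -> W1) (F' : T -> W2) : 0 <= K ->
  (forall a b c, f (a - b) c = f a c - f b c) ->
  (forall a b c, f a (b - c) = f a b - f a c) ->
  (forall a b, `|f a b| <= K * `|a| * `|b|) ->
  loc_lip F x -> loc_lip F' x -> loc_lip (fun y => f (F y) (F' y)) x.
Proof.
move=> K0 fl fr fK /loc_lip_bounded[C1 h1] /loc_lip_bounded[C2 h2].
have [C0 [A Ax hA]] := h1 (Num.max C1 C2) ltac:(by rewrite le_max lexx).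
have [_ [B Bx hB]] := h2 (Num.max C1 C2) ltac:(by rewrite le_max lexx orbT).
move: (Num.max C1 C2) => C in C0 hA hB.
exists (K * C * C *+ 2), (A `&` B); split; [|exact: filterI|].
  by rewrite mulrn_wge0// !mulr_ge0.
move=> y z [Ay By] [Az Bz].
have [a1 a2] := hA _ _ Ay Az; have [b1 b2] := hB _ _ By Bz.
have [a3 _] := hA _ _ Az Ay.
have -> : f (F y) (F' y) - f (F z) (F' z) =
    f (F y - F z) (F' y) + f (F z) (F' y - F' z).
  by rewrite fl fr addrA subrK.
rewrite mulr2n mulrDl; apply: (le_trans (ler_normD _ _)); apply: lerD.
  apply: (le_trans (fK _ _)); rewrite -!mulrA ler_wpM2l//.
  by rewrite mulrC ler_pM.
by apply: (le_trans (fK _ _)); rewrite -!mulrA ler_wpM2l// ler_pM.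
Qed.

Lemma loc_lip_scale (W : normedModType R) (F : T -> R) (F' : T -> W) :
  loc_lip (F : T -> R^o) x -> loc_lip F' x -> loc_lip (fun y => F y *: F' y) x.
Proof.
apply: (@loc_lip_bilinear R^o W W (fun a b => a *: b) 1) => //.
- by move=> a b c; exact: scalerBl.
- by move=> a b c; exact: scalerBr.
- by move=> a b; rewrite mul1r normrZ.
Qed.

Lemma loc_lip_mulmx m n p (F : T -> 'M[R]_(m, n)) (F' : T -> 'M[R]_(n, p)) :
  loc_lip F x -> loc_lip F' x -> loc_lip (fun y => F y *m F' y) x.
Proof.
apply: (@loc_lip_bilinear 'M[R]_(m, n) 'M[R]_(n, p) 'M[R]_(m, p)
  (fun a b => a *m b) n%:R) => //.
- by move=> a b c; exact: mulmxBl.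
- by move=> a b c; exact: mulmxBr.
- by move=> a b; exact: mulmx_norm.
Qed.

Lemma loc_lip_comp (W W' : normedModType R) (F : T -> W) (g : W -> W') (K : R) :
  0 <= K -> (forall a b, `|g a - g b| <= K * `|a - b|) ->
  loc_lip F x -> loc_lip (fun y => g (F y)) x.
Proof.
move=> K0 gK [C [A [C0 Ax h]]]; exists (K * C), A; split => //.
  exact: mulr_ge0.
move=> y z Ay Az; apply: (le_trans (gK _ _)); rewrite -mulrA ler_wpM2l//.
exact: h.
Qed.

Lemma loc_lip_continuous (W : normedModType R) (F : T -> W) : loc_lip F x ->
  {for x, continuous F}.
Proof.
move=> [C [A [C0 Ax h]]]; apply/(@cvg_dist R W _ (nbhs x)) => e e0.
have eC : 0 < e / (C + 1) by rewrite divr_gt0// ltr_wpDl.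
have [B Bx hB] := dist_small eC.
apply: filterS (filterI Ax Bx) => y [Ay By].
apply: (le_lt_trans (h _ _ Ay (nbhs_singleton Ax))).
apply: (@le_lt_trans _ _ (C * (e / (C + 1)))).
  by rewrite ler_wpM2l// hB//; exact: nbhs_singleton.
by rewrite mulrA ltr_pdivrMr ?ltr_wpDl// mulrC ltr_pM2l// ltrDl.
Qed.

Lemma loc_lip_inv (F : T -> R) : (0 : R) < F x ->
  loc_lip (F : T -> R^o) x -> loc_lip ((fun y => (F y)^-1) : T -> R^o) x.
Proof.
move=> Fx FL; have Fx2 : 0 < F x / 2 by rewrite divr_gt0.
have /(@cvg_dist R R^o)/(_ _ Fx2) B := loc_lip_continuous FL.
move: FL => [C [A [C0 Ax h]]].
exists (C / (F x / 2) ^+ 2), (A `&` [set y | `|F y - F x| < F x / 2]); split.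
- by rewrite divr_ge0// exprn_ge0// ltW.
- exact: filterI.
move=> y z [Ay /= Fy] [Az /= Fz].
have gt2 w : `|F w - F x| < F x / 2 -> F x / 2 < F w.
  by rewrite ltr_distl => /andP[+ _]; have := splitr (F x); lra.
have {}Fy := gt2 _ Fy; have {}Fz := gt2 _ Fz.
have y0 := lt_trans Fx2 Fy; have z0 := lt_trans Fx2 Fz.
have -> : (F y)^-1 - (F z)^-1 = (F z - F y) * ((F y) * (F z))^-1 :> R.
  by field; rewrite !gt_eqF.
rewrite normrM normfV (gtr0_norm (mulr_gt0 y0 z0)) ler_pdivrMr ?mulr_gt0//.
have hh : `|F z - F y| <= C * dist y z by rewrite distrC; exact: h.
apply: (le_trans hh).
rewrite [leRHS](_ : _ = C * dist y z * ((F y * F z) / (F x / 2) ^+ 2)); last first.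
  by field; rewrite gt_eqF.
rewrite ler_peMr ?mulr_ge0// ler_pdivlMr ?exprn_gt0// mul1r expr2.
by rewrite ler_pM// ltW.
Qed.

End LocallyLipschitz.

Lemma rV_dist_small (R : realType) n (x : 'rV[R]_n) (e : R) : 0 < e ->
  exists2 A, nbhs x A & forall y z, A y -> A z -> `|y - z| <= e.
Proof.
move=> e0; exists [set y | `|y - x| < e / 2].
  by apply/near_rV; exists (e / 2) => //; rewrite divr_gt0.
move=> y z /= yx zx; rewrite -(subrKA x) (splitr e).
by apply: (le_trans (ler_normD _ _)); rewrite lerD// ltW// distrC.
Qed.

Section CutOff.
Context (R : realType).

Definition cutoff (r s : R) : R := Num.max 0 (r - s).

Lemma cutoff_ge0 r s : 0 <= cutoff r s.
Proof. by rewrite le_max lexx. Qed.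

Lemma cutoff_gt0 r s : (0 < cutoff r s) = (s < r).
Proof. by rewrite lt_max ltxx subr_gt0. Qed.

Lemma cutoff_lip r s t : `|cutoff r s - cutoff r t| <= `|s - t|.
Proof.
rewrite /cutoff /Order.max ler_norml; have := ler_norm (s - t).
have := lerNnormlW (lexx `|s - t|); have := normr_ge0 (s - t).
by case: ltP => a; case: ltP => b h0 h1 h2; apply/andP; split; lra.
Qed.

End CutOff.

(** Increments along [t *: h] with small t > 0 determine [h *m J] once a Jacobian is known to
    exist. *)
Lemma deriv_line (R : realType) n p (f : 'rV[R]_n -> 'rV[R]_p) y J (h : 'rV[R]_n) v :
  has_jac f y J ->
  (exists C r : R, 0 < r /\ forall t : R, 0 < t -> t < r ->
    `|f (y + t *: h) - f y - t *: v| <= C * t ^+ 2) ->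
  h *m J = v.
Proof.
move=> [C [C0 hJ]] [C' [r [r0 hv]]]; apply/eqP; rewrite -subr_eq0 -normr_le0.
pose K := C * `|h| ^+ 2 + `|C'|.
pose s := Num.min (C^-1 / (`|h| + 1)) r / 2.
have h1 : 0 < `|h| + 1 by rewrite ltr_wpDl.
have s0 : 0 < s by rewrite divr_gt0// lt_min r0 divr_gt0 ?invr_gt0.
apply: (@le_of_inv_nat _ _ _ (K * s)) => k; rewrite add0r.
have k0 : 0 < (k.+1%:R : R) by rewrite ltr0n.
pose t := s / k.+1%:R; have t0 : 0 < t by rewrite divr_gt0.
have ts : t < Num.min (C^-1 / (`|h| + 1)) r.
  apply: (@le_lt_trans _ _ s).
    by rewrite ler_pdivrMr// ler_peMr ?ler1n// ltW.
  by rewrite ltr_pdivrMr// ltr_pMr ?ltr1n// lt_min r0 divr_gt0 ?invr_gt0.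
move: ts; rewrite lt_min => /andP[t1 t2].
have e : y + t *: h - y = t *: h by rewrite addrC addKr.
have th : `|t *: h| < C^-1.
  rewrite normrZ gtr0_norm//; apply: (@le_lt_trans _ _ (t * (`|h| + 1))).
    by rewrite ler_wpM2l ?(ltW t0)// lerDl.
  by rewrite -ltr_pdivlMr.
have a1 := hJ (y + t *: h); rewrite e in a1; have {}a1 := a1 th.
have a2 := hv t t0 t2.
rewrite -(ler_pM2l t0) -[t in leLHS]gtr0_norm// -normrZ.
have -> : t *: (h *m J - v) = (f (y + t *: h) - f y - t *: v) -
    (f (y + t *: h) - f y - (t *: h) *m J).
  have aux (W : zmodType) (F a b : W) : (F - b) - (F - a) = a - b.
    by rewrite opprB addrC addrA subrK.
  by rewrite aux scalerBr scalemxAl.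
apply: (le_trans (ler_normB _ _)).
rewrite [leRHS](_ : _ = `|C'| * t ^+ 2 + C * (t * `|h|) ^+ 2); last first.
  rewrite /t /K; move: (k.+1%:R : R) (lt0r_neq0 k0) => kk kk0.
  by field.
apply: lerD.
  by apply: (le_trans a2); rewrite ler_wpM2r ?exprn_ge0 ?ler_norm// ltW.
by apply: (le_trans a1); rewrite normrZ gtr0_norm.
Qed.

(** The bridge to the derivative ['D_h], in terms of which [differential] is defined. *)
Lemma has_jac_derive (R : realType) n p (f : 'rV[R]_n -> 'rV[R]_p) y J
    (h : 'rV[R]_n) : has_jac f y J -> 'D_h f y = h *m J.
Proof.
move=> [C [C0 hJ]]; rewrite /derive; apply: (@cvg_lim 'rV[R]_p) => //.
apply/cvg_rV => e e0.
have h1 : 0 < `|h| + 1 by rewrite ltr_wpDl.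
pose K := C * `|h| ^+ 2 + 1.
have K0 : 0 < K by rewrite ltr_wpDl// mulr_ge0 ?exprn_ge0// ltW.
pose r := Num.min (C^-1 / (`|h| + 1)) (e / K).
have r0 : 0 < r by rewrite lt_min !divr_gt0 ?invr_gt0.
exists r => //= t; rewrite /ball_ /= sub0r normrN lt_min => /andP[t1 t2] t0.
have E : t *: h + y - y = t *: h by rewrite addrK.
have th : `|t *: h| < C^-1.
  rewrite normrZ; apply: (@le_lt_trans _ _ (`|t| * (`|h| + 1))).
    by rewrite ler_wpM2l// lerDl.
  by rewrite -ltr_pdivlMr.
have := hJ (t *: h + y); rewrite E => /(_ th) a.
have -> : t^-1 *: (f (t *: h + y) - f y) - h *m J =
   t^-1 *: (f (t *: h + y) - f y - (t *: h) *m J).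
  by rewrite [in RHS]scalerBr -scalemxAl scalerA mulVf// scale1r.
rewrite normrZ normfV mulrC ltr_pdivrMr ?normr_gt0//.
apply: (le_lt_trans a); rewrite normrZ exprMn mulrCA expr2 -mulrA mulrC.
rewrite ltr_pM2r ?normr_gt0//.
apply: (@le_lt_trans _ _ (`|t| * K)).
  by rewrite ler_wpM2l// lerDl.
by rewrite -ltr_pdivlMr.
Qed.

Lemma loc_lip_compose (R : realType) (T : topologicalType) (dist : T -> T -> R) (t : T)
    m (F : T -> 'rV[R]_m) (W : normedModType R) (h : 'rV[R]_m -> W) :
  (forall y z, 0 <= dist y z) ->
  (forall c : R, 0 < c -> exists2 A, nbhs t A &
     forall y z, A y -> A z -> dist y z <= c) ->
  loc_lip dist F t -> loc_lip (fun a c => `|a - c|) h (F t) ->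
  loc_lip dist (fun t' => h (F t')) t.
Proof.
move=> d0 ds FL; have Fc := loc_lip_continuous ds FL.
move: FL => [C [A [C0 Ax hA]]] [C' [B [C'0 Bx hB]]].
exists (C' * C), (A `&` F @^-1` B); split; first exact: mulr_ge0.
  by apply: filterI => //; exact: Fc.
move=> y z [Ay By] [Az Bz]; apply: (le_trans (hB _ _ By Bz)).
by rewrite -mulrA ler_wpM2l// hA.
Qed.

(** The slopes [l t] are genuine derivatives, so the mean value theorem applies. *)
Lemma increasing_of_slopes (R : realType) (f l : R -> R) :
  (forall t, 0 < l t /\ exists C e : R, 0 < e /\ forall t', `|t' - t| < e ->
     `|f t' - f t - (t' - t) * l t| <= C * (t' - t) ^+ 2) ->
  forall t, 0 < t -> f 0 < f t.
Proof.
move=> h t t0.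
have fd (x : R) : is_derive x 1 f (l x).
  have [_ [C [e [e0 hC]]]] := h x.
  have cv : h^-1 *: ((f \o shift x) (h *: 1) - f x) @[h --> 0^'] --> (l x : R^o).
    apply/(@cvg_dist R R^o) => c c0; pose K := `|C| + 1.
    have K0 : 0 < K by rewrite ltr_wpDl.
    exists (Num.min e (c / K)); first by rewrite /= lt_min e0 divr_gt0.
    move=> s /=; rewrite /ball_ /= sub0r normrN lt_min => /andP[s1 s2] s0.
    have E : s * 1 + x - x = s by rewrite mulr1 addrK.
    have := hC (s * 1 + x); rewrite E => /(_ s1) a.
    have -> : s^-1 *: (f (s * 1 + x) - f x) - l x =
        s^-1 * (f (s * 1 + x) - f x - s * l x).
      by rewrite [in RHS]mulrBr mulrA mulVf// mul1r.
    rewrite normrM normfV mulrC ltr_pdivrMr ?normr_gt0//.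
    apply: (le_lt_trans a); apply: (@le_lt_trans _ _ (K * `|s| * `|s|)).
      rewrite -mulrA -normrM -expr2 [`|_ ^+ 2|]ger0_norm ?sqr_ge0// ler_wpM2r ?sqr_ge0//.
      by rewrite (le_trans (ler_norm _))// lerDl.
    by rewrite ltr_pM2r ?normr_gt0// mulrC -ltr_pdivlMr.
  by split; [apply/cvg_ex; exists (l x)|exact: cvg_lim].
have fc : {within `[0, t], continuous f}.
  apply: derivable_within_continuous => x _.
  by have [] := fd x.
have [c _ e] := MVT t0 (fun x _ => fd x) fc.
by rewrite -subr_gt0 e mulr_gt0 ?subr_gt0//; have [] := h c.
Qed.

(** * Local fields *)

Section Frames.
Context (R : realType) (V : vectType R) (d : nat) (M : manifold R d).
Context (u : M -> {vspace qform V}).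
Hypothesis fit : fitting_immersion u.

Local Notation Q := (qform V).

Lemma dimu x : \dim (u x) = d.
Proof. by have [/(_ x)[]] := fit. Qed.

Definition comb x (c : 'rV[R]_d) : Q := \sum_i c 0 i *: (vbasis (u x))`_i.

Definition ell x (q : Q) : 'rV[R]_d :=
  \row_i coord (vbasis (u x)) (cast_ord (esym (dimu x)) i)
    (daddv_pi (u x) (u x)^C q).

(* Near x, [frame b x z] parametrises the pencil over the point with coordinate z,
   as a graph over u x; its inverse [ell x] does not depend on z. *)
Definition frame (b : chart R d M) x (z c : 'rV[R]_d) : Q :=
  comb x c + gr_chart (u x) (u (chart_inv b z)) (comb x c).

Lemma ell_linear x : linear (ell x).
Proof. by move=> c p q; apply/rowP => i; rewrite !mxE !linearP. Qed.

HB.instance Definition _ x := GRing.isLinear.Build R Q _ _ (ell x) (ell_linear x).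

Lemma comb_linear x : linear (comb x).
Proof.
move=> k c c'; rewrite /comb scaler_sumr -big_split; apply: eq_bigr => i _.
by rewrite !mxE scalerDl scalerA.
Qed.

HB.instance Definition _ x := GRing.isLinear.Build R _ Q _ (comb x) (comb_linear x).

Lemma frame_linear b x z : linear (frame b x z).
Proof.
move=> k c c'; rewrite /frame linearP linearP scalerDr.
by rewrite addrACA.
Qed.

HB.instance Definition _ b x z :=
  GRing.isLinear.Build R _ Q _ (frame b x z) (frame_linear b x z).

Lemma comb_mem x c : comb x c \in u x.
Proof.
apply: memv_suml => i _; apply: memvZ; apply: vbasis_mem.
by apply: mem_nth; rewrite size_tuple dimu.
Qed.

Lemma comb_ell x q : comb x (ell x q) = daddv_pi (u x) (u x)^C q.
Proof.
rewrite [RHS](coord_vbasis (memv_pi _ _ _)).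
rewrite (reindex (cast_ord (esym (dimu x)))) /=; last first.
  by exists (cast_ord (dimu x)) => i _; rewrite ?cast_ordK ?cast_ordKV.
by apply: eq_bigr => i _; rewrite mxE.
Qed.

Lemma ell_id x q : q \in u x -> comb x (ell x q) = q.
Proof. by move=> qx; rewrite comb_ell daddv_pi_id ?capv_compl. Qed.

Lemma ell_compl x q : q \in (u x)^C%VS -> ell x q = 0.
Proof.
move=> qC; apply/rowP => i; rewrite !mxE.
have := @daddv_pi_add _ _ (u x) (u x)^C%VS q (capv_compl _).
rewrite addv_complf memvf => /(_ isT).
rewrite [X in _ + X]daddv_pi_id ?(capvC (u x)^C%VS) ?capv_compl//.
by move=> /(canRL (addrK _)); rewrite subrr => ->; rewrite linear0.
Qed.

Lemma comb_inj x : injective (comb x).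
Proof.
move=> c c' /eqP; rewrite -subr_eq0 -linearB /= => /eqP cc'.
apply/eqP; rewrite -subr_eq0; apply/eqP/rowP => i; rewrite [RHS]mxE.
have /freeP fr : free (vbasis (u x)) by exact: basis_free (vbasisP _).
have := fr (fun j => (c - c') 0 (cast_ord (dimu x) j)) _ (cast_ord (esym (dimu x)) i).
rewrite cast_ordKV; apply; rewrite -[RHS]cc'.
rewrite [RHS](reindex (cast_ord (dimu x))) //=.
by exists (cast_ord (esym (dimu x))) => j _; rewrite ?cast_ordK ?cast_ordKV.
Qed.

Lemma ell_comb x c : ell x (comb x c) = c.
Proof. by apply: (@comb_inj x); rewrite ell_id ?comb_mem. Qed.

Section Frame.
Context (b : chart R d M) (x : M) (z : 'rV[R]_d).
Local Notation y := (chart_inv b z).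
Hypothesis tr : (u y :&: (u x)^C = 0)%VS.

Let grP := gr_chartP (etrans (dimu x) (esym (dimu y))) tr.

Lemma ell_frame c : ell x (frame b x z c) = c.
Proof.
have [h1 _ _] := grP.
by rewrite /frame linearD /= ell_comb ell_compl ?addr0.
Qed.

Lemma frame_mem c : frame b x z c \in u y.
Proof. by have [_ _ h3] := grP; apply/h3; exists (comb x c); rewrite ?comb_mem. Qed.

Lemma frame_ell q : q \in u y -> frame b x z (ell x q) = q.
Proof.
have [h1 _ h3] := grP => /h3[p px ->]; rewrite linearD /= (ell_compl (h1 p)).
by rewrite addr0 /frame ell_id.
Qed.

End Frame.

Lemma frame_sum b x z c :
  frame b x z c = \sum_i c 0 i *: frame b x z (delta_mx 0 i).
Proof.
rewrite {1}(row_sum_delta c) linear_sum; apply: eq_bigr => i _.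
by rewrite linearZ.
Qed.

(** Taking the interior makes the set open, so that it can serve as a domain of coordinates; the
    last condition says that the frame has a Lipschitz derivative around [b y]. *)
Definition good (b : chart R d M) x : set M :=
  interior [set y | [/\ atlas b, chart_dom b x, chart_dom b y,
    (u y :&: (u x)^C = 0)%VS &
    forall i k, c11 (fun z => coords (frame b x z (delta_mx 0 i)) 0 k) (b y)]].

Lemma good_open b x : open (good b x).
Proof. exact: open_interior. Qed.

Lemma good_sub b x y : good b x y -> [/\ atlas b, chart_dom b x, chart_dom b y,
    (u y :&: (u x)^C = 0)%VS &
    forall i k, c11 (fun z => coords (frame b x z (delta_mx 0 i)) 0 k) (b y)].
Proof. by move/interior_subset. Qed.

Lemma smooth_c11 (W : vectType R) (f : 'rV[R]_d -> W) z : smooth_at f z ->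
  \forall y \near z, forall k, c11 (fun y => coords (f y) 0 k) y.
Proof.
move=> [U [oU Uz CU]].
have : nbhs z U by apply: open_nbhs_nbhs.
apply: filterS => y Uy k.
have [C hC] := Ck2_c11 oU Uy (CU 2%N k).
by exists C; eexists; exact: hC.
Qed.

Lemma chart_continuous (b : chart R d M) x : chart_dom b x ->
  {for x, continuous b}.
Proof. exact: chart_fun_continuous. Qed.

Lemma good_center b x : atlas b -> chart_dom b x -> good b x x.
Proof.
move=> ab bx; have [_ [sm _] _] := fit.
have [tr /smooth_c11 cA] := sm x b ab bx.
have cb := chart_continuous bx cA.
have ob : nbhs x (chart_dom b).
  by apply: open_nbhs_nbhs; split => //; exact: chart_dom_open.
apply: filterS (filterI ob (filterI tr cb)) => y [yb [ytr yA]]; split => // i k.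
pose p := comb x (delta_mx 0 i).
pose E l : 'End(Q) := (vbasis {: 'End(Q)})`_l.
(* In a basis of the endomorphisms, the frame is affine in the coordinates of the Grassmannian
   chart, whose regularity is that of u. *)
rewrite (_ : (fun z => _) = (fun z => coords p 0 k + \sum_(l < \dim {: 'End(Q)})
   coords (gr_chart (u x) (u (chart_inv b z))) 0 l * coords (E l p) 0 k)).
  apply: c11_add; first exact: c11_cst.
  apply: c11_sum => l; apply: c11_mul; last exact: c11_cst.
  exact: yA.
apply/funext => z; rewrite /frame -/p linearD mxE; congr (_ + _).
rewrite -{1}[gr_chart _ _]coordsK uncoordsE sum_lfunE linear_sum /= summxE.
by apply: eq_bigr => l _; rewrite scale_lfunE linearZ /= mxE.
Qed.

Lemma frame_c11 b x q (f : Q -> 'rV[R]_q) (y0 : 'rV[R]_(d + d)) : linear f ->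
  (forall i k, c11 (fun z => coords (frame b x z (delta_mx 0 i)) 0 k) (lsubmx y0)) ->
  c11v (fun y => f (frame b x (lsubmx y) (rsubmx y))) y0.
Proof.
move=> fl hc j.
have [g gE] : exists g : {linear Q -> 'rV[R]_q}, f =1 g.
  pose g : {linear Q -> 'rV[R]_q} :=
    HB.pack f (GRing.isLinear.Build _ _ _ _ f fl).
  by exists g.
rewrite (_ : (fun y => _) = fun y : 'rV[R]_(d + d) => \sum_i y 0 (rshift d i) *
  \sum_k coords (frame b x (lsubmx y) (delta_mx 0 i)) 0 k *
    (f ((vbasis {: Q})`_k)) 0 j).
  apply: c11_sum => i; apply: c11_mul; first exact: c11_coord.
  apply: c11_sum => k; apply: c11_mul; last exact: c11_cst.
  have [A hA] := lsubmx_mulmx R d d.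
  rewrite (_ : (fun y => _) = fun y : 'rV[R]_(d + d) =>
    coords (frame b x (y *m A) (delta_mx 0 i)) 0 k).
    apply: (@c11_comp_linear _ _ _ A (fun z => coords (frame b x z (delta_mx 0 i)) 0 k)).
    by rewrite -hA.
  by apply/funext => y; rewrite hA.
apply/funext => y; rewrite frame_sum gE linear_sum summxE.
apply: eq_bigr => i _; rewrite linearZ !mxE; congr (_ * _).
rewrite -{1}[frame _ _ _ _]coordsK uncoordsE linear_sum summxE.
by apply: eq_bigr => k _; rewrite linearZ gE mxE.
Qed.

Definition frame_row (b : chart R d M) x (y : 'rV[R]_(d + d)) :
    'rV[R]_(\dim {:Q}) := coords (frame b x (lsubmx y) (rsubmx y)).

(** [chart_inv] is a total function; the second clause rules out those z that are not coordinates of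
    a point. *)
Definition chart_ok (b : chart R d M) x z :=
  good b x (chart_inv b z) /\ b (chart_inv b z) = z.

Lemma frame_row_c11 b x y : chart_ok b x (lsubmx y) -> c11v (frame_row b x) y.
Proof.
move=> [/good_sub[_ _ _ _ h] bz]; rewrite bz in h.
by apply: (@frame_c11 _ _ _ (@coords R Q)) => //; exact: coords_linear.
Qed.

Lemma near_chart_ok b x : atlas b -> chart_dom b x ->
  \forall z \near b x, chart_ok b x z.
Proof.
move=> ab bx; have gx : nbhs x (good b x).
  by apply: open_nbhs_nbhs; split; [exact: good_open|exact: good_center].
have := chart_inv_continuous bx; rewrite /prop_for /continuous_at chart_funK//.
move=> /(_ _ gx) n1.
have n2 : nbhs (b x) ((b : M -> _) @` chart_dom b).
  by apply: open_nbhs_nbhs; split; [exact: chart_cod_open|exists x].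
have n3 : nbhs (b x) ((chart_inv b @^-1` good b x) `&` ((b : M -> _) @` chart_dom b)).
  exact: filterI.
move: n3; apply: filterS => z [gz [x' bx' x'z]]; split => //.
by rewrite -x'z chart_funK.
Qed.

(** Frames are linear in the fibre variable: differentiate the identity between [frame_row] at
    [y *m Lam] and t times [frame_row] at y. *)
Lemma jac_scaled b x z c t : 0 < t -> chart_ok b x z ->
  block_mx 1%:M 0 0 t%:M *m jac (frame_row b x) (row_mx z (t *: c)) =
  t *: jac (frame_row b x) (row_mx z c).
Proof.
move=> t0 okz; set Lam := block_mx _ _ _ _.
have LamE (y : 'rV[R]_(d + d)) : y *m Lam = row_mx (lsubmx y) (t *: rsubmx y).
  by rewrite -{1}[y]hsubmxK mul_row_block !mulmx1 !mulmx0 addr0 add0r mul_mx_scalar.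
have e y : frame_row b x (y *m Lam) = t *: frame_row b x y.
  by rewrite LamE /frame_row row_mxKl row_mxKr linearZ /= linearZ.
have okl c' : chart_ok b x (lsubmx (row_mx z c')) by rewrite row_mxKl.
have yE : row_mx z c *m Lam = row_mx z (t *: c) by rewrite LamE row_mxKl row_mxKr.
have h1 : has_jac (fun y => frame_row b x (y *m Lam)) (row_mx z c)
    (Lam *m jac (frame_row b x) (row_mx z (t *: c))).
  apply: (@has_jac_comp _ _ _ _ (fun y => y *m Lam)); first exact: has_jac_linear.
  by rewrite yE; exact/c11v_jac/frame_row_c11.
have h2 : has_jac (fun y => frame_row b x (y *m Lam)) (row_mx z c)
    (jac (frame_row b x) (row_mx z c) *m t%:M).
  have -> : (fun y => frame_row b x (y *m Lam)) = (fun y => frame_row b x y *m t%:M).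
    by apply/funext => y; rewrite e mul_mx_scalar.
  apply: (@has_jac_comp _ _ _ _ (frame_row b x) (fun y => y *m t%:M)).
    exact/c11v_jac/frame_row_c11.
  exact: has_jac_linear.
by rewrite (has_jac_unique h1 h2) mul_mx_scalar.
Qed.

(** The Grassmannian chart vanishes at its own centre, so moving from (b x, c) along (w, ell x r)
    changes the form to first order by [D w (comb x c) + r]; the pair w, r comes from
    [transverse_direction]. *)
Lemma center_direction b x c : atlas b -> chart_dom b x -> c != 0 ->
  exists h : 'rV[R]_(d + d),
    positive (uncoords (h *m jac (frame_row b x) (row_mx (b x) c)) : Q).
Proof.
move=> ab bx c0; pose z0 := b x.
pose A z := gr_chart (u x) (u (chart_inv b z)).
pose a z := coords (A z).
have [_ [sm _] ft] := fit; have [_ /smooth_c11/nbhs_singleton ca] := sm x b ab bx.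
have ja : has_jac a z0 (jac a z0) by exact: c11v_jac.
have a0 : a z0 = 0.
  by rewrite /a /A /z0 chart_funK// /gr_chart subrr linear0.
pose D w : 'End(Q) := differential u x b w.
have DE w : D w = uncoords (w *m jac a z0).
  by rewrite /D /differential /dir_derive -(has_jac_derive w ja).
have Dl : linear D.
  by move=> k w w'; rewrite !DE mulmxDl -scalemxAl linearP.
have q00 : comb x c != 0.
  apply: contra c0 => /eqP q0; rewrite -[c](ell_comb x) q0 linear0.
  exact: eqxx.
have [w [r [rP pos]]] : exists w r, r \in u x /\ positive (D w (comb x c) + r).
  apply: (transverse_direction (positive_cone V) (dimu x) Dl
    (comb_mem x c) q00) => w w0.
  by apply: ft => //; apply/eqP.
have lq (q : Q) : linear (fun k => coords ((uncoords k : 'End(Q)) q)).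
  by move=> k v v'; rewrite linearP add_lfunE scale_lfunE linearP.
have /choice[Lm hLm] : forall q : Q, exists B, forall k,
    coords ((uncoords k : 'End(Q)) q) = k *m B.
  by move=> q; exact: linear_mulmx (lq q).
have AE z q : coords (A z q) = a z *m Lm q by rewrite -hLm coordsK.
exists (row_mx w (ell x r)).
have okz : chart_ok b x z0 by exact: nbhs_singleton (near_chart_ok ab bx).
have okl : chart_ok b x (lsubmx (row_mx z0 c)) by rewrite row_mxKl.
rewrite (deriv_line (v := coords (D w (comb x c) + r))
  (c11v_jac (frame_row_c11 okl))); first by rewrite coordsK.
have [K [K0 aK]] := has_jac_lipschitz ja; move: ja => [C [C0 hJ]].
pose l : R := (\dim {:'End(Q)})%:R.
exists (l * (C * `|w| ^+ 2) * `|Lm (comb x c)| + l * (K * `|w|) * `|Lm r|).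
have w1 : 0 < `|w| + 1 by rewrite ltr_wpDl.
exists (Num.min (C^-1 / (`|w| + 1)) (K^-1 / (`|w| + 1))); split.
  by rewrite lt_min !divr_gt0 ?invr_gt0.
move=> t t0; rewrite lt_min => /andP[t1 t2].
have wt : `|t *: w| <= t * (`|w| + 1).
  by rewrite normrZ gtr0_norm// ler_wpM2l ?(ltW t0)// lerDl.
have e : z0 + t *: w - z0 = t *: w by rewrite addrC addKr.
have b1 : `|a (z0 + t *: w) - a z0 - (t *: w) *m jac a z0| <= C * `|t *: w| ^+ 2.
  rewrite -[in X in _ <= X]e -[in X in _ - X]e; apply: hJ; rewrite e.
  by apply: (le_lt_trans wt); rewrite -ltr_pdivlMr.
have b2 : `|a (z0 + t *: w) - a z0| <= K * `|t *: w|.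
  rewrite -[in X in _ <= X]e; apply: aK; rewrite e.
  by apply: (le_lt_trans wt); rewrite -ltr_pdivlMr.
(* The exact remainder: the expansion error of [a] applied to the form, plus t times the variation
   of [a] applied to r. Both are O(t^2). *)
have -> : frame_row b x (row_mx z0 c + t *: row_mx w (ell x r)) -
    frame_row b x (row_mx z0 c) - t *: coords (D w (comb x c) + r) =
  (a (z0 + t *: w) - a z0 - (t *: w) *m jac a z0) *m Lm (comb x c) +
  t *: ((a (z0 + t *: w) - a z0) *m Lm r).
  rewrite scale_row_mx add_row_mx /frame_row !row_mxKl !row_mxKr.
  have fE z c' : coords (frame b x z c') = coords (comb x c') + a z *m Lm (comb x c').
    by rewrite -AE -linearD.
  have AL z : a z *m Lm (comb x c + t *: r) =
      a z *m Lm (comb x c) + t *: (a z *m Lm r).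
    by rewrite -!AE !linearD /= !linearZ.
  have cE : comb x (c + t *: ell x r) = comb x c + t *: r.
    by rewrite linearD linearZ /= ell_id.
  have kE z : coords (frame b x z (c + t *: ell x r)) =
      coords (comb x c) + t *: coords r +
      (a z *m Lm (comb x c) + t *: (a z *m Lm r)).
    by rewrite fE cE AL linearD linearZ.
  have DrE : coords (D w (comb x c) + r) =
      (w *m jac a z0) *m Lm (comb x c) + coords r.
    by rewrite linearD /= DE hLm.
  rewrite kE fE DrE.
  rewrite !mulmxBl -!scalemxAl a0 !mul0mx !subr0.
  move: (coords _) (coords _) (a _ *m _) (a _ *m _) (w *m _ *m _) => v1 v2 v3 v4 v5.
  by apply/matrixP => i j; rewrite !mxE; ring.
have l0 : 0 <= l by rewrite /l.
apply: (le_trans (ler_normD _ _)); rewrite normrZ gtr0_norm//.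
rewrite [leRHS]mulrDl; apply: lerD.
  apply: (le_trans (mulmx_norm _ _)); rewrite [leRHS]mulrAC ler_wpM2r//.
  rewrite -mulrA ler_wpM2l//; apply: (le_trans b1).
  rewrite normrZ gtr0_norm// exprMn.
  by rewrite le_eqVlt; apply/orP; left; apply/eqP; ring.
rewrite expr2 mulrCA ler_wpM2l ?(ltW t0)//.
apply: (le_trans (mulmx_norm _ _)); rewrite [leRHS]mulrAC ler_wpM2r//.
rewrite -mulrA ler_wpM2l//; apply: (le_trans b2).
rewrite normrZ gtr0_norm//.
by rewrite le_eqVlt; apply/orP; left; apply/eqP; ring.
Qed.

Definition fibre_scaling (t : R) : 'M[R]_(d + d) := block_mx 1%:M 0 0 t%:M.

Lemma mulmx_fibre_scaling (v : 'rV[R]_(d + d)) t :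
  v *m fibre_scaling t = row_mx (lsubmx v) (t *: rsubmx v).
Proof.
rewrite /fibre_scaling -{1}[v]hsubmxK mul_row_block !mulmx1 !mulmx0 addr0 add0r.
by rewrite mul_mx_scalar.
Qed.

Lemma fibre_scalingM s t :
  fibre_scaling s *m fibre_scaling t = fibre_scaling (s * t).
Proof.
by rewrite /fibre_scaling mulmx_block !mulmx0 !mul0mx !addr0 !add0r mulmx1 -scalar_mxM.
Qed.

(* The homogeneity of Y makes the corresponding field commute with scalings. *)
Definition local_field (b : chart R d M) x (Y : 'rV[R]_d -> 'rV[R]_(d + d))
    (r : R) : Prop :=
  [/\ 0 < r, forall z, `|z - b x| <= 3 * r -> chart_ok b x z,
      forall t c, 0 < t -> Y (t *: c) = Y c *m fibre_scaling t,
      forall c, c != 0 -> loc_lip (fun c1 c2 => `|c1 - c2|) Y c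
    & forall z c, `|z - b x| <= 3 * r -> c != 0 ->
        positive (uncoords (Y c *m jac (frame_row b x) (row_mx z c)) : Q)].

Lemma local_field_shrink b x Y r r' : 0 < r' -> r' <= r ->
  local_field b x Y r -> local_field b x Y r'.
Proof.
move=> r'0 r'r [r0 h1 h2 h3 h4].
have le z : `|z - b x| <= 3 * r' -> `|z - b x| <= 3 * r.
  by move=> /le_trans; apply; rewrite ler_wpM2l.
by split=> // [z /le|z c /le]; [exact: h1|exact: h4].
Qed.

(** Positivity is an open condition and the Jacobian is continuous, so a direction found at the
    centre remains good nearby. *)
Lemma constant_direction b x c : atlas b -> chart_dom b x -> c != 0 ->
  exists (h : 'rV[R]_(d + d)) (r : R), 0 < r /\ forall z c',
    `|z - b x| < r -> `|c' - c| < r ->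
    positive (uncoords (h *m jac (frame_row b x) (row_mx z c')) : Q).
Proof.
move=> ab bx c0; have [h hp] := center_direction ab bx c0; exists h.
have okz := nbhs_singleton (near_chart_ok ab bx).
have [|C [C0 hC]] := @c11v_est _ _ _ (frame_row b x) (row_mx (b x) c).
  by apply: frame_row_c11; rewrite ?row_mxKl.
set J := jac (frame_row b x) in hp hC *.
have : nbhs (h *m J (row_mx (b x) c)) [set k | positive (uncoords k : Q)].
  by apply: open_nbhs_nbhs; split; [exact: positive_open|].
move=> /near_rV[e e0 he].
pose K := (d + d)%:R * `|h| * C + 1.
have K1 : 0 < K by rewrite ltr_wpDl// !mulr_ge0// ltW.
exists (Num.min C^-1 (e / K)); split; first by rewrite lt_min invr_gt0 C0 divr_gt0.
move=> z c' zr cr; apply: he.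
have dE : `|row_mx z c' - row_mx (b x) c| < Num.min C^-1 (e / K).
  rewrite opp_row_mx add_row_mx.
  have m0 : 0 < Num.min C^-1 (e / K) by exact: le_lt_trans zr.
  apply: (@le_lt_trans _ _ (Num.max `|z - b x| `|c' - c|)).
    apply: norm_le_coord => [|i j]; first by rewrite le_max normr_ge0.
    case: (split_ordP j) => k ->; rewrite ?row_mxEl ?row_mxEr le_max coord_le_norm//.
    by rewrite orbT.
  by rewrite gt_max zr cr.
have zz : `|row_mx (b x) c - row_mx (b x) c| < C^-1.
  by rewrite subrr normr0 invr_gt0.
have [_ _ /(_ (row_mx z c'))] := hC _ zz.
move: dE; rewrite lt_min => /andP[dC de] /(_ dC)[_ jC _].
rewrite -mulmxBr; apply: (le_lt_trans (mulmx_norm _ _)).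
apply: (@le_lt_trans _ _ (K * `|row_mx z c' - row_mx (b x) c|)).
  apply: (@le_trans _ _ ((d + d)%:R * `|h| * (C * `|row_mx z c' - row_mx (b x) c|))).
    by rewrite ler_wpM2l.
  by rewrite mulrA ler_wpM2r// lerDl.
by rewrite mulrC -ltr_pdivlMr.
Qed.

Lemma common_radius (I : eqType) (s : seq I) (r : I -> R) :
  (forall i, i \in s -> 0 < r i) ->
  exists2 e : R, 0 < e & forall i, i \in s -> e <= r i.
Proof.
elim: s => [|i s IH] h; first by exists 1.
have [e e0 he] : exists2 e : R, 0 < e & forall i, i \in s -> e <= r i.
  by apply: IH => j js; apply: h; rewrite inE js orbT.
exists (Num.min (r i) e) => [|j].
  by rewrite lt_min e0 h// inE eqxx.
rewrite inE => /predU1P[->|/he]; first by rewrite ge_min lexx.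
by rewrite ge_min => ->; rewrite orbT.
Qed.

Lemma norm_loc_lip n (c : 'rV[R]_n) :
  loc_lip (fun c1 c2 : 'rV[R]_n => `|c1 - c2|) ((fun c => `|c|) : _ -> R^o) c.
Proof.
exists 1, setT; split => //; first exact: filterT.
by move=> y z _ _; rewrite mul1r; exact: ler_dist_dist.
Qed.

(** Finitely many constant directions serve the compact unit sphere of fibre coordinates. They are
    summed with cut-off weights that depend on the direction of c only and extended by homogeneity
    through [fibre_scaling]; the sum stays positive because positive forms are a cone. *)
Lemma exists_local_field b x : atlas b -> chart_dom b x ->
  exists Y r, local_field b x Y r.
Proof.
move=> ab bx.
have /choice[h /choice[r hr]] : forall m : 'rV[R]_d, exists (h : 'rV[R]_(d + d)) (r : R),
    m != 0 -> 0 < r /\ forall z c', `|z - b x| < r -> `|c' - m| < r ->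
    positive (uncoords (h *m jac (frame_row b x) (row_mx z c')) : Q).
  move=> m; have [->|m0] := eqVneq m 0; first by exists 0, 0.
  by have [h [r H]] := constant_direction ab bx m0; exists h, r.
have S0 (m : 'rV[R]_d) : `|m| = 1 -> m != 0.
  by move=> m1; rewrite -normr_eq0 m1 oner_eq0.
have [m m1|s [sS scov]] := @compact_finite_cover _ _
    (fun m : 'rV[R]_d => [set c | `|c - m| < r m]) (@sphere_compact R d).
  by apply/near_rV; exists (r m) => //; have [] := hr m (S0 m m1).
have [m ms|e1 e10 he1] := @common_radius _ s r.
  by have [] := hr m (S0 m (sS m ms)).
have /near_rV[e2 e20 he2] := near_chart_ok ab bx.
pose e := Num.min e1 e2; have e0 : 0 < e by rewrite lt_min e10.
have e4 z : `|z - b x| <= 3 * (e / 4) -> `|z - b x| < e.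
  by move=> /le_lt_trans; apply; have := e0; lra.
pose w m (c : 'rV[R]_d) := cutoff (r m) `| `|c|^-1 *: c - m|.
have unit (c : 'rV[R]_d) : c != 0 -> `| `|c|^-1 *: c| = 1.
  by move=> c0; rewrite normrZ normfV normr_id mulVf// normr_eq0.
(* The radius [e / 4] leaves room for the factor 3 in [local_field]. *)
exists (fun c => \sum_(m <- s) w m c *: (h m *m fibre_scaling `|c|)), (e / 4).
split.
- by rewrite divr_gt0.
- by move=> z /e4; rewrite lt_min => /andP[_ /he2].
- move=> t c t0; rewrite mulmx_suml.
  have nE : `|t *: c| = `|c| * t by rewrite normrZ gtr0_norm// mulrC.
  have cE : (`|c| * t)^-1 *: (t *: c) = `|c|^-1 *: c.
    by rewrite scalerA invfM -mulrA mulVf ?mulr1// gt_eqF.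
  apply: eq_bigr => m _.
  by rewrite -scalemxAl -mulmxA fibre_scalingM /w nE cE.
- move=> c c0.
  have small := @rV_dist_small R d c.
  apply: loc_lip_sum => m; apply: loc_lip_scale => //.
    apply: (@loc_lip_comp _ _ _ _ 'rV[R]_d R^o _ (fun a => cutoff (r m) `|a - m|) 1) => //.
      move=> a a'; rewrite mul1r; apply: (le_trans (cutoff_lip _ _ _)).
      apply: (le_trans (ler_dist_dist _ _)).
      by rewrite opprB addrA subrK.
    apply: loc_lip_scale => //; last first.
      exists 1, setT; split => //; first exact: filterT.
      by move=> y z _ _; rewrite mul1r.
    apply: loc_lip_inv => //; first by rewrite normr_gt0.
    exact: norm_loc_lip.
  apply: (@loc_lip_near _ _ _ _ _ (fun c => row_mx (lsubmx (h m)) 0 +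
      `|c| *: row_mx 0 (rsubmx (h m)))).
    near=> y; rewrite mulmx_fibre_scaling scale_row_mx add_row_mx.
    by rewrite scaler0 addr0 add0r.
  apply: loc_lip_add => //; first exact: loc_lip_cst.
  apply: loc_lip_scale => //; first exact: norm_loc_lip.
  exact: loc_lip_cst.
- move=> z c /e4 ze c0; have n0 : 0 < `|c| by rewrite normr_gt0.
  move: (ze); rewrite lt_min => /andP[ze1 /he2 okz].
  have cE : c = `|c| *: (`|c|^-1 *: c) by rewrite scalerA divff ?scale1r ?gt_eqF.
  have jE : fibre_scaling `|c| *m jac (frame_row b x) (row_mx z c) =
      `|c| *: jac (frame_row b x) (row_mx z (`|c|^-1 *: c)).
    have := jac_scaled (`|c|^-1 *: c) n0 okz; rewrite -cE; exact.
  rewrite mulmx_suml linear_sum /=.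
  rewrite (eq_bigr (fun m => (w m c * `|c|) *: uncoords (h m *m
      jac (frame_row b x) (row_mx z (`|c|^-1 *: c))))); last first.
    by move=> m _; rewrite -scalemxAl -mulmxA jE -scalemxAr !linearZ /= scalerA.
  apply: positive_sum => [m ms|m ms|].
  + by rewrite mulr_ge0// ?cutoff_ge0 ?ltW.
  + rewrite pmulr_lgt0// cutoff_gt0 => cm.
    have [_] := hr m (S0 m (sS m ms)); apply => //.
    by apply: (lt_le_trans ze1); exact: he1.
  + have [m ms cm] := scov _ (unit c c0); exists m => //.
    by rewrite pmulr_lgt0// cutoff_gt0.
Unshelve. all: by end_near. Qed.

End Frames.

(** * The invariant field and its flow *)

(* The patch (b, x, g, s) stands for the coordinates [kap] on the punctured bundle
   sending (y, q) to b (g^-1 y) and to the coordinates in u x of e^-s rho(g)^-1 q.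
   Then the change of coordinates [tau p p'] depends only on g'^-1 g and s - s',
   which is what makes the field below invariant. *)
Record patch (R : realType) d (M : topologicalType) (G : Type) := Patch {
  pchart : chart R d M; pcenter : M; pelt : G; pscale : R }.

Section InvariantFlow.
Context (R : realType) (V : vectType R) (d : nat) (M : manifold R d).
Context (G : groupType) (act : G -> M -> M) (rho : G -> 'End(V)).
Context (u : M -> {vspace qform V}).
Hypothesis actP : smooth_action act.
Hypothesis rho1 : rho 1%g = \1%VF.
Hypothesis rhoM : forall g h, rho (g * h)%g = (rho g \o rho h)%VF.
Hypothesis eqv : equivariant act rho u.
Hypothesis fit : fitting_immersion u.

Local Notation Q := (qform V).
Local Notation N := (punctured_bundle u).
Local Notation ell := (ell fit).
Local Notation frame := (frame u).
Local Notation good := (good u).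
Local Notation patch := (patch R d M G).
Implicit Types (p : patch) (e : N).

Let act1 x : act 1%g x = x. Proof. by have [] := actP. Qed.
Let actMul g h x : act (g * h)%g x = act g (act h x).
Proof. by have [] := actP. Qed.
Lemma actK g : cancel (act g) (act g^-1%g).
Proof. by move=> x; rewrite -actMul mulVg act1. Qed.
Lemma actKV g : cancel (act g^-1%g) (act g).
Proof. by move=> x; rewrite -actMul mulgV act1. Qed.
Let act_cont g : continuous (act g).
Proof. by have [_ _ /(_ g)[]] := actP. Qed.

Lemma rhoK g v : rho g^-1%g (rho g v) = v.
Proof. by rewrite -[LHS]comp_lfunE -rhoM mulVg rho1 id_lfunE. Qed.

Lemma rhoKV g v : rho g (rho g^-1%g v) = v.
Proof. by rewrite -[LHS]comp_lfunE -rhoM mulgV rho1 id_lfunE. Qed.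

Lemma rho_inv g : ((rho g)^-1)%VF = rho g^-1%g.
Proof.
have k0 : lker (rho g) == 0%VS.
  by apply/lker0P => v w vw; rewrite -(rhoK g v) vw rhoK.
by apply/lfunP => v; rewrite -{1}(rhoKV g v) lker0_lfunK.
Qed.

Definition scaled_act g (s : R) : 'End(Q) := expR s *: act_form (rho g).

Lemma scaled_actE g s q v w : qeval (scaled_act g s q) v w =
  expR s * qeval q (rho g^-1%g v) (rho g^-1%g w).
Proof. by rewrite /scaled_act scale_lfunE qevalZ act_formE rho_inv. Qed.

Lemma scaled_actM g h s t q :
  scaled_act g s (scaled_act h t q) = scaled_act (g * h)%g (s + t) q.
Proof.
apply: qeval_ext => v w; rewrite !scaled_actE invgM rhoM !comp_lfunE expRD.
by rewrite mulrA.
Qed.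

Lemma scaled_act1 q : scaled_act 1%g 0 q = q.
Proof.
by apply: qeval_ext => v w; rewrite scaled_actE invg1 rho1 !id_lfunE expR0 mul1r.
Qed.

Lemma scaled_actK g s q : scaled_act g^-1%g (- s) (scaled_act g s q) = q.
Proof. by rewrite scaled_actM mulVg addNr scaled_act1. Qed.

Lemma scaled_actKV g s q : scaled_act g s (scaled_act g^-1%g (- s) q) = q.
Proof. by rewrite scaled_actM mulgV subrr scaled_act1. Qed.

Lemma scaled_act_positive g s q : positive q -> positive (scaled_act g s q).
Proof.
move=> qp v v0; rewrite scaled_actE mulr_gt0 ?expR_gt0// qp// => gv.
by apply: v0; rewrite -(rhoKV g v) gv linear0.
Qed.

Lemma scaled_act_mem g s q x : q \in u x -> scaled_act g s q \in u (act g x).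
Proof. by move=> qx; rewrite scale_lfunE eqv memvZ// memv_img. Qed.

Lemma scaled_act_eq0 g s q : scaled_act g s q = 0 -> q = 0.
Proof. by move=> q0; rewrite -(scaled_actK g s q) q0 linear0. Qed.

(** * Coordinates on the punctured bundle *)

Lemma near_N (e : N) (A : set N) : nbhs e A <->
  exists2 U, nbhs (val e).1 U & exists2 r : R, 0 < r &
    forall e' : N, U (val e').1 ->
      `|coords (val e').2 - coords (val e).2| < r -> A e'.
Proof.
split.
  move/(@nbhs_initial _ _ (set_val : N -> _)) => [B [[U W] /= [Ue We] UW] BA].
  exists U => //.
  have /(@nbhs_initial _ _ (@coords R Q))[C /near_rV[r r0 hr] CW] := We.
  exists r => // e' Ue' ee'; apply: BA; apply: UW; split => //=.
  by apply: CW; exact: hr.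
move=> [U Ue [r r0 h]]; apply/(@nbhs_initial _ _ (set_val : N -> _)).
exists (U `*` [set q : Q | `|coords q - coords (val e).2| < r]).
  exists (U, [set q : Q | `|coords q - coords (val e).2| < r]) => //; split => //.
  apply/(@nbhs_initial _ _ (@coords R Q)).
  exists [set k | `|k - coords (val e).2| < r] => //.
  by apply/near_rV; exists r.
by move=> e' /= [Ue' re']; exact: h.
Qed.

Lemma mem_N (e : N) : (val e).2 \in u (val e).1 /\ (val e).2 <> 0.
Proof. by case: e => /= e /set_mem. Qed.

Lemma base_continuous (e : N) : {for e, continuous (fun e' : N => (val e').1)}.
Proof. by move=> A Ae; apply/near_N; exists A => //; exists 1. Qed.

Lemma fibre_continuous (e : N) :
  {for e, continuous (fun e' : N => coords (val e').2)}.
Proof.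
apply/continuous_rV => r r0; apply/near_N; exists setT; first exact: filterT.
by exists r.
Qed.

Lemma continuous_N (T : topologicalType) (f : T -> N) (t : T) :
  {for t, continuous (fun t' => (val (f t')).1)} ->
  {for t, continuous (fun t' => coords (val (f t')).2)} ->
  {for t, continuous f}.
Proof.
move=> c1 /continuous_rV c2 A /near_N[U /c1 Ut [r r0 h]].
suff : nbhs t (f @^-1` A) by [].
have Ut' : nbhs t [set t' | U (val (f t')).1] by exact: Ut.
have Ct' : nbhs t [set t' | `|coords (val (f t')).2 - coords (val (f t)).2| < r].
  exact: c2.
by apply: filterS (filterI Ut' Ct') => t' [a b]; exact: h.
Qed.

Lemma bundle_hausdorff : hausdorff_space N.
Proof.
rewrite open_hausdorff => e e' ee'.
have [xx|xx] := eqVneq (val e).1 (val e').1; last first.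
  have := @manifold_hausdorff R d M; rewrite open_hausdorff.
  move=> /(_ _ _ xx)[[A B] /= [Ae Be'] [oA oB AB]].
  have op (U : set M) : open U -> open [set e : N | U (val e).1].
    move=> oU; rewrite openE => f /= Uf; apply/near_N; exists U; last by exists 1.
    exact: open_nbhs_nbhs.
  exists ([set e : N | A (val e).1], [set e : N | B (val e).1]).
    by rewrite !inE in Ae Be' *.
  split; [exact: op|exact: op|apply/eqP/seteqP; split => // f [/= Af Bf]].
  by move/eqP/seteqP : AB => [AB _]; apply: (AB (val f).1).
have qq : coords (val e).2 != coords (val e').2.
  apply: contra ee' => /eqP/(can_inj (@coordsK _ _)) qq; apply/eqP/val_inj.
  by move: xx qq; case: (val e) => a b; case: (val e') => a' b' /= -> ->.
pose r := `|coords (val e).2 - coords (val e').2| / 2.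
have r0 : 0 < r by rewrite divr_gt0// normr_gt0 subr_eq0.
have op (k : 'rV[R]_(\dim {:Q})) : open [set e : N | `|coords (val e).2 - k| < r].
  rewrite openE => f /= fr; apply/near_N; exists setT; first exact: filterT.
  exists (r - `|coords (val f).2 - k|); first by rewrite subr_gt0.
  move=> f' _ ff' /=; rewrite -(subrKA (coords (val f).2)).
  by apply: (le_lt_trans (ler_normD _ _)); rewrite -ltrBrDr.
exists ([set f : N | `|coords (val f).2 - coords (val e).2| < r],
        [set f : N | `|coords (val f).2 - coords (val e').2| < r]).
  by rewrite !inE /= !subrr !normr0.
split; [exact: op|exact: op|apply/eqP/seteqP; split => // f [/= h1 h2]].
have : `|coords (val e).2 - coords (val e').2| < r + r.
  rewrite -(subrKA (coords (val f).2)); apply: (le_lt_trans (ler_normD _ _)).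
  by rewrite ltrD// distrC.
by rewrite /r -splitr ltxx.
Qed.

Definition dom p : set N :=
  [set e | good (pchart p) (pcenter p) (act (pelt p)^-1%g (val e).1)].

Definition kap p (e : N) : 'rV[R]_(d + d) :=
  row_mx (pchart p (act (pelt p)^-1%g (val e).1))
    (ell (pcenter p) (scaled_act (pelt p)^-1%g (- pscale p) (val e).2)).

Definition param p (y : 'rV[R]_(d + d)) : Q :=
  scaled_act (pelt p) (pscale p)
    (frame (pchart p) (pcenter p) (lsubmx y) (rsubmx y)).

(** [e0] is a default value for those y that give no point of the bundle; by [near_kinv] it is never
    reached near actual coordinates. *)
Definition kinv (e0 : N) p (y : 'rV[R]_(d + d)) : N :=
  insubd e0 (act (pelt p) (chart_inv (pchart p) (lsubmx y)), param p y).

Definition tau p p' (y : 'rV[R]_(d + d)) : 'rV[R]_(d + d) :=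
  row_mx (pchart p' (act ((pelt p')^-1 * pelt p)%g
      (chart_inv (pchart p) (lsubmx y))))
    (ell (pcenter p') (scaled_act ((pelt p')^-1 * pelt p)%g (pscale p - pscale p')
      (frame (pchart p) (pcenter p) (lsubmx y) (rsubmx y)))).

Lemma dom_open p : open (dom p).
Proof.
rewrite openE => e de; have [_ _ /(_ (pelt p)^-1%g)[ac _]] := actP.
have n1 : nbhs (act (pelt p)^-1%g (val e).1) (good (pchart p) (pcenter p)).
  by apply: open_nbhs_nbhs; split => //; exact: good_open.
exact: base_continuous (ac _ _ n1).
Qed.

Lemma pre_mem p (e : N) : scaled_act (pelt p)^-1%g (- pscale p) (val e).2 \in
   u (act (pelt p)^-1%g (val e).1).
Proof. by have [qx _] := mem_N e; exact: scaled_act_mem. Qed.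

Lemma chart_pre p (e : N) : dom p e ->
  chart_inv (pchart p) (pchart p (act (pelt p)^-1%g (val e).1)) =
  act (pelt p)^-1%g (val e).1.
Proof. by move=> /good_sub[_ _ h _ _]; exact: chart_funK. Qed.

Lemma frame_kap p (e : N) : dom p e ->
  frame (pchart p) (pcenter p) (lsubmx (kap p e)) (rsubmx (kap p e)) =
  scaled_act (pelt p)^-1%g (- pscale p) (val e).2.
Proof.
move=> de; have /good_sub[_ _ _ tr _] := de.
have zE := chart_pre de.
have tr' : (u (chart_inv (pchart p) (pchart p (act (pelt p)^-1%g (val e).1)))
    :&: (u (pcenter p))^C = 0)%VS by rewrite zE.
rewrite row_mxKl row_mxKr; apply: (frame_ell fit tr').
by rewrite zE; exact: pre_mem.
Qed.

Lemma param_kap p (e : N) : dom p e -> param p (kap p e) = (val e).2.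
Proof. by move=> de; rewrite /param frame_kap// scaled_actKV. Qed.

Lemma kapK e0 p (e : N) : dom p e -> kinv e0 p (kap p e) = e.
Proof.
move=> de; apply: val_inj; rewrite /kinv param_kap// row_mxKl chart_pre//.
rewrite actKV -surjective_pairing insubdK//; exact: valP.
Qed.

Lemma kinv_spec e0 p y x : good (pchart p) (pcenter p) x ->
  pchart p x = lsubmx y -> rsubmx y != 0 ->
  [/\ val (kinv e0 p y) = (act (pelt p) x, param p y), dom p (kinv e0 p y) &
      kap p (kinv e0 p y) = y].
Proof.
move=> gx bx y0; have [_ _ dx tr _] := good_sub gx.
have ix : chart_inv (pchart p) (lsubmx y) = x by rewrite -bx chart_funK.
have tr' : (u (chart_inv (pchart p) (lsubmx y)) :&: (u (pcenter p))^C = 0)%VS.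
  by rewrite ix.
have vE : val (kinv e0 p y) = (act (pelt p) x, param p y).
  rewrite /kinv ix insubdK//; apply/mem_set; split => /=.
    apply: scaled_act_mem; rewrite -[in u _]ix; exact: (frame_mem fit tr').
  move=> /scaled_act_eq0 f0; move/eqP: y0; apply.
  by rewrite -[rsubmx y](ell_frame fit tr') f0 linear0.
have dk : dom p (kinv e0 p y) by rewrite /dom /= vE /= actK.
split => //; rewrite /kap vE /= actK bx scaled_actK.
by rewrite (ell_frame fit tr') hsubmxK.
Qed.

Lemma tau_kap p p' (e : N) : dom p e -> tau p p' (kap p e) = kap p' e.
Proof.
move=> de; rewrite /tau frame_kap//.
have -> : lsubmx (kap p e) = pchart p (act (pelt p)^-1%g (val e).1).
  by rewrite row_mxKl.
rewrite chart_pre//.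
have [_ aM _] := actP; rewrite -aM -mulgA mulgV mulg1.
by rewrite scaled_actM -mulgA mulgV mulg1 addrAC subrr add0r.
Qed.

Lemma kap_continuous p (e : N) : dom p e -> {for e, continuous (kap p)}.
Proof.
move=> de; apply/continuous_rV => r r0.
have [_ _ /(_ (pelt p)^-1%g)[ac _]] := actP.
have /good_sub[_ _ db _ _] := de.
have cx : {for e, continuous (fun e' : N => pchart p (act (pelt p)^-1%g (val e').1))}.
  apply: (@continuous_comp _ _ _ (fun e' : N => act (pelt p)^-1%g (val e').1)).
    apply: (@continuous_comp _ _ _ (fun e' : N => (val e').1)).
      exact: base_continuous.
    exact: ac.
  exact: chart_fun_continuous.
pose f (k : 'rV[R]_(\dim {:Q})) := ell (pcenter p)
   (scaled_act (pelt p)^-1%g (- pscale p) (uncoords k)).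
have fl : linear f by move=> c k l; rewrite /f !linearP.
have [A fA] := linear_mulmx fl.
have /continuous_rV/(_ _ r0) := cx.
have rA : 0 < r / ((\dim {:Q})%:R * `|A| + 1).
  by rewrite divr_gt0// ltr_wpDl// mulr_ge0.
have /continuous_rV/(_ _ rA) := @fibre_continuous e.
move=> h1 h2; apply: filterS (filterI h1 h2) => e' [a b].
rewrite /kap opp_row_mx add_row_mx.
apply: (@le_lt_trans _ _ (Num.max
   `|pchart p (act (pelt p)^-1%g (val e').1) - pchart p (act (pelt p)^-1%g (val e).1)|
   `|f (coords (val e').2) - f (coords (val e).2)|)).
  apply: norm_le_coord => [|i j]; first by rewrite le_max normr_ge0.
  rewrite mxE le_max /f !coordsK; case: splitP => k _.
    by rewrite coord_le_norm.
  by rewrite orbC coord_le_norm.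
rewrite gt_max b !fA -mulmxBl; apply: (le_lt_trans (mulmx_norm _ _)).
rewrite mulrAC; apply: (@le_lt_trans _ _ (((\dim {:Q})%:R * `|A| + 1) *
   `|coords (val e').2 - coords (val e).2|)).
  by rewrite ler_wpM2r// lerDl.
by rewrite mulrC -ltr_pdivlMr// ltr_wpDl// mulr_ge0.
Qed.

Lemma lsub_kap p (e : N) : lsubmx (kap p e) = pchart p (act (pelt p)^-1%g (val e).1).
Proof. exact: row_mxKl. Qed.

Lemma dom_c11 p (e : N) : dom p e -> forall i k,
  c11 (fun z => coords (frame (pchart p) (pcenter p) z (delta_mx 0 i)) 0 k)
    (lsubmx (kap p e)).
Proof. by move=> /good_sub[_ _ _ _ h] i k; rewrite lsub_kap. Qed.

Lemma param_c11 p (e : N) : dom p e -> c11v (fun y => coords (param p y)) (kap p e).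
Proof.
move=> /dom_c11 h.
apply: (@frame_c11 _ _ _ _ _ _ _ _ (fun q => coords (scaled_act (pelt p) (pscale p) q))) => //.
by move=> c x y; rewrite !linearP.
Qed.

(** The base half is the action of a group element read in two charts, smooth by hypothesis. The
    fibre half is a fixed linear map applied to the frame, because [ell] does not vary with the base
    point. *)
Lemma tau_c11 p p' (e : N) : dom p e -> dom p' e -> c11v (tau p p') (kap p e).
Proof.
move=> de de' j; case: (split_ordP j) => i ->.
  rewrite (_ : (fun y => _) = fun y : 'rV[R]_(d + d) => pchart p'
     (act ((pelt p')^-1 * pelt p)%g (chart_inv (pchart p) (lsubmx y))) 0 i); last first.
    by apply/funext => y; rewrite row_mxEl.
  have [A hA] := lsubmx_mulmx R d d.
  rewrite (_ : (fun y => _) = fun y : 'rV[R]_(d + d) => pchart p'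
     (act ((pelt p')^-1 * pelt p)%g (chart_inv (pchart p) (y *m A))) 0 i); last first.
    by apply/funext => y; rewrite hA.
  apply: (@c11_comp_linear _ _ _ A (fun z => pchart p'
     (act ((pelt p')^-1 * pelt p)%g (chart_inv (pchart p) z)) 0 i)).
  rewrite -hA lsub_kap.
  have [a1 _ b1 _ _] := good_sub de; have [a2 _ b2 _ _] := good_sub de'.
  have [_ aM /(_ ((pelt p')^-1 * pelt p)%g)[_ sm]] := actP.
  have aE : act ((pelt p')^-1 * pelt p)%g (act (pelt p)^-1%g (val e).1) =
      act (pelt p')^-1%g (val e).1.
    by rewrite -aM -mulgA mulgV mulg1.
  rewrite -aE in b2.
  have /smooth_c11/nbhs_singleton h := sm _ _ _ a1 a2 b1 b2.
  rewrite (_ : (fun z => _) = fun z => \sum_k coords (pchart p'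
     (act ((pelt p')^-1 * pelt p)%g (chart_inv (pchart p) z))) 0 k *
     ((vbasis {: 'rV[R]_d})`_k) 0 i); last first.
    by apply/funext => z; rewrite -coords_entry.
  by apply: c11_sum => k; apply: c11_mul; [exact: h|exact: c11_cst].
rewrite (_ : (fun y => _) = fun y : 'rV[R]_(d + d) => ell (pcenter p')
  (scaled_act ((pelt p')^-1 * pelt p)%g (pscale p - pscale p')
    (frame (pchart p) (pcenter p) (lsubmx y) (rsubmx y))) 0 i); last first.
  by apply/funext => y; rewrite row_mxEr.
apply: (@frame_c11 _ _ _ _ _ _ _ _ (fun q => ell (pcenter p')
   (scaled_act ((pelt p')^-1 * pelt p)%g (pscale p - pscale p') q))); last exact: dom_c11.
by move=> c x y; rewrite !linearP.
Qed.

Lemma rsub_kap p (e : N) : dom p e -> rsubmx (kap p e) != 0.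
Proof.
move=> de; apply/eqP => r0; have [_] := mem_N e; apply.
by rewrite -(param_kap de) /param r0 !linear0.
Qed.

Lemma near_kap p (e : N) : dom p e -> \forall y \near kap p e,
  [/\ good (pchart p) (pcenter p) (chart_inv (pchart p) (lsubmx y)),
      pchart p (chart_inv (pchart p) (lsubmx y)) = lsubmx y &
      rsubmx y != 0].
Proof.
move=> de; have [_ _ db _ _] := good_sub de.
set x := act _ _ in db.
have n1 : nbhs (kap p e) [set y | good (pchart p) (pcenter p)
    (chart_inv (pchart p) (lsubmx y))].
  have gx : nbhs x (good (pchart p) (pcenter p)).
    by apply: open_nbhs_nbhs; split => //; exact: good_open.
  have := chart_inv_continuous db; rewrite -[pchart p x](lsub_kap p e).
  have ix : chart_inv (pchart p) (lsubmx (kap p e)) = x.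
    by rewrite lsub_kap chart_funK.
  rewrite /prop_for /continuous_at ix => /(_ _ gx) h.
  exact: (@lsubmx_continuous _ _ _ (kap p e) _ h).
have n2 : nbhs (kap p e) [set y | ((pchart p : M -> _) @` chart_dom (pchart p)) (lsubmx y)].
  apply: (@lsubmx_continuous _ _ _ (kap p e)); apply: open_nbhs_nbhs.
  by split; [exact: chart_cod_open|rewrite lsub_kap; exists x].
have n3 : nbhs (kap p e) [set y | rsubmx y != 0].
  have r0 := rsub_kap de; rewrite -normr_gt0 in r0.
  have /continuous_rV/(_ _ r0) := @rsubmx_continuous R d d (kap p e).
  apply: filterS => y h; apply: contraTneq h => ->.
  by rewrite sub0r normrN ltxx.
apply: filterS (filterI n1 (filterI n2 n3)) => y [h1 [[x' dx' x'E] h3]].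
by split => //; rewrite -x'E chart_funK.
Qed.

Section Transitions.
Context (e0 : N).

Lemma near_kinv p (e : N) : dom p e -> \forall y \near kap p e,
  [/\ val (kinv e0 p y) = (act (pelt p) (chart_inv (pchart p) (lsubmx y)), param p y),
      dom p (kinv e0 p y) & kap p (kinv e0 p y) = y].
Proof.
move=> /near_kap; apply: filterS => y [h1 h2 h3].
exact: (kinv_spec e0 h1 h2 h3).
Qed.

Lemma kinv_continuous p (e : N) : dom p e ->
  {for kap p e, continuous (kinv e0 p)}.
Proof.
move=> de; have nk := near_kinv de; have [_ _ db _ _] := good_sub de.
apply: continuous_N.
  have c1 : {for kap p e, continuous (fun y => act (pelt p)
     (chart_inv (pchart p) (lsubmx y)))}.
    apply: (@continuous_comp _ _ _ (fun y => chart_inv (pchart p) (lsubmx y))).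
      apply: (@continuous_comp _ _ _ (@lsubmx R 1 d d)).
        exact: lsubmx_continuous.
      by rewrite lsub_kap; exact: chart_inv_continuous.
    by have [_ _ /(_ (pelt p))[ac _]] := actP; exact: ac.
  have E : \forall y \near kap p e, act (pelt p) (chart_inv (pchart p) (lsubmx y)) =
      (val (kinv e0 p y)).1.
    by move: nk; apply: filterS => y [-> _ _].
  rewrite /prop_for /continuous_at -(nbhs_singleton E).
  by apply: cvg_trans c1; exact: near_eq_cvg E.
have c2 := c11v_continuous (param_c11 de).
have E : \forall y \near kap p e, coords (param p y) = coords (val (kinv e0 p y)).2.
  by move: nk; apply: filterS => y [-> _ _].
rewrite /prop_for /continuous_at -(nbhs_singleton E).
by apply: cvg_trans c2; exact: near_eq_cvg E.
Qed.

Lemma near_dom p p' (e : N) : dom p e -> dom p' e ->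
  \forall y \near kap p e, dom p' (kinv e0 p y).
Proof.
move=> de de'; have c := kinv_continuous de.
have : nbhs (kinv e0 p (kap p e)) (dom p').
  rewrite kapK//.
  by apply: open_nbhs_nbhs; split => //; exact: dom_open.
by move=> /c.
Qed.

(** The chain rule: every y near [kap p e] is [kap p f] for some f in the domains of p and p', where
    the coordinate changes compose. *)
Lemma jac_tau_cocycle p p' p'' (e : N) : dom p e -> dom p' e -> dom p'' e ->
  jac (tau p p'') (kap p e) =
  jac (tau p p') (kap p e) *m jac (tau p' p'') (kap p' e).
Proof.
move=> de de' de''; apply: has_jacE.
have tk q q' (f : N) (df : dom q f) := tau_kap q' df.
apply: (has_jac_near (f := fun y => tau p' p'' (tau p p' y))).
  apply: filterS (filterI (near_kinv de) (near_dom de de')) => y [[_ + +] +].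
  move: (kinv e0 p y) => f h1 <- h3.
  by rewrite (tk _ _ _ h1) (tk _ _ _ h3) (tk _ _ _ h1).
apply: has_jac_comp; first exact/c11v_jac/tau_c11.
by rewrite (tk p p')//; exact/c11v_jac/tau_c11.
Qed.

Lemma jac_param_cocycle p p' (e : N) : dom p e -> dom p' e ->
  jac (fun y => coords (param p y)) (kap p e) =
  jac (tau p p') (kap p e) *m jac (fun y => coords (param p' y)) (kap p' e).
Proof.
move=> de de'; apply: has_jacE.
have tk q q' (f : N) (df : dom q f) := tau_kap q' df.
have pk q (f : N) (df : dom q f) := param_kap df.
apply: (has_jac_near (f := fun y => coords (param p' (tau p p' y)))).
  apply: filterS (filterI (near_kinv de) (near_dom de de')) => y [[_ + +] +].
  move: (kinv e0 p y) => f h1 <- h3.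
  by rewrite (tk _ _ _ h1) (pk _ _ h3) (pk _ _ h1).
apply: (@has_jac_comp _ _ _ _ (tau p p') (fun y => coords (param p' y))).
  exact/c11v_jac/tau_c11.
by rewrite (tk p p')//; exact/c11v_jac/param_c11.
Qed.

End Transitions.

(** * Group elements and scalings acting on patches *)

Lemma moved_mem h (s : R) e :
  (act h (val e).1, scaled_act h s (val e).2) \in punctured_bundle u.
Proof.
apply/mem_set; have [qx q0] := mem_N e; split; first exact: scaled_act_mem.
by move=> /scaled_act_eq0.
Qed.

Definition act_bundle h (s : R) (e : N) : N :=
  insubd e (act h (val e).1, scaled_act h s (val e).2).

Lemma val_act_bundle h s e :
  val (act_bundle h s e) = (act h (val e).1, scaled_act h s (val e).2).
Proof. by rewrite insubdK//; exact: moved_mem. Qed.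

(** A patch is transported together with its coordinates: a point and its image have the same ones,
    so invariance of a field becomes equality of components. *)
Definition move_patch h (s : R) p : patch :=
  Patch (pchart p) (pcenter p) (h * pelt p)%g (s + pscale p).

Let act_back h g y : act (h * g)^-1%g (act h y) = act g^-1%g y.
Proof. by have [_ aM _] := actP; rewrite -aM invgM mulgVK. Qed.

Lemma dom_move h s p e : dom (move_patch h s p) (act_bundle h s e) = dom p e.
Proof. by rewrite /dom/= /mkset val_act_bundle/= act_back. Qed.

Lemma kap_move h s p e : kap (move_patch h s p) (act_bundle h s e) = kap p e.
Proof.
rewrite /kap/= val_act_bundle/= act_back scaled_actM invgM mulgVK.
by rewrite (_ : - (s + pscale p) + s = - pscale p)//; ring.
Qed.

Lemma tau_move h s p p' : tau (move_patch h s p) (move_patch h s p') = tau p p'.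
Proof.
apply/funext => y; rewrite /tau/=.
have -> : ((h * pelt p')^-1 * (h * pelt p) = (pelt p')^-1 * pelt p)%g.
  by rewrite invgM -mulgA mulKg.
by have -> : s + pscale p - (s + pscale p') = pscale p - pscale p' by ring.
Qed.

(* The scale of a patch can be chosen so that a given form has a unit vector as
   coordinates: this reduces [uniform_time] to a compact set. *)
Definition rescale s p : patch :=
  Patch (pchart p) (pcenter p) (pelt p) (pscale p - s).

Lemma kap_rescale s p e :
  kap (rescale s p) e = kap p e *m fibre_scaling d (expR s).
Proof.
rewrite mulmx_fibre_scaling /kap/= row_mxKl row_mxKr; congr row_mx.
rewrite -linearZ /=; congr ell.
by apply: qeval_ext => v w; rewrite qevalZ !scaled_actE mulrA -expRD opprB.
Qed.

Lemma jac_tau_rescale s p e : dom p e ->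
  jac (tau p (rescale s p)) (kap p e) = fibre_scaling d (expR s).
Proof.
move=> de; apply: has_jacE.
apply: (has_jac_near (f := fun y => y *m fibre_scaling d (expR s)));
  last exact: has_jac_linear.
apply: filterS (near_kinv e de) => y [_ dy ky].
have := tau_kap (rescale s p) dy.
by rewrite kap_rescale ky.
Qed.

(** Isolates a change of scale of p, to be cancelled by the homogeneity of a local field. *)
Lemma jac_tau_split s p p' e : dom p e -> dom p' e ->
  jac (tau p p') (kap p e) =
  fibre_scaling d (expR s) *m jac (tau (rescale s p) p') (kap (rescale s p) e).
Proof.
move=> de de'; have ds : dom (rescale s p) e by [].
rewrite -(jac_tau_rescale s de).
exact: (jac_tau_cocycle e de ds de').
Qed.

(** * Solutions of an invariant positive field *)

Section SolutionCurves.
Context (X : patch -> N -> 'rV[R]_(d + d)).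
Hypothesis X_move : forall h s p (e : N), dom p e ->
  X (move_patch h s p) (act_bundle h s e) = X p e.
Hypothesis X_positive : forall p (e : N), dom p e -> positive (uncoords
  (X p e *m jac (fun y => coords (param p y)) (kap p e)) : Q).

Local Notation solution := (solution (fun p => dom p : set N) kap X setT).

Lemma solution_act_bundle h s (g : R -> N) : solution g ->
  solution (fun t => act_bundle h s (g t)).
Proof.
move=> sg t _; have [p [C [c [c0 C0 H]]]] := sg t I.
exists (move_patch h s p), C, c; split => // t1 t2 h1 h2.
have [dp a1 a2] := H _ _ h1 h2.
by rewrite dom_move !kap_move X_move.
Qed.

(** For fixed v, the value of the moving form at (v, v) has as slope the value at (v, v) of its
    derivative along X, which is positive. *)
Lemma solution_positive (g : R -> N) : solution g ->
  forall t, 0 < t -> positive ((val (g t)).2 - (val (g 0)).2).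
Proof.
move=> sg t t0 v v0.
pose f t := qeval (val (g t)).2 v v.
suff : f 0 < f t.
  rewrite -subr_gt0 /f -[X in _ - X]mul1r -mulNr -qevalZ -qevalD.
  by rewrite scaleN1r.
have /choice[q hq] : forall t, exists q : Q, positive q /\ exists C c : R, 0 < c /\
    forall t', `|t' - t| < c ->
    `|f t' - f t - (t' - t) * qeval q v v| <= C * (t' - t) ^+ 2.
  move=> {t0} t1; have [p [C [c [c0 C0 H]]]] := sg t1 I.
  have tt : `|t1 - t1| < c by rewrite subrr normr0.
  have [dp _ _] := H _ _ tt tt.
  set W := X p (g t1) *m jac (fun y => coords (param p y)) (kap p (g t1)).
  exists (uncoords W); split; first exact: X_positive.
  (* Evaluation at (v, v) is seen as a map to 1 x 1 matrices, so that the Jacobian lemmas apply. *)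
  have ll : linear (fun k : 'rV[R]_(\dim {:Q}) =>
      (qeval (uncoords k : Q) v v)%:M : 'rV[R]_1).
    by move=> a k k'; rewrite linearP qevalD qevalZ raddfD /= -scale_scalar_mx.
  have [A hA] := linear_mulmx ll.
  pose F y := coords (param p y) *m A.
  have jF : has_jac F (kap p (g t1))
      (jac (fun y => coords (param p y)) (kap p (g t1)) *m A).
    apply: (@has_jac_comp _ _ _ _ (fun y => coords (param p y)) (fun y => y *m A)).
      exact/c11v_jac/(param_c11 dp).
    exact: has_jac_linear.
  have FE t' : dom p (g t') -> F (kap p (g t')) = (f t')%:M.
    by move=> d'; rewrite /F (param_kap d') -hA coordsK.
  move: jF => [K [K0 hK]]; set J := _ *m A in hK.
  pose D := K * C ^+ 2 + (d + d)%:R * C * `|J|.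
  exists D, (Num.min c (K^-1 / (C + 1))).
  have C1 : 0 < C + 1 by rewrite ltr_wpDl.
  split; first by rewrite lt_min c0 divr_gt0 ?invr_gt0.
  move=> t'; rewrite lt_min => /andP[tc tK].
  have [_ a1 a2] := H _ _ tt tc; have [d' _ _] := H _ _ tc tt.
  have aK : `|kap p (g t') - kap p (g t1)| < K^-1.
    apply: (le_lt_trans a1); apply: (@le_lt_trans _ _ (`|t' - t1| * (C + 1))).
      by rewrite mulrC ler_wpM2l// lerDl.
    by rewrite -ltr_pdivlMr.
  have := hK _ aK; rewrite !FE//.
  move: (kap p (g t') - kap p (g t1)) a1 a2 => dk a1 a2 a3.
  have E : (f t' - f t1 - (t' - t1) * qeval (uncoords W : Q) v v)%:M =
      ((f t')%:M - (f t1)%:M - dk *m J) +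
      (dk - (t' - t1) *: X p (g t1)) *m J :> 'rV[R]_1.
    rewrite mulmxBl addrA subrK -scalemxAl /J mulmxA -/W -hA.
    by rewrite !raddfB /= -scale_scalar_mx.
  have nE (a : R) : `|a| = `|a%:M : 'rV[R]_1|.
    apply/eqP; rewrite eq_le; apply/andP; split.
      by have := coord_le_norm (a%:M : 'rV[R]_1) 0 0; rewrite mxE mulr1n.
    by apply: norm_le_coord => // i j; rewrite !ord1 mxE mulr1n.
  rewrite nE E; apply: (le_trans (ler_normD _ _)); rewrite /D mulrDl lerD//.
    apply: (le_trans a3); rewrite -mulrA ler_wpM2l ?(ltW K0)//.
    rewrite -[(t' - t1) ^+ 2]ger0_norm ?sqr_ge0// normrX -exprMn.
    by rewrite lerXn2r ?nnegrE ?mulr_ge0.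
  apply: (le_trans (mulmx_norm _ _)).
  rewrite [leRHS]mulrAC ler_wpM2r// -mulrA ler_wpM2l//.
apply: (@increasing_of_slopes _ f (fun t => qeval (q t) v v)) => // t'.
by have [qp hC] := hq t'; split => //; exact: qp.
Qed.

End SolutionCurves.

(** * Gluing local fields *)

Section Cells.
Context (J : choiceType) (b : J -> chart R d M) (x : J -> M).
Context (Y : J -> 'rV[R]_d -> 'rV[R]_(d + d)) (r : J -> R).
Hypothesis lf : forall j, local_field u (b j) (x j) (Y j) (r j).

(** Three concentric balls are in use: radius r j to cover M, 2 r j to bound the field, 3 r j to
    carry the weight. The middle one contains the ball of radius r j around any point of the first,
    and the weight is at least r j on it. *)
Definition cell_outer j : set M :=
  [set y | chart_dom (b j) y /\ `|b j y - b j (x j)| <= 3 * r j].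

(** Extended by 0 off the chart domain. It vanishes outside the outer cell, which is compact and
    hence closed in M; this prevents a jump at the boundary of the domain. *)
Definition bump j (y : M) : R :=
  if y \in chart_dom (b j) then cutoff (3 * r j) `|b j y - b j (x j)| else 0.

Lemma outer_good j y : cell_outer j y -> good (b j) (x j) y.
Proof.
move=> [by_ le]; have [_ ok _ _ _] := lf j.
by have [gd _] := ok _ le; rewrite chart_funK in gd.
Qed.

Lemma outer_compact j : compact (cell_outer j).
Proof.
have [_ ok _ _ _] := lf j.
have -> : cell_outer j = chart_inv (b j) @`
    [set z | `|z - b j (x j)| <= 3 * r j].
  apply/seteqP; split => [y [by_ le]|y [z /= zr <-]].
    by exists (b j y) => //; rewrite chart_funK.
  have [/good_sub[_ _ h _ _] bz] := ok z zr.
  by split => //; rewrite bz.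
apply: continuous_compact; last exact: compact_cball.
apply: continuous_in_subspaceT => z /set_mem /ok[/good_sub[_ _ h _ _] bz].
by have := chart_inv_continuous h; rewrite bz.
Qed.

Lemma bump_ge0 j y : 0 <= bump j y.
Proof. by rewrite /bump; case: ifP => // _; exact: cutoff_ge0. Qed.

Lemma bump_gt0 j y : 0 < bump j y ->
  chart_dom (b j) y /\ `|b j y - b j (x j)| < 3 * r j.
Proof.
by rewrite /bump; case: ifPn; rewrite ?ltxx// cutoff_gt0 => /set_mem.
Qed.

Lemma bump_outer j y : ~ cell_outer j y -> bump j y = 0.
Proof.
move=> no; apply/eqP; rewrite eq_le bump_ge0 andbT leNgt.
by apply/negP => /bump_gt0[h /ltW le]; apply: no.
Qed.

Definition cell_patch (k : J * G) : patch := Patch (b k.1) (x k.1) k.2 0.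

Definition weight (k : J * G) (e : N) := bump k.1 (act k.2^-1%g (val e).1).

Definition cell_meets (k : J * G) : set N :=
  [set e | cell_outer k.1 (act k.2^-1%g (val e).1)].

(** Meaningful on the domain of [cell_patch k]; elsewhere it is only ever multiplied by a weight
    equal to 0. *)
Definition pushed_field (k : J * G) p (e : N) : 'rV[R]_(d + d) :=
  Y k.1 (rsubmx (kap (cell_patch k) e)) *m
  jac (tau (cell_patch k) p) (kap (cell_patch k) e).

Definition chart_dist p (e1 e2 : N) := `|kap p e1 - kap p e2|.

Lemma meets_dom k e : cell_meets k e -> dom (cell_patch k) e.
Proof. exact: outer_good. Qed.

Lemma weight_outer k e : ~ cell_meets k e -> weight k e = 0.
Proof. exact: bump_outer. Qed.

Lemma near_not_meets k (e : N) : ~ cell_meets k e ->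
  \forall e' \near e, ~ cell_meets k e'.
Proof.
move=> no; have cl := compact_closed (@manifold_hausdorff R d M) (@outer_compact k.1).
have : nbhs (act k.2^-1%g (val e).1) (~` cell_outer k.1).
  by apply: open_nbhs_nbhs; split => //; exact: closed_openC.
by move=> n; exact: base_continuous (@act_cont _ _ _ n).
Qed.

Lemma chart_dist_small p e : dom p e -> forall c : R, 0 < c ->
  exists2 A, nbhs e A & forall y z, A y -> A z -> chart_dist p y z <= c.
Proof.
move=> de c c0; have [A Ax hA] := rV_dist_small (kap p e) c0.
exists (kap p @^-1` A) => [|y z Ay Az]; last exact: hA.
exact: (kap_continuous de).
Qed.

Lemma chart_dist_ge0 p (y z : N) : 0 <= chart_dist p y z.
Proof. exact: normr_ge0. Qed.

Lemma near_dom_N p e : dom p e -> \forall e' \near e, dom p e'.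
Proof. by move=> de; apply: open_nbhs_nbhs; split => //; exact: dom_open. Qed.

Lemma kap_jac_loc_lip p p' e : dom p e -> dom p' e ->
  loc_lip (chart_dist p) (kap p') e /\
  loc_lip (chart_dist p) (fun e' => jac (tau p p') (kap p e')) e.
Proof.
move=> de de'.
have [C [C0 hC]] := c11v_est (tau_c11 de de').
have O : nbhs e [set e' | dom p e' /\ `|kap p e' - kap p e| < C^-1].
  have n1 : nbhs e [set e' | `|kap p e' - kap p e| < C^-1].
    by have /continuous_rV := kap_continuous de; apply; rewrite invr_gt0.
  exact: filterI (near_dom_N de) n1.
split; exists C, [set e' | dom p e' /\ `|kap p e' - kap p e| < C^-1];
  split => //; rewrite ?(ltW C0)//; move=> y z [dy ny] [dz nz].
  have [_ _ /(_ _ ny)[_ _]] := hC _ nz.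
  by rewrite !(tau_kap p').
by have [_ _ /(_ _ ny)[_ + _]] := hC _ nz.
Qed.

(** Off the closed outer cell the weight vanishes in a neighbourhood; on it, the point lies in an
    open domain where the weight is a Lipschitz function of coordinates. *)
Lemma weight_loc_lip p k e : dom p e ->
  loc_lip (chart_dist p) (weight k : N -> R^o) e.
Proof.
move=> de; have [m|no] := pselect (cell_meets k e); last first.
  apply: (@loc_lip_near _ _ _ _ R^o (fun=> 0)); last exact: loc_lip_cst.
  by apply: filterS (near_not_meets no) => e' /weight_outer.
have dk := meets_dom m.
apply: (@loc_lip_near _ _ _ _ R^o (fun e' => cutoff (3 * r k.1)
    `|lsubmx (kap (cell_patch k) e') - b k.1 (x k.1)|)).
  apply: filterS (near_dom_N dk) => e' de'.
  rewrite lsub_kap /weight /bump mem_set//.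
  by have [] := good_sub de'.
have [h _] := kap_jac_loc_lip de dk.
apply: (@loc_lip_comp _ _ _ _ 'rV[R]_(d + d) R^o _ (fun a => cutoff (3 * r k.1)
    `|lsubmx a - b k.1 (x k.1)|) 1) h => // y z.
rewrite mul1r; apply: (le_trans (cutoff_lip _ _ _)).
apply: (le_trans (ler_dist_dist _ _)).
rewrite opprB addrA subrK -linearB; apply: norm_le_coord => // i j.
by rewrite mxE coord_le_norm.
Qed.

Lemma pushed_loc_lip p k e : dom p e -> dom (cell_patch k) e ->
  loc_lip (chart_dist p) (pushed_field k p) e.
Proof.
move=> de dk; have small := chart_dist_small de; have ge0 := chart_dist_ge0 p.
have [kl _] := kap_jac_loc_lip de dk.
apply: loc_lip_mulmx => //.
  have [_ _ _ Yl _] := lf k.1.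
  have rn : rsubmx (kap (cell_patch k) e) != 0.
    exact: (rsub_kap dk).
  apply: (@loc_lip_compose _ _ _ _ _ (fun e' => rsubmx (kap (cell_patch k) e'))) => //;
    last exact: Yl.
  apply: (@loc_lip_comp _ _ _ _ 'rV[R]_(d + d) 'rV[R]_d _ (@rsubmx R 1 d d) 1) kl => //.
  move=> y z; rewrite mul1r -linearB; apply: norm_le_coord => // i j.
  by rewrite mxE coord_le_norm.
have [C [C0 hC]] := c11v_est (tau_c11 dk de).
apply: (@loc_lip_compose _ _ _ _ _ (kap (cell_patch k)) _ (jac (tau (cell_patch k) p))) => //.
exists C, [set y | `|y - kap (cell_patch k) e| < C^-1]; split; first exact: ltW.
  by apply/near_rV; exists C^-1; rewrite ?invr_gt0.
by move=> y z ny nz; have [_ _ /(_ _ ny)[_ + _]] := hC _ nz.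
Qed.

Lemma weighted_loc_lip p k e : dom p e ->
  loc_lip (chart_dist p) (fun e' => weight k e' *: pushed_field k p e') e.
Proof.
move=> de; have [m|no] := pselect (cell_meets k e); last first.
  apply: (@loc_lip_near _ _ _ _ 'rV[R]_(d + d) (fun=> 0)); last exact: loc_lip_cst.
  by apply: filterS (near_not_meets no) => e' /weight_outer ->; rewrite scale0r.
have small := chart_dist_small de; have ge0 := chart_dist_ge0 p.
apply: loc_lip_scale => //; first exact: weight_loc_lip.
exact: pushed_loc_lip de (meets_dom m).
Qed.

Hypothesis cover : forall y : M, exists j g, chart_dom (b j) (act g^-1%g y) /\
  `|b j (act g^-1%g y) - b j (x j)| < r j.
Hypothesis locfin : forall y : M, exists2 W : set M, nbhs y W & finite_set
  [set k : J * G | exists y', W y' /\ cell_outer k.1 (act k.2^-1%g y')].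
Hypothesis r_small : forall j, r j <= 1 / 2.
Context (e0 : N).

(** A sum over finite support: by [local_support] only finitely many terms are nonzero at each
    point, without which it would be 0 by convention. *)
Definition raw_field p (e : N) : 'rV[R]_(d + d) :=
  \sum_(k \in [set: J * G]) weight k e *: pushed_field k p e.

Lemma weight_move h s j g e : weight (j, (h * g)%g) (act_bundle h s e) = weight (j, g) e.
Proof. by rewrite /weight/= val_act_bundle/= act_back. Qed.

(** The patch of a translated cell has scale 0, whereas the moved patch has scale s; the homogeneity
    of [Y j] makes up for the difference. *)
Lemma pushed_move h s j g p e : dom (cell_patch (j, g)) e -> dom p e ->
  pushed_field (j, (h * g)%g) (move_patch h s p) (act_bundle h s e) = pushed_field (j, g) p e.
Proof.
have qE : cell_patch (j, (h * g)%g) =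
    move_patch h s (rescale s (cell_patch (j, g))).
  by rewrite /cell_patch /move_patch /rescale/= sub0r subrr.
have [_ _ Ys _ _] := lf j.
rewrite /pushed_field qE; move: (cell_patch (j, g)) => q dq dp /=.
rewrite kap_move tau_move [in RHS](jac_tau_split s dq dp).
have E : Y j (rsubmx (kap (rescale s q) e)) =
    Y j (rsubmx (kap q e)) *m fibre_scaling d (expR s).
  by rewrite -(Ys _ _ (expR_gt0 s)) kap_rescale mulmx_fibre_scaling row_mxKr.
by rewrite E; exact: (esym (mulmxA _ _ _)).
Qed.

Lemma pushed_transition k p p' e : dom (cell_patch k) e -> dom p e -> dom p' e ->
  pushed_field k p' e = pushed_field k p e *m jac (tau p p') (kap p e).
Proof.
move=> dk dp dp'; rewrite /pushed_field.
rewrite (jac_tau_cocycle e dk dp dp').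
exact: mulmxA.
Qed.

Lemma weight_dom k e : weight k e != 0 -> dom (cell_patch k) e.
Proof.
move=> w0; apply: meets_dom; apply: contrapT => /weight_outer w.
by rewrite w eqxx in w0.
Qed.

(** Reindex the sum by left multiplication on group elements; terms of weight 0, where the pushed
    field is meaningless, are set apart. *)
Lemma raw_move h s p e : dom p e ->
  raw_field (move_patch h s p) (act_bundle h s e) = raw_field p e.
Proof.
move=> dp; pose f (k : J * G) := (k.1, (h * k.2)%g).
have bij : bijective f.
  by exists (fun k => (k.1, (h^-1 * k.2)%g)) => -[j g]; rewrite /f/= ?mulKg ?mulVKg.
rewrite /raw_field; apply: (etrans (reindex_fsbigT f (fun k => weight k
  (act_bundle h s e) *: pushed_field k (move_patch h s p) (act_bundle h s e)) bij)).
apply: eq_fsbigr => -[j g] _ /=; rewrite weight_move.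
have := fun w0 => pushed_move h s (@weight_dom (j, g) e w0) dp.
move: (weight _ _) (pushed_field _ _ _) (pushed_field _ _ _) => w v v' H.
by have [->|/H ->] := eqVneq w 0; rewrite ?scale0r.
Qed.

Lemma local_support e : exists2 A : seq (J * G), uniq A & \forall e' \near e,
  forall k, k \notin A -> weight k e' = 0.
Proof.
have [W We /finite_seqP[A AE]] := locfin (val e).1.
exists (undup A); first exact: undup_uniq.
have n : nbhs e [set e' : N | W (val e').1] by exact: base_continuous We.
move: n; apply: filterS => e' We' k kA.
apply: weight_outer => m; move/negP: kA; apply; rewrite mem_undup.
suff : [set` A] k by [].
by rewrite -AE; exists (val e').1.
Qed.

Lemma raw_seq (A : seq (J * G)) p e : uniq A -> (forall k, k \notin A -> weight k e = 0) ->
  raw_field p e = \sum_(k <- A) weight k e *: pushed_field k p e.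
Proof.
move=> uA h; rewrite /raw_field (fsbigE A)//.
  by apply: eq_bigl => k; rewrite in_setT.
by move=> k _ /h ->; rewrite scale0r.
Qed.

Lemma raw_loc_lip p e : dom p e -> loc_lip (chart_dist p) (raw_field p) e.
Proof.
move=> dp; have [A uA hA] := local_support e.
apply: (@loc_lip_near _ _ _ _ 'rV[R]_(d + d)
  (fun e' => \sum_(k <- A) weight k e' *: pushed_field k p e')).
  by move: hA; apply: filterS => e' /(raw_seq p uA) ->.
by apply: loc_lip_sum => k; exact: (weighted_loc_lip k dp).
Qed.

Lemma raw_transition p p' e : dom p e -> dom p' e ->
  raw_field p' e = raw_field p e *m jac (tau p p') (kap p e).
Proof.
move=> dp dp'; have [A uA hA] := local_support e.
rewrite !(raw_seq _ uA (nbhs_singleton hA)) mulmx_suml; apply: eq_bigr => k _.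
have := fun w0 => pushed_transition (@weight_dom k e w0) dp dp'.
move: (weight k e) (pushed_field k p e) (pushed_field k p' e) (jac _ _) => w v v' A' H.
have [->|/H ->] := eqVneq w 0; first by rewrite !scale0r mul0mx.
by rewrite scalemxAl.
Qed.

Lemma covering_weight e : exists k : J * G, 0 < weight k e.
Proof.
have [j [g [bg le]]] := cover (val e).1; exists (j, g).
rewrite /weight /bump/= mem_set// cutoff_gt0; apply: (lt_le_trans le).
by have [r0 _ _ _ _] := lf j; have := r0; lra.
Qed.

(** Each term is positive in its own patch by [local_field], and is carried over by the chain rule
    for [param] and by [scaled_act]; some weight is positive because the inner cells cover. *)
Lemma raw_positive p e : dom p e ->
  positive (uncoords (raw_field p e *m jac (fun y => coords (param p y)) (kap p e)) : Q).
Proof.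
move=> dp; have [A uA hA] := local_support e.
rewrite (raw_seq _ uA (nbhs_singleton hA)) mulmx_suml linear_sum /=.
under eq_bigr do rewrite -scalemxAl linearZ /=.
apply: positive_sum => [k _|k _ wk|]; first exact: bump_ge0.
- have dk := weight_dom (lt0r_neq0 wk).
  rewrite -mulmxA -(jac_param_cocycle e dk dp).
  have sl : linear (fun v => coords (scaled_act k.2 0 (uncoords v : Q))).
    by move=> c v v'; rewrite !linearP.
  have [B hB] := linear_mulmx sl.
  have [bk zr] := bump_gt0 wk; have [_ ok _ _ Yp] := lf k.1.
  have okz := ok _ (ltW zr).
  set y := kap (cell_patch k) e.
  have ly : lsubmx y = b k.1 (act k.2^-1%g (val e).1) by rewrite lsub_kap.
  have okl : chart_ok u (b k.1) (x k.1) (lsubmx y) by rewrite ly.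
  have -> : jac (fun y => coords (param (cell_patch k) y)) y =
      jac (frame_row u (b k.1) (x k.1)) y *m B.
    apply: has_jacE; rewrite (_ : (fun y => _) =
        fun y => frame_row u (b k.1) (x k.1) y *m B); last first.
      by apply/funext => y'; rewrite -hB /frame_row coordsK.
    apply: (@has_jac_comp _ _ _ _ (frame_row u (b k.1) (x k.1)) (fun y => y *m B)).
      exact/c11v_jac/frame_row_c11.
    exact: has_jac_linear.
  rewrite mulmxA -hB coordsK; apply: scaled_act_positive.
  rewrite -[y in jac _ y]hsubmxK; apply: Yp; first by rewrite ly ltW.
  exact: (rsub_kap dk).
have [k wk] := covering_weight e; exists k => //.
apply: contraT => kA; have := nbhs_singleton hA k kA.
by move=> w; rewrite w ltxx in wk.
Qed.

Let r0 j : 0 < r j. Proof. by have [] := lf j. Qed.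

(** Contains all y within r j of the coordinates of a point of the inner cell, in a patch scaled so
    that its fibre coordinates have norm 1: since r j <= 1 / 2, the fibre part of y stays between 1
    / 2 and 2. *)
Let core j := [set y : 'rV[R]_(d + d) | [/\ `|lsubmx y - b j (x j)| <= 2 * r j,
  1 / 2 <= `|rsubmx y| & `|rsubmx y| <= 2]].

Let core_compact j : compact (core j).
Proof.
pose y0 := row_mx (b j (x j)) 0 : 'rV[R]_(d + d).
have lc (c : R) : closed [set y : 'rV[R]_(d + d) | `|lsubmx y - b j (x j)| <= c].
  rewrite (_ : mkset _ = (fun y : 'rV[R]_(d + d) => `|lsubmx y - b j (x j)|) @^-1`
    [set t | t <= c]) //.
  apply: preimage_closed => [y _|]; last exact: closed_le.
  exact: (@continuous_comp _ _ _ (@lsubmx R 1 d d) (fun z => `|z - b j (x j)|) y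
    (@lsubmx_continuous R d d y) (@dist_continuous _ _ _ _)).
have rc : continuous (fun y : 'rV[R]_(d + d) => `|rsubmx y|).
  move=> y; have := @continuous_comp _ _ _ (@rsubmx R 1 d d) (fun z => `|z - 0|) y
    (@rsubmx_continuous R d d y) (@dist_continuous _ _ _ _).
  by congr continuous_at; apply/funext => z /=; rewrite subr0.
have cl : closed (core j).
  rewrite (_ : core j = [set y | `|lsubmx y - b j (x j)| <= 2 * r j] `&`
    ((fun y => `|rsubmx y|) @^-1` [set t | 1 / 2 <= t] `&`
     (fun y => `|rsubmx y|) @^-1` [set t | t <= 2])); last first.
    by apply/seteqP; split => [y []|y [? []]].
  apply: closedI; first exact: lc.
  by apply: closedI; apply: preimage_closed => [y _|]; [exact: rc|exact: closed_ge|
    exact: rc|exact: closed_le].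
apply: (subclosed_compact cl (@compact_cball R _ y0 2)) => y [h1 _ h2].
rewrite /= -[y]hsubmxK opp_row_mx add_row_mx subr0.
apply: norm_le_coord => // i k.
case: (split_ordP k) => l ->; rewrite ?row_mxEl ?row_mxEr.
  apply: (le_trans (coord_le_norm _ _ _)); apply: (le_trans h1).
  by have := r_small j; lra.
exact: le_trans (coord_le_norm _ _ _) h2.
Qed.

(** Compactness bounds the field on the core in the patch with group element 1 and scale 0;
    invariance transports the bound to all g and s. *)
Lemma raw_bound j : exists2 B : R, 0 <= B & forall g s e,
  dom (Patch (b j) (x j) g s) e -> core j (kap (Patch (b j) (x j) g s) e) ->
  `|raw_field (Patch (b j) (x j) g s) e| <= B.
Proof.
pose p0 : patch := Patch (b j) (x j) 1%g 0.
have [_ ok _ _ _] := lf j.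
have spec y : core j y -> dom p0 (kinv e0 p0 y) /\ kap p0 (kinv e0 p0 y) = y.
  move=> [h1 h2 _]; have [|gd bz] := ok (lsubmx y).
    by apply: (le_trans h1); have := r0 j; lra.
  have y0 : rsubmx y != 0.
    by rewrite -normr_gt0; apply: lt_le_trans h2; rewrite divr_gt0.
  by have [] := @kinv_spec e0 p0 y _ gd bz y0.
pose f y := raw_field p0 (kinv e0 p0 y).
have fc y : core j y -> {for y, continuous f}.
  move=> /spec[dy ky].
  have kc := kinv_continuous dy.
  rewrite ky in kc.
  apply: (@continuous_comp _ _ _ (kinv e0 p0) (raw_field p0)) => //.
  apply: loc_lip_continuous; first exact: (chart_dist_small dy).
  by exact: (raw_loc_lip dy).
have [y /fc/continuous_rV/(_ 1 ltr01)|s [sK scov]] := @compact_finite_cover _ _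
    (fun y => [set y' | `|f y' - f y| < 1]) (@core_compact j); first exact.
pose B := \sum_(y <- s) (`|f y| + 1).
have B0 : 0 <= B by rewrite sumr_ge0// => y _; rewrite addr_ge0.
exists B => // g t e de Ke.
pose e' := act_bundle g^-1%g (- t) e.
have eE : e = act_bundle g t e'.
  apply: val_inj; rewrite /e' !val_act_bundle/=.
  rewrite actKV scaled_actKV -surjective_pairing//.
have pE : Patch (b j) (x j) g t = move_patch g t p0.
  by rewrite /move_patch/= mulg1 addr0.
move: de Ke; rewrite pE eE dom_move kap_move.
move=> de Ke; rewrite (raw_move _ _ de).
have [y ys /= le] := scov _ Ke.
have {}le : `|f (kap p0 e') - f y| < 1 := le.
have fE : f (kap p0 e') = raw_field p0 e' by rewrite /f kapK.
have BE : `|f y| + 1 <= B.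
  by rewrite /B (big_rem y ys) lerDl sumr_ge0// => z _; rewrite addr_ge0.
move: fE BE le => <-; move: (f y) (f (kap p0 e')) => v v' BE le; apply: le_trans BE.
rewrite [leRHS]addrC; apply: (@le_trans _ _ (`|v' - v| + `|v|)).
  by have := ler_normD (v' - v) v; rewrite subrK.
exact: lerD (ltW le) (lexx _).
Qed.

(** Summing over all translates of the cells makes this normalising function invariant under the
    group and under scalings. *)
Definition total (C : J -> R) e : R := \sum_(k \in [set: J * G]) C k.1 * weight k e.

Lemma total_seq C (A : seq (J * G)) e : uniq A ->
  (forall k, k \notin A -> weight k e = 0) ->
  total C e = \sum_(k <- A) C k.1 * weight k e.
Proof.
move=> uA h; rewrite /total (fsbigE A)//.
  by apply: eq_bigl => k; rewrite in_setT.
by move=> k _ /h ->; rewrite mulr0.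
Qed.

Lemma total_ge C e k : (forall j, 0 <= C j) -> C k.1 * weight k e <= total C e.
Proof.
move=> C0; have [A uA hA] := local_support e.
have ge0 k' : 0 <= C k'.1 * weight k' e by rewrite mulr_ge0// bump_ge0.
rewrite (total_seq C uA (nbhs_singleton hA)).
have [kA|/(nbhs_singleton hA) ->] := boolP (k \in A); last by rewrite mulr0 sumr_ge0.
by rewrite (big_rem k)//= lerDl sumr_ge0.
Qed.

Lemma total_gt0 C e : (forall j, 0 < C j) -> 0 < total C e.
Proof.
move=> C0; have [k wk] := covering_weight e.
apply: (@lt_le_trans _ _ (C k.1 * weight k e)); first exact: mulr_gt0.
by apply: total_ge => j; exact: ltW.
Qed.

Lemma total_move C h s e : total C (act_bundle h s e) = total C e.
Proof.
pose f (k : J * G) := (k.1, (h * k.2)%g).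
have bij : bijective f.
  by exists (fun k => (k.1, (h^-1 * k.2)%g)) => -[j g]; rewrite /f/= ?mulKg ?mulVKg.
rewrite /total; apply: (etrans (reindex_fsbigT f (fun k => C k.1 *
  weight k (act_bundle h s e)) bij)).
by apply: eq_fsbigr => -[j g] _ /=; rewrite weight_move.
Qed.

Lemma total_loc_lip C p e : dom p e ->
  loc_lip (chart_dist p) (total C : N -> R^o) e.
Proof.
move=> dp; have [A uA hA] := local_support e.
apply: (@loc_lip_near _ _ _ _ R^o (fun e' => \sum_(k <- A) C k.1 *: (weight k e' : R^o))).
  by move: hA; apply: filterS => e' /(total_seq C uA) ->.
apply: loc_lip_sum => k; apply: loc_lip_scale; first exact: chart_dist_ge0.
- exact: (chart_dist_small dp).
- exact: loc_lip_cst.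
- exact: (weight_loc_lip k dp).
Qed.

(* The weights C j in [total] are chosen from the bound of the raw field on the
   core of cell j, which bounds the normalised field there by r j / 2. *)
Theorem complete_field : exists X : patch -> N -> 'rV[R]_(d + d),
  [/\ transitions (fun p => dom p : set N) kap X,
      locally_lipschitz_field (fun p => dom p : set N) kap X,
      uniform_time (fun p => dom p : set N) kap (kinv e0) X,
      forall h s p (e : N), dom p e ->
        X (move_patch h s p) (act_bundle h s e) = X p e &
      forall p (e : N), dom p e -> positive (uncoords
        (X p e *m jac (fun y => coords (param p y)) (kap p e)) : Q)].
Proof.
have /choice[B hB] : forall j, exists B : R, 0 <= B /\ forall g s e,
    dom (Patch (b j) (x j) g s) e -> core j (kap (Patch (b j) (x j) g s) e) ->
    `|raw_field (Patch (b j) (x j) g s) e| <= B.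
  by move=> j; have [B B0 h] := raw_bound j; exists B.
(* Chosen so that [B j <= r j / 2 * (C j * r j)]; the [+ 1] keeps C j positive when B j is 0. *)
pose C j := 2 * B j / r j ^+ 2 + 1.
have C0 j : 0 < C j.
  by have [B0 _] := hB j; rewrite ltr_wpDl// divr_ge0 ?exprn_ge0 ?mulr_ge0 ?(ltW (r0 j)).
have T0 e : 0 < total C e by exact: total_gt0.
exists (fun p e => (total C e)^-1 *: raw_field p e); split.
- move=> p p' e dp dp'.
  have [K [K0 hK]] := c11v_est (tau_c11 dp dp').
  exists (fun e1 => jac (tau p p') (kap p e1)), ((1 + (d + d)%:R) * K),
    [set e1 | [/\ dom p e1, dom p' e1 & `|kap p e1 - kap p e| < K^-1]].
  split; first by rewrite mulr_ge0 ?addr_ge0// ltW.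
    have n1 : nbhs e [set e1 | `|kap p e1 - kap p e| < K^-1].
      have /continuous_rV := kap_continuous dp.
      by apply; rewrite invr_gt0.
    have n2 : nbhs e ((dom p : set N) `&` ((dom p' : set N) `&`
        [set e1 | `|kap p e1 - kap p e| < K^-1])).
      by apply: filterI; [exact: near_dom_N|apply: filterI => //; exact: near_dom_N].
    by move: n2; apply: filterS => e1 [? [? ?]].
  move=> e1 [d1 d1' n1]; have [_ J1 h1] := hK _ n1; split.
  + by rewrite (raw_transition d1 d1') scalemxAl.
  + move=> v; apply: (le_trans (mulmx_norm _ _)); rewrite mulrAC ler_wpM2r//.
    apply: (@le_trans _ _ ((d + d)%:R * K)); first by rewrite ler_wpM2l.
    by rewrite ler_wpM2r ?(ltW K0)// lerDr.
  + move=> e2 [d2 d2' n2]; have [+ _ _] := h1 _ n2.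
    rewrite !(tau_kap p')// => h; apply: (le_trans h).
    by rewrite ler_wpM2r ?exprn_ge0// ler_peMl ?(ltW K0)// lerDl.
- move=> p e dp.
  have small := chart_dist_small dp.
  suff [K [ O [K0 Oe h]]] : loc_lip (chart_dist p)
      (fun e => (total C e)^-1 *: raw_field p e) e by exists K, O.
  apply: loc_lip_scale => //; first exact: chart_dist_ge0.
    apply: loc_lip_inv => //; first exact: chart_dist_ge0.
    exact: total_loc_lip.
  exact: (raw_loc_lip dp).
- move=> e; have [j [g [bg le]]] := cover (val e).1.
  have [_ ok _ _ _] := lf j.
  have gd : good (b j) (x j) (act g^-1%g (val e).1).
    have [|+ _] := ok (b j (act g^-1%g (val e).1)).
      by apply: (le_trans (ltW le)); have := r0 j; lra.
    by rewrite chart_funK.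
  pose p0 : patch := Patch (b j) (x j) g 0.
  have n0 : 0 < `|rsubmx (kap p0 e)|.
    by rewrite normr_gt0; apply: rsub_kap.
  pose p : patch := Patch (b j) (x j) g (ln `|rsubmx (kap p0 e)|).
  have dp : dom p e by [].
  have c1 : `|rsubmx (kap p e)| = 1.
    have -> : p = rescale (- ln `|rsubmx (kap p0 e)|) p0.
      by rewrite /rescale/= opprK add0r.
    rewrite kap_rescale mulmx_fibre_scaling row_mxKr normrZ.
    by rewrite gtr0_norm ?expR_gt0// expRN lnK ?posrE// mulVf// gt_eqF.
  have lE : lsubmx (kap p e) = b j (act g^-1%g (val e).1) by rewrite lsub_kap.
  exists p, (r j); split => // y yr.
  have yl : `|lsubmx y - b j (x j)| <= 2 * r j.
    rewrite -(subrKA (lsubmx (kap p e))); apply: (le_trans (ler_normD _ _)).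
    have -> : 2 * r j = r j + r j by ring.
    apply: lerD; last by rewrite lE ltW.
    rewrite -linearB; apply: le_trans yr; apply: norm_le_coord => // i k.
    by rewrite mxE coord_le_norm.
  have yc : `|rsubmx y - rsubmx (kap p e)| <= 1 / 2.
    apply: le_trans (r_small j); rewrite -linearB; apply: le_trans yr.
    by apply: norm_le_coord => // i k; rewrite mxE coord_le_norm.
  have Ky : core j y.
    have {}yc : `| `|rsubmx y| - 1| <= 1 / 2.
      by have := le_trans (ler_dist_dist _ _) yc; rewrite c1.
    move: yc; rewrite ler_distl => /andP[a1 a2]; split => //.
      by apply: le_trans a1; rewrite lerBrDr -splitr.
    by apply: (le_trans a2); rewrite lerD2l ler_pdivrMr// mul1r ler1n.
  have [|gy bz] := ok (lsubmx y); first by apply: (le_trans yl); rewrite ler_wpM2r ?ler_nat ?(ltW (r0 j)).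
  have y0 : rsubmx y != 0.
    have [_ h _] := Ky; rewrite -normr_gt0; apply: lt_le_trans h.
    by rewrite divr_gt0.
  have [vy dy ky] := @kinv_spec e0 p y _ gy bz y0.
  split => //; rewrite normrZ gtr0_norm ?invr_gt0//.
  rewrite mulrC ler_pdivrMr//.
  have [B0 /(_ g _ _ dy)] := hB j; rewrite ky => /(_ Ky) hb; apply: (le_trans hb).
  (* On the ball of radius [2 * r j] the bump is at least [3 * r j - 2 * r j]. *)
  have wy : r j <= weight (j, g) (kinv e0 p y).
    have /good_sub[_ _ h _ _] := gy.
    rewrite /weight /bump/= vy/= actK mem_set// bz.
    rewrite /cutoff le_max; apply/orP; right; rewrite lerBrDr.
    have -> : 3 * r j = r j + 2 * r j by ring.
    by rewrite lerD2l.
  have := @total_ge C (kinv e0 p y) (j, g) (fun j => ltW (C0 j)) => /= tg.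
  apply: (@le_trans _ _ (r j / 2 * (C j * r j))); last first.
    rewrite ler_wpM2l ?divr_ge0 ?(ltW (r0 j))//; apply: le_trans tg.
    by rewrite ler_wpM2l// ltW.
  have rj := r0 j; rewrite /C.
  have -> : r j / 2 * ((2 * B j / r j ^+ 2 + 1) * r j) = B j + r j ^+ 2 / 2.
    by field; rewrite gt_eqF.
  by rewrite lerDl divr_ge0// exprn_ge0// ltW.
- move=> h s p e dp; by rewrite total_move (raw_move h s dp).
- move=> p e dp; rewrite -scalemxAl linearZ /=; apply: positiveZ.
    by rewrite invr_gt0.
  exact: (raw_positive dp).
Qed.

End Cells.

(** * Cells and the flow on the punctured bundle *)

Hypothesis prop : proper_action act.

Record cell := Cell {
  cell_chart : chart R d M; cell_center : M;
  cell_field : 'rV[R]_d -> 'rV[R]_(d + d); cell_radius : R;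
  cell_local_field :
    local_field u cell_chart cell_center cell_field cell_radius;
  cell_radius_small : cell_radius <= 1 / 2 }.

Definition inner_ball (t : cell) : set M := [set y | chart_dom (cell_chart t) y /\
  `|cell_chart t y - cell_chart t (cell_center t)| < cell_radius t].

Definition outer_ball (t : cell) : set M := [set y | chart_dom (cell_chart t) y /\
  `|cell_chart t y - cell_chart t (cell_center t)| <= 3 * cell_radius t].

Lemma inner_ball_open t : open (inner_ball t).
Proof.
rewrite openE => y [dy ny].
have n1 : nbhs y (chart_dom (cell_chart t)).
  by apply: open_nbhs_nbhs; split => //; exact: chart_dom_open.
pose c := cell_radius t - `|cell_chart t y - cell_chart t (cell_center t)|.
have c0 : 0 < c by rewrite subr_gt0.
have n2 : nbhs y [set y' | `|cell_chart t y' - cell_chart t y| < c].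
  by have /continuous_rV := chart_fun_continuous dy; exact.
have n3 : nbhs y (chart_dom (cell_chart t) `&`
    [set y' | `|cell_chart t y' - cell_chart t y| < c]) by exact: filterI.
move: n3; apply: filterS => y' [dy' le]; split => //.
rewrite -(subrKA (cell_chart t y)); apply: (le_lt_trans (ler_normD _ _)).
by rewrite -ltrBrDr.
Qed.

Lemma outer_ball_compact t : compact (outer_ball t).
Proof.
exact: (@outer_compact unit (fun=> cell_chart t) (fun=> cell_center t)
  (fun=> cell_field t) (fun=> cell_radius t) (fun=> cell_local_field t) tt).
Qed.

Lemma inner_outer_ball t : inner_ball t `<=` outer_ball t.
Proof.
move=> y [dy ny]; split => //; apply: (le_trans (ltW ny)).
by have [r0 _ _ _ _] := cell_local_field t; rewrite ler_peMl ?ler1n// ltW.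
Qed.

Lemma small_cells (y : M) (U : set M) : open U -> U y ->
  exists2 t, inner_ball t y & outer_ball t `<=` U.
Proof.
move=> oU Uy; have [b ab by_] := @atlas_cover R d M y.
have [F [r lf]] := exists_local_field fit ab by_.
have r0 : 0 < r by have [] := lf.
have : nbhs (chart_inv b (b y)) U by rewrite chart_funK//; exact: open_nbhs_nbhs.
move=> /(chart_inv_continuous by_)/near_rV[c c0 hc].
(* The bound [c / 4] keeps the outer ball, of radius [3 * r'], inside U. *)
pose r' := Num.min r (Num.min (1 / 2) (c / 4)).
have r'0 : 0 < r' by rewrite !lt_min r0 !divr_gt0.
have r'r : r' <= r by rewrite /r' ge_min lexx.
have r'1 : r' <= 1 / 2 by rewrite /r' !ge_min lexx orbT.
have r'c : r' <= c / 4 by rewrite /r' !ge_min lexx !orbT.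
exists (Cell (local_field_shrink r'0 r'r lf) r'1).
  by split; rewrite //= subrr normr0.
move=> z [/= bz nz]; rewrite -(chart_funK bz); apply: hc.
apply: (le_lt_trans nz); apply: (@le_lt_trans _ _ (3 * (c / 4))).
  by rewrite ler_wpM2l.
by rewrite mulrCA gtr_pMr// ltr_pdivrMr// mul1r ltr_nat.
Qed.

(** The image of a solution under [act_bundle] is a solution, so uniqueness turns the invariance of
    the field into commutation with its flow. *)
Theorem bundle_flow : exists Phi : R -> N -> N, [/\ flow Phi,
  forall h s t e, Phi t (act_bundle h s e) = act_bundle h s (Phi t e) &
  forall t e, 0 < t -> positive ((val (Phi t e)).2 - (val e).2)].
Proof.
(* [kinv] needs a default point; an empty bundle has the trivial flow. *)
have [[e0 _]|noN] := pselect (exists e : N, True); last first.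
  exists (fun _ e => e); split=> [|h s t e|t e]; try by case: noN; exists e.
  by split => // -[t e]; case: noN; exists e.
have [a1 aM sm] := actP; have ac g : continuous (act g) by have [] := sm g.
have [t0 _ _] := small_cells (openT : open [set: M]) (I : setT (val e0).1).
have [t [S [cov lfin]]] := invariant_cover (@manifold_hausdorff R d M)
  (@manifold_second_countable R d M) a1 aM ac prop inner_ball_open outer_ball_compact
  inner_outer_ball small_cells t0.
pose tj (j : S) := t (val j).
have cover (y : M) : exists j g, chart_dom (cell_chart (tj j)) (act g^-1%g y) /\
    `|cell_chart (tj j) (act g^-1%g y) - cell_chart (tj j) (cell_center (tj j))|
      < cell_radius (tj j).
  have [i [g [Si Ii]]] := cov y.
  by exists (exist _ i (mem_set Si)), g.
have locfin (y : M) : exists2 W : set M, nbhs y W & finite_set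
    [set k : S * G | exists y', W y' /\ cell_outer (fun j => cell_chart (tj j))
      (fun j => cell_center (tj j)) (fun j => cell_radius (tj j)) k.1
      (act k.2^-1%g y')].
  have [W Wy fin] := lfin y; exists W => //.
  apply: sub_finite_set (finite_preimage (f := fun k : S * G => (val k.1, k.2)) _ fin).
    move=> [j g] [y' [Wy' o]]; split; last by exists y'.
    exact: set_mem (valP j).
  by move=> [j g] [j' g'] _ _ /= [/val_inj -> ->].
have [X [trans lip time Xm Xp]] := complete_field
  (fun j => cell_local_field (tj j)) cover locfin
  (fun j => cell_radius_small (tj j)) e0.
have charts : manifold_charts (fun p : patch => dom p : set N) kap (kinv e0).
  split.
  - exact: bundle_hausdorff.
  - exact: dom_open.
  - by move=> p e dp; exact: (kap_continuous dp).
  - by move=> p e dp; exact: (kinv_continuous dp).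
  - by move=> p e dp; exact: kapK.
have [Phi [fl sol uniq]] := complete_flow charts trans lip time.
have [_ Phi0 _] := fl.
exists Phi; split => // [h s t' e|t' e t'0].
  have := uniq _ (solution_act_bundle Xm h s (sol e)) t'.
  by rewrite Phi0.
by have := solution_positive Xp (sol e) t'0; rewrite Phi0.
Qed.

(** * Descent to the sphere bundle *)

Local Notation S := (sphere_bundle u).

Lemma act_bundle_continuous g s : continuous (act_bundle g s : N -> N).
Proof.
move=> e; apply: continuous_N.
  rewrite (_ : (fun t' => _) = fun e' : N => act g (val e').1); last first.
    by apply/funext => e'; rewrite val_act_bundle.
  have [_ _ /(_ g)[ac _]] := actP.
  apply: (@continuous_comp _ _ _ (fun e' : N => (val e').1) (act g)); last exact: ac.
  exact: base_continuous.
have sl : linear (fun v => coords (scaled_act g s (uncoords v : Q))).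
  by move=> c v v'; rewrite !linearP.
have [B hB] := linear_mulmx sl.
rewrite (_ : (fun t' => _) = fun e' : N => coords (val e').2 *m B); last first.
  by apply/funext => e'; rewrite val_act_bundle/= -hB coordsK.
apply: (@continuous_comp _ _ _ (fun e' : N => coords (val e').2) (fun v => v *m B)).
  exact: fibre_continuous.
apply: c11v_continuous => j; apply: (c11_comp_linear (f := fun v => v 0 j)).
exact: c11_coord.
Qed.

Lemma ray_act_bundle s e : ray (act_bundle 1%g s e) = ray e :> S.
Proof.
apply/esym/ray_eqP/asboolP; rewrite val_act_bundle/=.
have [a1 _ _] := actP; rewrite a1; split => //; exists (expR s).
  exact: expR_gt0.
have := scaled_act1 (val e).2; rewrite /scaled_act expR0 scale1r => h.
by rewrite scale_lfunE h.
Qed.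

Lemma ray_eq e e' : ray e = ray e' :> S -> exists s, e' = act_bundle 1%g s e.
Proof.
move=> /ray_eqP/asboolP[x12 [c c0 q12]]; exists (ln c); apply: val_inj.
rewrite val_act_bundle; have [a1 _ _] := actP.
rewrite a1 [LHS]surjective_pairing x12 q12; congr pair.
have := scaled_act1 (val e).2; rewrite /scaled_act expR0 scale1r => h.
by rewrite scale_lfunE h lnK.
Qed.

Lemma ray_continuous : continuous (@ray R V M u).
Proof. exact: pi_continuous. Qed.

Lemma ray_repr (z : S) : ray (repr z) = z.
Proof. exact: reprK. Qed.

(** The saturation of an open set is the union of its rescalings. Openness of the projection is what
    gives continuity of the flow jointly in time and ray. *)
Lemma ray_open (O : set N) : open O -> open (@ray R V M u @` O).
Proof.
move=> oO; rewrite /open/= /quotient_open.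
rewrite (_ : _ @^-1` _ = \bigcup_(s in setT) (act_bundle 1%g s @^-1` O)).
  by apply: bigcup_open => s _; apply: open_comp => // e _; exact: act_bundle_continuous.
apply/seteqP; split => [e [e' Oe' /esym/ray_eq[s es]]|e [s _ Oe]].
  by exists s => //=; rewrite -es.
by exists (act_bundle 1%g s e) => //; exact: ray_act_bundle.
Qed.

Theorem equivariant_fitting_flow : exists Psi : R -> S -> S,
  fitting_flow Psi /\ equivariant_flow act rho Psi.
Proof.
have [Phi [[Pc P0 PD] Pe Pp]] := bundle_flow.
pose Psi t (z : S) : S := ray (Phi t (repr z)).
(* Independence of the representative, since Phi commutes with scalings. *)
have PsiE t e : Psi t (ray e) = ray (Phi t e).
  have [s es] := ray_eq (esym (ray_repr (ray e))).
  by rewrite /Psi es Pe ray_act_bundle.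
exists Psi; split; last first.
  move=> g t e e' [f [f' [<- <- vf]]].
  have fE : f' = act_bundle g 0 f.
    apply: val_inj; rewrite val_act_bundle vf.
    by rewrite scale_lfunE expR0 scale1r.
  exists (Phi t f), (Phi t f'); rewrite !PsiE; split => //.
  rewrite fE Pe val_act_bundle.
  by rewrite scale_lfunE expR0 scale1r.
split; last first.
  move=> t z t0; exists (repr z), (Phi t (repr z)); split => //.
    exact: ray_repr.
  exact: Pp.
split; last first.
- by move=> s t z; rewrite -(ray_repr z) !PsiE PD.
- by move=> z; rewrite -[z in LHS]ray_repr PsiE P0 ray_repr.
move=> [t z] A /=; rewrite -(ray_repr z) PsiE => An.
have : nbhs (t, repr z) [set p : R * N | A (ray (Phi p.1 p.2))].
  exact: (Pc (t, repr z) (@ray R V M u @^-1` A) (ray_continuous An)).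
move=> [[B O] /= [Bt Oz] BO].
have ro : nbhs (ray (repr z)) (@ray R V M u @` (interior O)).
  apply: open_nbhs_nbhs; split; first exact/ray_open/open_interior.
  by exists (repr z).
exists (B, @ray R V M u @` (interior O)) => /=; first by split.
move=> [t' z'] /= [Bt' [e' Oe' <-]]; rewrite /preimage/= PsiE.
by apply: (BO (t', e')); split => //=; exact: interior_subset Oe'.
Qed.

End InvariantFlow.

Theorem proposition4p8 (R : realType) (V : vectType R)
    (vol : ('I_(\dim {:V}) -> V) -> R) (d : nat) (M : manifold R d)
    (evenV : ~~ odd (\dim {:V})) (volP : volume_form vol) :
  (forall u : M -> {vspace qform V}, fitting_immersion u ->
     exists Phi : R -> sphere_bundle u -> sphere_bundle u, fitting_flow Phi) /\
  (forall (Gamma : groupType) (act : Gamma -> M -> M) (rho : Gamma -> 'End(V)),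
     smooth_action act -> proper_action act -> SL_representation vol rho ->
     forall u : M -> {vspace qform V}, fitting_immersion u ->
       equivariant act rho u ->
       exists Phi : R -> sphere_bundle u -> sphere_bundle u,
         fitting_flow Phi /\ equivariant_flow act rho Phi).
Proof.
split=> [u fit|Gamma act rho actP prop [_ rho1 rhoM] u fit eqv]; last first.
  exact: (equivariant_fitting_flow actP rho1 rhoM eqv fit prop).
(* Any finite group would do: with the trivial action, properness is the finiteness of the group. *)
pose G : groupType := {perm bool}; pose rho := fun _ : G => \1%VF : 'End(V).
pose act := fun (_ : G) (x : M) => x.
have rho1 : rho 1%g = \1%VF by [].
have rhoM g h : rho (g * h)%g = (rho g \o rho h)%VF by rewrite comp_lfun1l.
have actP : smooth_action act.
  split => // g; split => [x|x a b]; first exact: cvg_id.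
  exact: atlas_smooth.
have eqv : equivariant act rho u.
  move=> g x; have h q : act_form (rho g) q = q.
    by have := scaled_act1 rho1 rhoM q; rewrite /scaled_act expR0 scale1r.
  apply/esym/eqP; rewrite -[X in _ == X]lim1g; apply/eqP/eq_in_limg => q _.
  by rewrite h id_lfunE.
have prop : proper_action act.
  by move=> K _; exact: (@finite_finset {perm bool}).
have [Phi [h _]] := equivariant_fitting_flow actP rho1 rhoM eqv fit prop.
by exists Phi.
Qed.
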